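(* Let $u\in\mathscr{S}'(\mathbb{R}^d)$, and suppose $a\in C_c^\infty(\mathbb{R}^{2d})$, $z_0\in\mathbb{R}^{2d}\setminus\{0\}$, $a(z_0)=1$ and $$\|a_h^w(x,D)u\|_{L^2}=\mathcal{O}(h^\infty),\quad h\in(0,1].$$ Then there exists a relatively compact neighborhood $U$ of $z_0$ such that for every $b\in C_c^\infty(\mathbb{R}^{2d})$ with $\operatorname{supp}(b)\subseteq U$ we have $$\|b_h^w(x,D)u\|_{L^2}=\mathcal{O}(h^\infty),\quad h\in(0,1].$$
   Context: For a function $a$ on $\mathbb{R}^{2d}$ and $h>0$, $a_h(z)=a(hz)$. The Weyl quantization of a symbol $a$ is $a^w(x,D)u(x)=(2\pi)^{-d}\int_{\mathbb{R}^{2d}}e^{i(x-y)\cdot\xi}a\big(\tfrac{x+y}{2},\xi\big)u(y)\,dy\,d\xi$ for $u\in\mathscr{S}(\mathbb{R}^d)$, extended to $u\in\mathscr{S}'(\mathbb{R}^d)$ by duality. $f(h)=\mathcal{O}(h^\infty)$ for $h\in(0,1]$ means $\sup_{h\in(0,1]}h^{-N}|f(h)|<\infty$ for every integer $N\ge0$. *)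

(* Defs.v *)
From HB Require Import structures.
From mathcomp Require Import all_boot all_order all_algebra.
From mathcomp Require Import complex.
From mathcomp Require Import all_classical all_reals all_analysis.

Set Implicit Arguments.
Unset Strict Implicit.
Unset Printing Implicit Defensive.

Import Order.TTheory GRing.Theory Num.Theory.
Import numFieldNormedType.Exports.

Local Open Scope classical_set_scope.
Local Open Scope ring_scope.
Local Open Scope complex_scope.

Definition rV_display : Type -> measure_display.
Proof. exact. Qed.

Section rV_measurable.
Context (R : realType) (n : nat).

Definition rV_coord (i : 'I_n) (x : 'rV[R]_n) : measurableTypeR R := x ord0 i.

Let rV_set0 : g_sigma_preimage rV_coord set0.
Proof. exact: sigma_algebra0. Qed.

Let rV_setC A : g_sigma_preimage rV_coord A -> g_sigma_preimage rV_coord (~` A).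
Proof. exact: sigma_algebraC. Qed.

Let rV_bigcup (F : (set 'rV[R]_n)^nat) :
  (forall i, g_sigma_preimage rV_coord (F i)) ->
  g_sigma_preimage rV_coord (\bigcup_i (F i)).
Proof. exact: sigma_algebra_bigcup. Qed.

(* The Borel sigma-algebra of R^n, as the one generated by the coordinates
   (the library's construction for [n.-tuple T]). *)
HB.instance Definition _ := @isMeasurable.Build
  (rV_display R)
  'rV[R]_n (g_sigma_preimage rV_coord) rV_set0 rV_setC rV_bigcup.

Lemma measurable_rV_coord (i : 'I_n) : measurable_fun [set: 'rV[R]_n] (rV_coord i).
Proof.
move=> _ Y mY; rewrite setTI; apply: sub_sigma_algebra => /=.
rewrite -bigcup_seq/=; exists i => /=; first by rewrite mem_index_enum.
by exists Y => //; rewrite setTI.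
Qed.

Lemma measurable_fun_rV d (T : measurableType d) (f : T -> 'rV[R]_n) :
  (forall i, measurable_fun [set: T] (rV_coord i \o f)) ->
  measurable_fun [set: T] f.
Proof.
move=> mf _ A mA; rewrite setTI.
suff : g_sigma_preimage (fun i => rV_coord i \o f) `<=` measurable.
  by apply; rewrite g_sigma_preimage_comp; exists A => //; rewrite setTI.
apply: smallest_sub; first exact: sigma_algebra_measurable.
move=> B; rewrite -bigcup_seq/= => -[i _ [C mC <-]].
exact: mf.
Qed.

End rV_measurable.

Section rV_cons.
Context (R : realType) (n : nat).

Definition rV_cons (p : measurableTypeR R * 'rV[R]_n) : 'rV[R]_n.+1 :=
  \row_j oapp (p.2 ord0) p.1 (unlift ord0 j).

Definition rV_uncons (x : 'rV[R]_n.+1) : measurableTypeR R * 'rV[R]_n :=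
  (x ord0 ord0, \row_j x ord0 (lift ord0 j)).

Lemma rV_consK : cancel rV_cons rV_uncons.
Proof.
case=> t x; rewrite /rV_uncons /rV_cons mxE unlift_none /=; congr pair.
by apply/rowP => j; rewrite !mxE liftK.
Qed.

Lemma measurable_rV_cons : measurable_fun setT rV_cons.
Proof.
apply: measurable_fun_rV => i; case: (unliftP ord0 i) => [j ->|->].
- rewrite (_ : _ \o _ = rV_coord j \o snd).
    exact: measurableT_comp (@measurable_rV_coord R n j) measurable_snd.
  by apply/funext => -[t x]; rewrite /= /rV_coord mxE liftK.
- rewrite (_ : _ \o _ = fst); first exact: measurable_fst.
  by apply/funext => -[t x]; rewrite /= /rV_coord mxE unlift_none.
Qed.

Lemma measurable_rV_uncons : measurable_fun setT rV_uncons.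
Proof.
apply/measurable_fun_pairP; split; first exact: measurable_rV_coord.
apply: measurable_fun_rV => i.
rewrite (_ : _ \o _ = rV_coord (lift ord0 i)); first exact: measurable_rV_coord.
by apply/funext => x; rewrite /= /rV_coord mxE.
Qed.

Variable mu : {sigma_finite_measure set 'rV[R]_n -> \bar R}.

Definition cons_measure : set 'rV[R]_n.+1 -> \bar R :=
  pushforward (lebesgue_measure \x mu)%E rV_cons.

Let cons_measure0 : cons_measure set0 = 0%E.
Proof. by rewrite /cons_measure /pushforward preimage_set0 measure0. Qed.

Let cons_measure_ge0 A : (0 <= cons_measure A)%E.
Proof. by rewrite /cons_measure /pushforward; apply: measure_ge0. Qed.

Let cons_measure_sigma_additive : semi_sigma_additive cons_measure.
Proof.
move=> F mF tF mUF; rewrite /cons_measure /pushforward preimage_bigcup.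
apply: measure_semi_sigma_additive.
- by move=> k; rewrite -[X in measurable X]setTI; exact: measurable_rV_cons.
- apply/trivIsetP => /= i j _ _ ij; rewrite -preimage_setI.
  by move/trivIsetP : tF => /(_ _ _ _ _ ij) ->//; rewrite preimage_set0.
- rewrite -preimage_bigcup -[X in measurable X]setTI.
  exact: measurable_rV_cons.
Qed.

HB.instance Definition _ := isMeasure.Build _ _ _ cons_measure
  cons_measure0 cons_measure_ge0 cons_measure_sigma_additive.

Let cons_measure_sigma_finite : sigma_finite setT cons_measure.
Proof.
have /sigma_finiteP[F [TF ndF Foo]] := sigma_finiteT (@lebesgue_measure R).
have /sigma_finiteP[G [TG ndG Goo]] := sigma_finiteT mu.
exists (fun k => rV_uncons @^-1` (F k `*` G k)).
  rewrite -preimage_bigcup (_ : \bigcup_k _ = setT) ?preimage_setT//.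
  apply/seteqP; split=> // -[t x] _.
  have [k _ Fkt] : (\bigcup_k F k) t by rewrite -TF.
  have [l _ Glx] : (\bigcup_k G k) x by rewrite -TG.
  exists (maxn k l) => //; split.
  - by move: t Fkt; exact/subsetPset/ndF/leq_maxl.
  - by move: x Glx; exact/subsetPset/ndG/leq_maxr.
move=> k; have [mF Fk] := Foo k; have [mG Gk] := Goo k.
have mFG : measurable (F k `*` G k) by exact: measurableX.
split; first by rewrite -[X in measurable X]setTI; exact: measurable_rV_uncons.
rewrite /cons_measure /pushforward -comp_preimage.
rewrite (_ : _ \o _ = id); last by rewrite funeqE => x /=; rewrite rV_consK.
by rewrite preimage_id product_measure1E// lte_mul_pinfty// ge0_fin_numE.
Qed.

HB.instance Definition _ := Measure_isSigmaFinite.Build _ _ _ cons_measure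
  cons_measure_sigma_finite.

End rV_cons.

Fixpoint lebesgue_rV (R : realType) (n : nat) :
    {sigma_finite_measure set 'rV[R]_n -> \bar R} :=
  if n is m.+1 then cons_measure (lebesgue_rV R m) else \d_(0 : 'rV[R]_0).

(* Lebesgue measure is determined by this formula on boxes. *)
Lemma lebesgue_rV_box (R : realType) (n : nat)
    (A : 'I_n -> set (measurableTypeR R)) :
  (forall i, measurable (A i)) ->
  lebesgue_rV R n [set x | forall i, A i (x ord0 i)] =
  (\prod_(i < n) lebesgue_measure (A i))%E.
Proof.
elim: n A => [|n IHn] A mA.
  by rewrite big_ord0 /= diracE mem_set// => -[].
have mB : measurable
    [set x : 'rV[R]_n | forall i, A (lift ord0 i) (x ord0 i)].
  rewrite (_ : mkset _ =
      \bigcap_(i : 'I_n) (@rV_coord R n i @^-1` A (lift ord0 i))); last first.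
    by apply/seteqP; split=> x /= h i; [move=> _|]; exact: h.
  apply: fin_bigcap_measurable; first exact: finite_finset.
  by move=> i _; rewrite -[X in measurable X]setTI; exact: measurable_rV_coord.
rewrite big_ord_recl -(IHn (fun i => A (lift ord0 i)))// -product_measure1E//=.
rewrite /cons_measure /pushforward; congr (product_measure1 _ _ _); apply/seteqP; split=> -[t x] /=.
- move=> h; split; first by have := h ord0; rewrite mxE unlift_none.
  by move=> i; have := h (lift ord0 i); rewrite mxE liftK.
- move=> [At h] i; rewrite mxE.
  by case: (unliftP ord0 i) => [j|] -> /=.
Qed.

Section smooth.
Context (R : realType) (n : nat).
Implicit Types (f : 'rV[R]_n -> R[i]) (g : 'rV[R]_n -> R).

(* [dpartials [:: i1; ...; ik] g] is the iterated partial derivative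
   d_i1 (... (d_ik g)). *)
Definition dpartials (s : seq 'I_n) g : 'rV[R]_n -> R :=
  foldr (fun i k x => 'D_(delta_mx ord0 i) k x) g s.

Definition smooth g : Prop := forall s : seq 'I_n,
  continuous (dpartials s g) /\
  forall i x, derivable (dpartials s g) x (delta_mx ord0 i).

Definition csmooth f : Prop :=
  smooth (fun x => complex.Re (f x)) /\ smooth (fun x => complex.Im (f x)).

Definition cdpartials (s : seq 'I_n) f : 'rV[R]_n -> R[i] := fun x =>
  dpartials s (fun y => complex.Re (f y)) x +i*
  dpartials s (fun y => complex.Im (f y)) x.

Definition supp f : set 'rV[R]_n := closure [set x | f x != 0].

Definition Cc_infty f : Prop := csmooth f /\ compact (supp f).

Definition monomial (alpha : 'I_n -> nat) (x : 'rV[R]_n) : R :=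
  \prod_i x ord0 i ^+ alpha i.

(* For smooth f the order in which the derivatives are taken is immaterial. *)
Definition mpartial (beta : 'I_n -> nat) f : 'rV[R]_n -> R[i] :=
  cdpartials (flatten [seq nseq (beta i) i | i <- enum 'I_n]) f.

Definition schwartz_seminorm (alpha beta : 'I_n -> nat) f : \bar R :=
  ereal_sup [set (ComplexField.Normc.normc
    ((monomial alpha x)%:C * mpartial beta f x))%:E | x in [set: 'rV[R]_n]].

Definition schwartz f : Prop :=
  csmooth f /\ forall alpha beta, (schwartz_seminorm alpha beta f < +oo)%E.

End smooth.

Section tempered.
Context (R : realType) (d : nat).
Implicit Types (f phi psi : 'rV[R]_d -> R[i]).
Implicit Types (u : ('rV[R]_d -> R[i]) -> R[i]).

(* An element of S'(R^d) is a linear form on S(R^d), continuous for the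
   topology of the seminorms [schwartz_seminorm]. It is represented by a
   function on all of ['rV[R]_d -> R[i]], of which only the values on Schwartz
   functions are constrained or used. *)
Definition tempered u : Prop :=
  (forall (c : R[i]) phi psi, schwartz phi -> schwartz psi ->
    u (fun x => c * phi x + psi x) = c * u phi + u psi) /\
  (forall phi, schwartz phi -> forall e : R, 0 < e ->
    exists N : nat, exists2 delta : R, 0 < delta &
    forall psi, schwartz psi ->
      (forall alpha beta : 'I_d -> nat,
        (\sum_i alpha i <= N)%N -> (\sum_i beta i <= N)%N ->
        (schwartz_seminorm alpha beta (fun x => psi x - phi x)%R <= delta%:E)%E) ->
      ComplexField.Normc.normc (u psi - u phi) < e).

Definition Cintegral {disp} {T : measurableType disp}
    (mu : {measure set T -> \bar R}) (F : T -> R[i]) : R[i] :=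
  (\int[mu]_x complex.Re (F x))%R +i* (\int[mu]_x complex.Im (F x))%R.

Definition Cmeasurable f : Prop :=
  measurable_fun setT (fun x => complex.Re (f x) : measurableTypeR R) /\
  measurable_fun setT (fun x => complex.Im (f x) : measurableTypeR R).

Definition L2norm f : \bar R :=
  'N[lebesgue_rV R d]_2%:E[(fun x => (ComplexField.Normc.normc (f x))%:E)]%E.

Definition L2 f : Prop := Cmeasurable f /\ (L2norm f < +oo)%E.

(* The tempered distribution u is the function f in L^2. *)
Definition represents f u : Prop := forall phi, schwartz phi ->
  u phi = Cintegral (lebesgue_rV R d) (fun x => f x * phi x).

(* The L^2 norm of a distribution: [L2norm f] if u is given by f in L^2
   (which is then unique almost everywhere), and +oo if u is not in L^2. *)
Definition distr_L2norm u : \bar R :=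
  ereal_inf [set L2norm f | f in [set f | L2 f /\ represents f u]].

Definition dotp (x y : 'rV[R]_d) : R := \sum_i x ord0 i * y ord0 i.

Definition expi (t : R) : R[i] := cos t +i* sin t.

(* A point (x, xi) of R^{2d} is [row_mx x xi : 'rV[R]_(d + d)]. *)
Definition weyl (a : 'rV[R]_(d + d) -> R[i]) phi : 'rV[R]_d -> R[i] := fun x =>
  ((2 * pi) ^- d)%:C *
  Cintegral (lebesgue_rV R d \x lebesgue_rV R d)%E
    (fun p : 'rV[R]_d * 'rV[R]_d => let: (y, xi) := p in
      expi (dotp (x - y) xi) * a (row_mx (2^-1 *: (x + y)) xi) * phi y).

Definition reflect_xi (a : 'rV[R]_(d + d) -> R[i]) : 'rV[R]_(d + d) -> R[i] :=
  fun z => a (row_mx (lsubmx z) (- rsubmx z)).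

(* Extension to S' by duality: exchanging x and y in the kernel of a^w(x,D)
   amounts to changing xi into -xi, so the transpose of a^w(x,D) for the
   bilinear pairing (f, g) |-> \int f g is the Weyl quantization of
   a(x, -xi). For a in C_c^oo it maps S(R^d) to itself. *)
Definition weyl_distr (a : 'rV[R]_(d + d) -> R[i]) u :
    ('rV[R]_d -> R[i]) -> R[i] :=
  fun phi => u (weyl (reflect_xi a) phi).

Definition dilate (h : R) (a : 'rV[R]_(d + d) -> R[i]) : 'rV[R]_(d + d) -> R[i] :=
  fun z => a (h *: z).

End tempered.

Definition bigO_hinfty (R : realType) (F : R -> \bar R) : Prop :=
  forall N : nat,
    (ereal_sup [set (h ^- N)%:E * `|F h| | h in [set` `]0%R, 1%R]]] < +oo)%E.

(* Main.v *)
Require Import Defs.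
From mathcomp Require Import all_boot all_order all_algebra.
From mathcomp Require Import complex ring lra zify.
From mathcomp Require Import all_classical all_reals all_analysis.
From mathcomp Require Import measurable_realfun.
Import Order.TTheory GRing.Theory Num.Theory.
Import numFieldNormedType.Exports.
Set Implicit Arguments.
Unset Strict Implicit.
Unset Printing Implicit Defensive.
Local Open Scope classical_set_scope.
Local Open Scope ring_scope.
Local Open Scope complex_scope.

(** The L^2 norm of a distribution v is the best constant in
    |v(phi)| <= C |phi|_2 over Schwartz phi, by Riesz; so with
    A(x, xi) = a(x, -xi) the hypothesis reads
    |u(A_h^w phi)| <= C_N h^N |phi|_2 for all N. If A has no zero on supp B, put
    c = B / (k A) with k the constant of the Moyal expansion
      A_h^w c_h^w = k sum_(n < J) h^(2n)/n! P_n(A, c)_h^w + R,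
    whose term n = 0 is B_h^w and whose other symbols are supported in supp B.
    Hence a bound O(h^(N - e)) for all such B improves to O(h^(N + 1 - e)), where
    e is fixed, provided u(R phi) is O(h^oo) as J grows. R is O(h^(2J - 2d)) in
    the sup norm and its seminorms lose a power of h independent of J, so all its
    seminorms are small by interpolation. Take U = {Re a > 1/2}. *)

(** * Lebesgue measure on R^n *)

(** All operator bounds are crude kernel estimates: [a_h^w phi] and each of its seminorms are at
    most a negative power of h times |phi|_2. Such losses are affordable because the hypothesis
    holds for every power of h. This is why A_h^w stands on the left of c_h^w: u(A_h^w c_h^w phi) is
    the hypothesis at the test function c_h^w phi, whose L^2 norm costs only a fixed power of h. The
    exponent e is the loss of the initial estimate, fixed by d and the order of u. The constants
    depend on B, and the terms of the expansion are new symbols, so each step of the induction on N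
    treats all B at once. The expansion is the Taylor formula in t for a family of kernels: t = 1
    gives the composition, while at t = 0 the two partial Fourier transforms are taken at a common
    midpoint, so that integrating out the middle variable is a convolution. Fourier inversion
    evaluates it, with a constant k known only to be nonzero. The kernel of R serves for the sup
    norm alone. Its seminorms are bounded from R as a difference of Weyl operators, each with a loss
    that does not depend on the number of terms; this gives the loss independent of J. *)

Section rV_integral.
Context {R : realType}.
Implicit Types n : nat.

Lemma measurable_ball_rV n (x : 'rV[R]_n) (e : R) : 0 < e -> measurable (ball x e : set 'rV[R]_n).
Proof.
move=> e0.
have -> : ball x e = \bigcap_(i : 'I_n)
   (@rV_coord R n i @^-1` (ball (x ord0 i) e : set R)).
  apply/seteqP; split => y /=; first by move=> [_ b] i _; exact: b.
  by move=> b; split=> // i j; rewrite (ord1 i); exact: (b j I).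
apply: fin_bigcap_measurable; first exact: finite_finset.
move=> i _; rewrite -[X in measurable X]setTI.
exact: measurable_rV_coord measurableT _ (measurable_realfun.measurable_ball _ _).
Qed.

(** The sigma-algebra is generated by coordinates, but an open set is the union of the sup-norm
    balls of rational centre and radius 1/(k+1) that it contains, a countable family of measurable
    sets. *)
Lemma measurable_open_rV n (U : set 'rV[R]_n) : open U -> measurable U.
Proof.
move=> oU.
pose F (p : 'rV[rat]_n * nat) : set 'rV[R]_n :=
  let B := ball (map_mx ratr p.1 : 'rV[R]_n) (p.2.+1%:R^-1) in
  if `[< B `<=` U >] then B else set0.
have -> : U = \bigcup_p F p.
  apply/seteqP; split => [x Ux|x [p _]]; last first.
    by rewrite /F; case: asboolP => // pU Bx; exact: pU.
  have /nbhs_ballP[e /= e0 xeU] := oU _ Ux.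
  have [k _ ke] : exists2 k : nat, True & k.+1%:R^-1 < e / 2 :> R.
    have := near_infty_natSinv_lt (PosNum (divr_gt0 e0 (@ltr0n R 2))).
    by case=> k _ /(_ k) /= kk; exists k => //; exact: kk.
  have /choice[q hq] : forall i : 'I_n, exists q : rat,
      ratr q \in `](x ord0 i - k.+1%:R^-1), (x ord0 i + k.+1%:R^-1)[.
    by move=> i; apply: rat_in_itvoo; rewrite ltrBlDr -addrA ltrDl addr_gt0.
  exists (\row_i q i, k) => //.
  have xq : ball (map_mx ratr (\row_i q i) : 'rV[R]_n) (k.+1%:R^-1) x.
    split=> // i j; rewrite (_ : i = ord0); last exact: ord1.
    by rewrite !mxE; have := hq j; rewrite in_itv/= /ball/= ltr_distl.
  rewrite /F; case: asboolP => //= nB; case: nB => y By; apply: xeU.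
  have e2 : k.+1%:R^-1 <= e / 2 by exact: ltW.
  by apply: ball_splitr; [exact: le_ball e2 _ xq|exact: le_ball e2 _ By].
apply: countable_bigcupT_measurable => // p.
by rewrite /F; case: asboolP => // _; exact: measurable_ball_rV.
Qed.

Lemma continuous_measurable_rV n (f : 'rV[R]_n -> R) :
  continuous f -> measurable_fun setT f.
Proof.
move=> /continuousP cf; apply: (measurability _ (measurable_realfun.RGenOpens.measurableE R)) => //.
move=> _ [_ [a [b ->] <-]]; rewrite setTI.
by apply: measurable_open_rV; apply: cf; exact: interval_open.
Qed.

Local Notation leb := (@lebesgue_measure R).
Local Notation mu := (lebesgue_rV R).

Lemma measurable_affine (e v : R) :
  measurable_fun [set: measurableTypeR R] (fun x => e * x + v : measurableTypeR R).
Proof. exact: measurable_funD. Qed.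

(** Uniqueness of Lebesgue measure: e times the pushforward gives every half-open interval its
    length. *)
Lemma lebesgue_measure_affine (e v : R) (e0 : 0 < e) (A : set R) : measurable A ->
  pushforward leb (fun x => e * x + v : measurableTypeR R) A =
  ((e^-1)%:E * leb A)%E.
Proof.
move=> mA.
have einv0 : 0 <= e^-1 by rewrite invr_ge0 ltW.
have e0' : 0 <= e by exact: ltW.
have h : leb A = pushforward (mscale (NngNum e0') leb) (fun x => e * x + v : measurableTypeR R) A.
  apply: lebesgue_measure_unique => //; first exact: measurable_affine.
  move=> mf _ [[a b]] _ <-.
  rewrite /= /pushforward /mscale/=.
  rewrite (_ : _ @^-1` _ = `](a - v) / e, (b - v) / e]%classic); last first.
    by apply/seteqP; split => x /=; rewrite !in_itv/= ltr_pdivrMr// ler_pdivlMr// ltrBlDr lerBrDr mulrC.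
  rewrite !lebesgue_measure_itv/= !lte_fin ltr_pM2r ?invr_gt0// ltrD2r.
  case: ifPn => ab; last by rewrite mule0.
  by rewrite -EFinM/= -mulrBl; congr EFin; field; exact: lt0r_neq0.
by rewrite h /pushforward /mscale/= muleA -EFinM mulVf ?mul1e// lt0r_neq0.
Qed.

Lemma ge0_integral_affine (e v : R) (f : R -> \bar R) : 0 < e ->
  measurable_fun setT f -> (forall x, 0 <= f x)%E ->
  (\int[leb]_x f (e * x + v)%R = (e^-1)%:E * \int[leb]_x f x)%E.
Proof.
move=> e0 mf f0.
have einv0 : 0 <= e^-1 by rewrite invr_ge0 ltW.
rewrite -(@ge0_integral_mscale _ _ _ leb setT measurableT (NngNum einv0) f mf (fun x _ => f0 x)).
have mT := measurable_affine e v.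
have /= <- := ge0_integral_pushforward mT leb measurableT mf (fun x _ => f0 x).
by apply: eq_measure_integral => A mA _; exact: lebesgue_measure_affine.
Qed.

Lemma ge0_integral_rVS n (f : 'rV[R]_n.+1 -> \bar R) :
  measurable_fun setT f -> (forall x, 0 <= f x)%E ->
  (\int[mu n.+1]_x f x = \int[leb]_t \int[mu n]_x f (rV_cons (t, x)))%E.
Proof.
move=> mf f0.
rewrite [LHS]ge0_integral_pushforward//; last exact: measurable_rV_cons.
rewrite preimage_setT fubini_tonelli1//=.
by apply: measurableT_comp => //; exact: measurable_rV_cons.
Qed.

Lemma integral_rV0 (f : 'rV[R]_0 -> \bar R) : (\int[mu 0]_x f x)%E = f 0.
Proof.
have mf : measurable_fun setT f.
  have -> : f = cst (f 0) by apply/funext => x; rewrite [x]thinmx0.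
  exact: measurable_cst.
by rewrite /= integral_dirac// diracT mul1e.
Qed.

Lemma measurable_rV_affine n (e : R) (v : 'rV[R]_n) :
  measurable_fun setT (fun x : 'rV[R]_n => e *: x + v).
Proof.
apply: measurable_fun_rV => i.
rewrite (_ : _ \o _ = (fun t => e * t + v ord0 i : measurableTypeR R) \o @rV_coord R n i).
  exact: measurableT_comp (measurable_affine _ _) (@measurable_rV_coord R n i).
by apply/funext => x; rewrite /= /rV_coord !mxE.
Qed.

(** Tonelli peels off one coordinate at a time, and each contributes a factor 1/e. *)
Lemma ge0_integral_rV_affine n (e : R) (v : 'rV[R]_n) (f : 'rV[R]_n -> \bar R) :
  0 < e -> measurable_fun setT f -> (forall x, 0 <= f x)%E ->
  (\int[mu n]_x f (e *: x + v)%R = (e ^- n)%:E * \int[mu n]_x f x)%E.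
Proof.
move=> e0; elim: n v f => [|n IHn] v f mf f0.
  by rewrite !integral_rV0 expr0 invr1 mul1e; congr f; rewrite [LHS]thinmx0.
rewrite !ge0_integral_rVS//; last first.
  exact: measurableT_comp mf (measurable_rV_affine _ _).
pose F (p : measurableTypeR R * 'rV[R]_n) := f (rV_cons p).
have mF : measurable_fun setT F by exact: measurableT_comp mf (@measurable_rV_cons R n).
have mFt t : measurable_fun setT (fun x => F (t, x)).
  exact: measurableT_comp mF (measurable_pair1 _).
transitivity (\int[leb]_t ((e ^- n)%:E * \int[mu n]_x F ((e * t + v ord0 ord0)%R, x)))%E.
  apply: eq_integral => t _.
  rewrite -(IHn (\row_j v ord0 (lift ord0 j)) (fun x => F (e * t + v ord0 ord0, x)))//;
    last by move=> ?; exact: f0.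
  apply: eq_integral => x _; rewrite /F; congr f.
  apply/rowP => j; rewrite !mxE; case: (unliftP ord0 j) => [k|] ->/=; first by rewrite !mxE.
  by [].
have mG : measurable_fun setT (fun t => \int[mu n]_x F (t, x))%E.
  exact: (@measurable_fun_fubini_tonelli_F _ _ _ _ _ (mu n) F mF (fun p => f0 _)).
rewrite ge0_integralZl//.
- rewrite (@ge0_integral_affine e (v ord0 ord0) (fun t => \int[mu n]_x F (t, x))%E)//; last first.
    by move=> t; apply: integral_ge0 => x _; exact: f0.
  by rewrite muleA -EFinM exprS invfM mulrC.
- exact: measurableT_comp mG (measurable_affine _ _).
- by move=> t _; apply: integral_ge0 => x _; exact: f0.
- by rewrite lee_fin invr_ge0 exprn_ge0 ?ltW.
Qed.

Lemma measurable_rV_prod n (f : 'I_n -> R -> R) :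
  (forall i, measurable_fun setT (f i)) ->
  measurable_fun setT (fun x : 'rV[R]_n => \prod_(i < n) f i (x ord0 i)).
Proof.
move=> mf; apply: measurable_prod => i _.
exact: measurableT_comp (mf i) (@measurable_rV_coord R n i).
Qed.

Lemma ge0_integral_rV_prod n (f : 'I_n -> R -> R) :
  (forall i, measurable_fun setT (f i)) -> (forall i x, 0 <= f i x) ->
  (\int[mu n]_x (\prod_(i < n) f i (x ord0 i))%:E =
   \prod_(i < n) \int[leb]_t (f i t)%:E)%E.
Proof.
elim: n f => [|n IHn] f mf f0.
  by rewrite integral_rV0 !big_ord0.
have fp m (g : 'I_m -> R -> R) x : (forall i x, 0 <= g i x) ->
  (0 <= (\prod_(i < m) g i (x ord0 i))%:E)%E by move=> ?; rewrite lee_fin prodr_ge0.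
have mp m (g : 'I_m -> R -> R) : (forall i, measurable_fun setT (g i)) ->
  measurable_fun setT (fun x : 'rV[R]_m => (\prod_(i < m) g i (x ord0 i))%:E).
  by move=> mg; apply/measurable_EFinP; exact: measurable_rV_prod.
rewrite ge0_integral_rVS//; [|exact: mp|by move=> x; exact: fp].
rewrite big_ord_recl -IHn// -ge0_integralZr//.
- apply: eq_integral => t _.
  rewrite -ge0_integralZl//; [|exact: (mp n (fun i => f (lift ord0 i)))|by move=> x _;
    rewrite lee_fin prodr_ge0|by rewrite lee_fin].
  apply: eq_integral => x _; rewrite big_ord_recl /= !mxE unlift_none/= EFinM.
  by congr (_ * _%:E)%E; apply: eq_bigr => i _; rewrite mxE liftK.
- by apply/measurable_EFinP; exact: mf.
- by move=> t _; rewrite lee_fin.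
- by apply: integral_ge0 => x _; rewrite lee_fin prodr_ge0.
Qed.

End rV_integral.

(** * Complex-valued integrals *)

Notation nC := ComplexField.Normc.normc.

Lemma eq_ler (R : realType) (x y : R) : x = y -> x <= y.
Proof. by move=> ->. Qed.

Section complex_norm.
Context {R : realType}.
Implicit Types z w : R[i].

Lemma Re_add z w : complex.Re (z + w) = complex.Re z + complex.Re w.
Proof. by case: z; case: w. Qed.
Lemma Im_add z w : complex.Im (z + w) = complex.Im z + complex.Im w.
Proof. by case: z; case: w. Qed.
Lemma Re_mul z w : complex.Re (z * w) =
  complex.Re z * complex.Re w - complex.Im z * complex.Im w.
Proof. by case: z; case: w. Qed.
Lemma Im_mul z w : complex.Im (z * w) =
  complex.Re z * complex.Im w + complex.Im z * complex.Re w.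
Proof. by case: z; case: w. Qed.
Lemma Re_mulr (c : R) z : complex.Re (c%:C * z) = c * complex.Re z.
Proof. by rewrite Re_mul /= mul0r subr0. Qed.
Lemma Im_mulr (c : R) z : complex.Im (c%:C * z) = c * complex.Im z.
Proof. by rewrite Im_mul /= mul0r addr0. Qed.
Lemma Re_sum I (r : seq I) (F : I -> R[i]) :
  complex.Re (\sum_(i <- r) F i) = \sum_(i <- r) complex.Re (F i).
Proof. by elim/big_ind2 : _ => // x y z w <- <-; rewrite Re_add. Qed.
Lemma Im_sum I (r : seq I) (F : I -> R[i]) :
  complex.Im (\sum_(i <- r) F i) = \sum_(i <- r) complex.Im (F i).
Proof. by elim/big_ind2 : _ => // x y z w <- <-; rewrite Im_add. Qed.

Lemma complex_eqP z w : complex.Re z = complex.Re w -> complex.Im z = complex.Im w -> z = w.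
Proof. by case: z; case: w => a b c d /= -> ->. Qed.

Lemma nC_ge0 z : 0 <= nC z.
Proof. by case: z => a b; exact: sqrtr_ge0. Qed.
Lemma nC0 : nC (0 : R[i]) = 0.
Proof. exact: ComplexField.Normc.normc0. Qed.
Lemma nCD z w : nC (z + w) <= nC z + nC w.
Proof. exact: (@le_normcD R z w). Qed.
Lemma nCM z w : nC (z * w) = nC z * nC w.
Proof. exact: ComplexField.Normc.normcM. Qed.
Lemma nCN z : nC (- z) = nC z.
Proof. by case: z => a b /=; rewrite !sqrrN. Qed.
Lemma nCB z w : nC (z - w) <= nC z + nC w.
Proof. by rewrite -(nCN w); exact: nCD. Qed.
Lemma nCr (c : R) : nC c%:C = `|c|.
Proof. by rewrite /= expr0n addr0 sqrtr_sqr. Qed.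
Lemma nC_sqr z : nC z ^+ 2 = complex.Re z ^+ 2 + complex.Im z ^+ 2.
Proof. by case: z => a b /=; rewrite sqr_sqrtr// addr_ge0// sqr_ge0. Qed.
Lemma nC_Re z : `|complex.Re z| <= nC z.
Proof.
by rewrite -ler_sqr ?nnegrE ?nC_ge0// nC_sqr real_normK ?num_real// lerDl sqr_ge0.
Qed.
Lemma nC_Im z : `|complex.Im z| <= nC z.
Proof.
by rewrite -ler_sqr ?nnegrE ?nC_ge0// nC_sqr real_normK ?num_real// lerDr sqr_ge0.
Qed.
Lemma nC_le z : nC z <= `|complex.Re z| + `|complex.Im z|.
Proof.
rewrite -ler_sqr ?nnegrE ?nC_ge0 ?addr_ge0// nC_sqr sqrrD !real_normK ?num_real//.
by rewrite addrAC lerDl mulrn_wge0// mulr_ge0.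
Qed.
Lemma nC_eq0 z : nC z = 0 -> z = 0.
Proof. exact: ComplexField.Normc.eq0_normc. Qed.
Lemma nC_expi (t : R) : nC (expi t) = 1.
Proof. by rewrite /= cos2Dsin2 sqrtr1. Qed.
Lemma nC_sum I (r : seq I) (F : I -> R[i]) :
  nC (\sum_(i <- r) F i) <= \sum_(i <- r) nC (F i).
Proof.
elim/big_ind2 : _ => [|x y z w h1 h2|//]; first by rewrite nC0.
by apply: le_trans (nCD _ _) _; exact: lerD.
Qed.
Lemma nCi : nC ('i : R[i]) = 1.
Proof. by rewrite /= expr0n expr1n add0r sqrtr1. Qed.

Lemma expiD (s t : R) : expi (s + t) = expi s * expi t.
Proof. by apply: complex_eqP; rewrite ?Re_mul ?Im_mul /= ?cosD ?sinD// addrC. Qed.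
Lemma expi0 : expi (0 : R) = 1.
Proof. by rewrite /expi cos0 sin0. Qed.

End complex_norm.

Definition cmeas d (T : measurableType d) (R : realType) (f : T -> R[i]) : Prop :=
  measurable_fun setT (fun x => complex.Re (f x)) /\
  measurable_fun setT (fun x => complex.Im (f x)).

Definition cinteg d (T : measurableType d) (R : realType)
    (mu : {measure set T -> \bar R}) (f : T -> R[i]) : Prop :=
  mu.-integrable setT (fun x => (complex.Re (f x))%:E) /\
  mu.-integrable setT (fun x => (complex.Im (f x))%:E).

Section cmeas.
Context d (T : measurableType d) {R : realType}.
Implicit Types f g : T -> R[i].

Lemma cmeas_nC f : cmeas f -> measurable_fun setT (fun x => nC (f x)).
Proof.
move=> [mr mi].
rewrite (_ : (fun x => _) = (fun x => Num.sqrt (complex.Re (f x) ^+ 2 + complex.Im (f x) ^+ 2))); last first.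
  by apply/funext => x; case: (f x).
have ms : measurable_fun [set: R] (@Num.sqrt R).
  exact: continuous_measurable_fun (@sqrt_continuous R).
by apply: (measurableT_comp ms); apply: measurable_funD; exact: measurable_funX.
Qed.

Lemma cmeasD f g : cmeas f -> cmeas g -> cmeas (fun x => f x + g x).
Proof.
move=> [fr fi] [gr gi]; split.
  by under eq_fun do rewrite Re_add; exact: measurable_funD.
by under eq_fun do rewrite Im_add; exact: measurable_funD.
Qed.

Lemma cmeasM f g : cmeas f -> cmeas g -> cmeas (fun x => f x * g x).
Proof.
move=> [fr fi] [gr gi]; split.
  by under eq_fun do rewrite Re_mul; apply: measurable_funB; exact: measurable_funM.
by under eq_fun do rewrite Im_mul; apply: measurable_funD; exact: measurable_funM.
Qed.

Lemma cmeas_cst (c : R[i]) : cmeas (fun _ : T => c).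
Proof. by split; exact: measurable_cst. Qed.

Lemma cmeas_real (f : T -> R) : measurable_fun setT f -> cmeas (fun x => (f x)%:C).
Proof. by move=> mf; split => //=. Qed.

Lemma cmeas_expi (f : T -> R) : measurable_fun setT f -> cmeas (fun x => expi (f x)).
Proof.
move=> mf; split => /=.
  exact: measurableT_comp (continuous_measurable_fun (@continuous_cos R)) mf.
exact: measurableT_comp (continuous_measurable_fun (@continuous_sin R)) mf.
Qed.

Lemma cmeas_comp d' (U : measurableType d') (h : U -> T) f :
  cmeas f -> measurable_fun setT h -> cmeas (fun x => f (h x)).
Proof. by move=> [fr fi] mh; split; [exact: measurableT_comp fr mh|exact: measurableT_comp fi mh]. Qed.

Lemma cmeas_sum I (r : seq I) (F : I -> T -> R[i]) :
  (forall i, cmeas (F i)) -> cmeas (fun x => \sum_(i <- r) F i x).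
Proof.
move=> mF; elim: r => [|i r IH].
  by under eq_fun do rewrite big_nil; exact: cmeas_cst.
by under eq_fun do rewrite big_cons; exact: cmeasD.
Qed.

End cmeas.

Section cinteg.
Context d (T : measurableType d) {R : realType} (mu : {measure set T -> \bar R}).
Implicit Types f g : T -> R[i].

Lemma integrable_dom (f g : T -> R) : measurable_fun setT f ->
  (forall x, `|f x| <= g x) -> mu.-integrable setT (EFin \o g) ->
  mu.-integrable setT (EFin \o f).
Proof.
move=> mf fg ig; apply: le_integrable ig => //.
  exact/measurable_EFinP.
by move=> x _ /=; rewrite lee_fin (le_trans (fg x))// ler_norm.
Qed.

Lemma ge0_integrable (f : T -> R) : measurable_fun setT f -> (forall x, 0 <= f x) ->
  (\int[mu]_x (f x)%:E < +oo)%E -> mu.-integrable setT (EFin \o f).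
Proof.
move=> mf f0 fy; apply/integrableP; split; first exact/measurable_EFinP.
by under eq_integral do rewrite /= ger0_norm//.
Qed.

Lemma integrable_lt_pinfty (f : T -> R) : (forall x, 0 <= f x) ->
  mu.-integrable setT (EFin \o f) -> (\int[mu]_x (f x)%:E < +oo)%E.
Proof.
move=> f0 /integrableP[_].
by under eq_integral do rewrite /= ger0_norm//.
Qed.

Lemma integrable_scale (k : R) (f : T -> R) : mu.-integrable setT (EFin \o f) ->
  mu.-integrable setT (EFin \o (fun x => k * f x)).
Proof.
by move=> fi; have := integrableZl measurableT k fi; apply: eq_integrable => // x _ /=; rewrite EFinM.
Qed.

Lemma cinteg_dom f (g : T -> R) : cmeas f -> (forall x, nC (f x) <= g x) ->
  mu.-integrable setT (EFin \o g) -> cinteg mu f.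
Proof.
move=> [fr fi] fg ig; split.
  by apply: (@integrable_dom _ g) => // x; apply: le_trans (fg x); exact: nC_Re.
by apply: (@integrable_dom _ g) => // x; apply: le_trans (fg x); exact: nC_Im.
Qed.

Lemma cinteg_cmeas f : cinteg mu f -> cmeas f.
Proof. by move=> [/integrableP[/measurable_EFinP ? _] /integrableP[/measurable_EFinP ? _]]. Qed.

Lemma cinteg_nC f : cinteg mu f -> mu.-integrable setT (EFin \o (fun x => nC (f x))).
Proof.
move=> cf; have mf := cinteg_cmeas cf; case: cf => fr fi.
apply: (@integrable_dom _ (fun x => `|complex.Re (f x)| + `|complex.Im (f x)|)).
- exact: cmeas_nC.
- by move=> x; rewrite ger0_norm ?nC_ge0// nC_le.
- by have := integrableD measurableT (integrable_abse fr) (integrable_abse fi).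
Qed.

Lemma cintegD f g : cinteg mu f -> cinteg mu g -> cinteg mu (fun x => f x + g x).
Proof.
move=> [fr fi] [gr gi]; split.
  by under eq_fun do rewrite Re_add EFinD; exact: integrableD.
by under eq_fun do rewrite Im_add EFinD; exact: integrableD.
Qed.

Lemma cintegZ (c : R[i]) f : cinteg mu f -> cinteg mu (fun x => c * f x).
Proof.
move=> cf; apply: (@cinteg_dom _ (fun x => nC c * nC (f x))).
- by apply: cmeasM; [exact: cmeas_cst|exact: cinteg_cmeas].
- by move=> x; rewrite nCM.
- exact: (integrable_scale (nC c) (cinteg_nC cf)).
Qed.

Lemma Re_Cint f : complex.Re (Cintegral mu f) = (\int[mu]_x complex.Re (f x))%R.
Proof. by []. Qed.
Lemma Im_Cint f : complex.Im (Cintegral mu f) = (\int[mu]_x complex.Im (f x))%R.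
Proof. by []. Qed.

Lemma eq_Cint f g : (forall x, f x = g x) -> Cintegral mu f = Cintegral mu g.
Proof. by move=> fg; congr Cintegral; apply/funext. Qed.

Lemma CintD f g : cinteg mu f -> cinteg mu g ->
  Cintegral mu (fun x => f x + g x) = Cintegral mu f + Cintegral mu g.
Proof.
move=> [fr fi] [gr gi]; apply: complex_eqP.
  rewrite Re_add !Re_Cint -RintegralD//.
  by apply: eq_Rintegral => x _; rewrite Re_add.
rewrite Im_add !Im_Cint -RintegralD//.
by apply: eq_Rintegral => x _; rewrite Im_add.
Qed.

Lemma CintZ (c : R[i]) f : cinteg mu f ->
  Cintegral mu (fun x => c * f x) = c * Cintegral mu f.
Proof.
move=> [fr fi]; have fz r : mu.-integrable setT (EFin \o (fun x => r * complex.Re (f x))).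
  exact: (integrable_scale r fr).
have fz' r : mu.-integrable setT (EFin \o (fun x => r * complex.Im (f x))).
  exact: (integrable_scale r fi).
apply: complex_eqP.
  rewrite Re_mul !Re_Cint !Im_Cint -!RintegralZl// -RintegralB//.
  by apply: eq_Rintegral => x _; rewrite Re_mul.
rewrite Im_mul !Re_Cint !Im_Cint -!RintegralZl// -RintegralD//.
by apply: eq_Rintegral => x _; rewrite Im_mul.
Qed.

Lemma cintegB f g : cinteg mu f -> cinteg mu g -> cinteg mu (fun x => f x - g x).
Proof.
move=> cf cg; have := cintegD cf (cintegZ (-1) cg).
by under [X in _ X -> _]eq_fun do rewrite mulN1r.
Qed.

Lemma CintB f g : cinteg mu f -> cinteg mu g ->
  Cintegral mu (fun x => f x - g x) = Cintegral mu f - Cintegral mu g.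
Proof.
move=> cf cg; have := CintD cf (cintegZ (-1) cg).
by rewrite CintZ// mulN1r => <-; apply: eq_Cint => x; rewrite mulN1r.
Qed.

Lemma cinteg0 : cinteg mu (fun _ => 0 : R[i]).
Proof. by split; exact: integrable0. Qed.

Lemma Cint0 : Cintegral mu (fun _ => 0 : R[i]) = 0.
Proof. by rewrite /Cintegral /= Rintegral_cst// !mul0r. Qed.

Lemma cinteg_sum I (r : seq I) (F : I -> T -> R[i]) :
  (forall i, cinteg mu (F i)) -> cinteg mu (fun x => \sum_(i <- r) F i x).
Proof.
move=> iF; elim: r => [|i r IH].
  by under eq_fun do rewrite big_nil; exact: cinteg0.
by under eq_fun do rewrite big_cons; exact: cintegD.
Qed.

Lemma Cint_sum I (r : seq I) (F : I -> T -> R[i]) :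
  (forall i, cinteg mu (F i)) ->
  Cintegral mu (fun x => \sum_(i <- r) F i x) = \sum_(i <- r) Cintegral mu (F i).
Proof.
move=> iF; elim: r => [|i r IH].
  by rewrite big_nil -[RHS]Cint0; apply: eq_Cint => x; rewrite big_nil.
rewrite big_cons -IH -CintD//; last exact: cinteg_sum.
by apply: eq_Cint => x; rewrite big_cons.
Qed.

(** The factor 2 comes from treating real and imaginary parts separately; the estimates below are
    all up to constants. *)
Lemma nC_Cint_le f (g : T -> R) : cinteg mu f -> (forall x, nC (f x) <= g x) ->
  mu.-integrable setT (EFin \o g) ->
  nC (Cintegral mu f) <= 2 * (\int[mu]_x g x)%R.
Proof.
move=> [fr fi] fg ig; apply: le_trans (nC_le _) _.
have h (h : T -> R) : mu.-integrable setT (EFin \o h) -> (forall x, `|h x| <= g x) ->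
   `|(\int[mu]_x h x)%R| <= (\int[mu]_x g x)%R.
  move=> ih hg; apply: le_trans (le_normr_Rintegral measurableT ih) _.
  by apply: le_Rintegral => //; exact: integrable_norm.
rewrite mulrDl mul1r; apply: lerD.
  by apply: h => // x; apply: le_trans (fg x); exact: nC_Re.
by apply: h => // x; apply: le_trans (fg x); exact: nC_Im.
Qed.

Lemma Cint_cvg (f_ : nat -> T -> R[i]) (f : T -> R[i]) (g : T -> R) :
  (forall n, cmeas (f_ n)) -> cmeas f ->
  (forall x, (fun n => complex.Re (f_ n x)) @ \oo --> complex.Re (f x)) ->
  (forall x, (fun n => complex.Im (f_ n x)) @ \oo --> complex.Im (f x)) ->
  mu.-integrable setT (EFin \o g) -> (forall n x, nC (f_ n x) <= g x) ->
  (fun n => complex.Re (Cintegral mu (f_ n))) @ \oo --> complex.Re (Cintegral mu f) /\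
  (fun n => complex.Im (Cintegral mu (f_ n))) @ \oo --> complex.Im (Cintegral mu f).
Proof.
move=> mf_ mf cr ci ig fg.
have h (h_ : nat -> T -> R) (h : T -> R) : (forall n, measurable_fun setT (h_ n)) ->
    measurable_fun setT h -> (forall x, (fun n => h_ n x) @ \oo --> h x) ->
    (forall n x, `|h_ n x| <= g x) ->
    (fun n => \int[mu]_x h_ n x)%R @ \oo --> (\int[mu]_x h x)%R.
  move=> mh_ mh ch hg.
  have := @dominated_cvg _ _ _ mu setT measurableT (fun n x => (h_ n x)%:E) (fun x => (h x)%:E) (EFin \o g).
  move=> /(_ (fun n => proj2 (measurable_EFinP _ _) (mh_ n))) D.
  (* The limit inherits the majorant g, since |h_n x| converges to |h x|. *)
  have ih : mu.-integrable setT (EFin \o h).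
    apply: (@integrable_dom _ g) => // x.
    have := ch x => /(cvg_norm) cn.
    rewrite -(cvg_lim _ cn)//; apply: limr_le; first by apply/cvg_ex; eexists; exact: cn.
    by apply: nearW => n; exact: hg.
  apply: fine_cvg; rewrite fineK; last exact: integrable_fin_num.
  apply: D => //.
    by move=> x _; apply: cvg_EFin; [exact: nearW|exact: ch].
  by move=> n x _; rewrite lee_fin.
split; apply: h.
- by move=> n; case: (mf_ n).
- by case: mf.
- by [].
- by move=> n x; apply: le_trans (fg n x); exact: nC_Re.
- by move=> n; case: (mf_ n).
- by case: mf.
- by [].
- by move=> n x; apply: le_trans (fg n x); exact: nC_Im.
Qed.

End cinteg.

Section fubini.
Context d1 d2 (T1 : measurableType d1) (T2 : measurableType d2) {R : realType}.
Variables (m1 : {sigma_finite_measure set T1 -> \bar R})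
  (m2 : {sigma_finite_measure set T2 -> \bar R}).

(** No integrability is assumed: the real integral is [fine] of the difference of the integrals of
    the positive and negative parts, and Tonelli makes each of these measurable in the parameter. *)
Lemma measurable_Rint_param (f : T1 * T2 -> R) : measurable_fun setT f ->
  measurable_fun setT (fun x => \int[m2]_y f (x, y))%R.
Proof.
move=> mf; rewrite /Rintegral; apply: measurableT_comp => //.
under eq_fun do rewrite integralE.
have mEf : measurable_fun setT (fun p => (f p)%:E) by exact/measurable_EFinP.
apply: emeasurable_funB.
- have h := @measurable_fun_fubini_tonelli_F _ _ _ _ _ m2 ((fun p =>
    (f p)%:E)^\+)%E (measurable_funepos mEf) (fun p => funepos_ge0 _ p); congr (measurable_fun _ _): h;
    apply/funext => x; apply: eq_integral => y _; by rewrite !funeposE.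
- have h := @measurable_fun_fubini_tonelli_F _ _ _ _ _ m2 ((fun p =>
    (f p)%:E)^\-)%E (measurable_funeneg mEf) (fun p => funeneg_ge0 _ p); congr (measurable_fun _ _): h;
    apply/funext => x; apply: eq_integral => y _; by rewrite !funenegE.
Qed.

Lemma cmeas_Cint_param (f : T1 * T2 -> R[i]) : cmeas f ->
  cmeas (fun x => Cintegral m2 (fun y => f (x, y))).
Proof.
move=> [fr fi]; split.
  exact: (measurable_Rint_param fr).
exact: (measurable_Rint_param fi).
Qed.

(** Fubini for extended reals, plus the remark that [fine] alters the inner integral only where it
    is infinite, hence on a null set. *)
Lemma Rint_fubini1 (f : T1 * T2 -> R) :
  (m1 \x m2)%E.-integrable setT (EFin \o f) ->
  (\int[m1]_x \int[m2]_y f (x, y))%R = (\int[(m1 \x m2)%E]_z f z)%R.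
Proof.
move=> intf; rewrite /Rintegral -(integral12_prod_meas1 intf); congr fine.
have ig := integrable_fubini_F intf.
apply: ae_eq_integral => //.
- apply/measurable_EFinP; apply: measurable_Rint_param.
  by apply/measurable_EFinP; exact: measurable_int intf.
- exact: measurable_int ig.
- have := integrable_ae measurableT ig.
  apply: filterS => x /(_ I) h _; rewrite /= fineK//.
Qed.

Lemma Rint_fubini2 (f : T1 * T2 -> R) :
  (m1 \x m2)%E.-integrable setT (EFin \o f) ->
  (\int[m2]_y \int[m1]_x f (x, y))%R = (\int[(m1 \x m2)%E]_z f z)%R.
Proof.
move=> intf; rewrite /Rintegral -(integral21_prod_meas1 intf); congr fine.
have mg := measurable_fubini_G intf.
have mf : measurable_fun setT f by apply/measurable_EFinP; exact: measurable_int intf.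
have m1g : measurable_fun setT (fun y => (fine (\int[m1]_x (f (x, y))%:E)%E)%:E).
  by apply/measurable_EFinP; apply: measurableT_comp.
apply: ae_eq_integral => //.
have := ae_integrable2 intf.
  apply: filterS => x h _; rewrite /= fineK//; exact: integrable_fin_num h.
Qed.

Lemma Cint_fubini1 (f : T1 * T2 -> R[i]) : cinteg (m1 \x m2)%E f ->
  Cintegral m1 (fun x => Cintegral m2 (fun y => f (x, y))) = Cintegral (m1 \x m2)%E f.
Proof.
move=> [fr fi]; apply: complex_eqP; rewrite !(Re_Cint,Im_Cint).
  exact: (@Rint_fubini1 (fun p => complex.Re (f p)) fr).
exact: (@Rint_fubini1 (fun p => complex.Im (f p)) fi).
Qed.

Lemma Cint_fubini2 (f : T1 * T2 -> R[i]) : cinteg (m1 \x m2)%E f ->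
  Cintegral m2 (fun y => Cintegral m1 (fun x => f (x, y))) = Cintegral (m1 \x m2)%E f.
Proof.
move=> [fr fi]; apply: complex_eqP; rewrite !(Re_Cint,Im_Cint).
  exact: (@Rint_fubini2 (fun p => complex.Re (f p)) fr).
exact: (@Rint_fubini2 (fun p => complex.Im (f p)) fi).
Qed.

Lemma integrable_prod (g : T1 -> R) (h : T2 -> R) :
  (forall x, 0 <= g x) -> (forall y, 0 <= h y) ->
  m1.-integrable setT (EFin \o g) -> m2.-integrable setT (EFin \o h) ->
  (m1 \x m2)%E.-integrable setT (EFin \o (fun p => g p.1 * h p.2)).
Proof.
move=> g0 h0 ig ih.
have mg : measurable_fun setT g by apply/measurable_EFinP; exact: measurable_int ig.
have mh : measurable_fun setT h by apply/measurable_EFinP; exact: measurable_int ih.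
apply/integrable12ltyP.
  apply/measurable_EFinP; apply: measurable_funM.
    exact: measurableT_comp mg measurable_fst.
  exact: measurableT_comp mh measurable_snd.
have hy := integrable_lt_pinfty h0 ih.
have gy := integrable_lt_pinfty g0 ig.
have hf : (\int[m2]_x (h x)%:E)%E \is a fin_num.
  by rewrite ge0_fin_numE//; apply: integral_ge0 => x _; rewrite lee_fin.
under eq_integral => x _.
  under eq_integral => y _ do rewrite /= ger0_norm ?mulr_ge0// EFinM.
  rewrite ge0_integralZl//; last first.
  - by rewrite lee_fin.
  - by move=> y _; rewrite lee_fin.
  - exact/measurable_EFinP.
  over.
rewrite /= ge0_integralZr//; last first.
- by apply: integral_ge0 => x _; rewrite lee_fin.
- by move=> y _; rewrite lee_fin.
- exact/measurable_EFinP.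
apply: lte_mul_pinfty => //; first by apply: integral_ge0 => x _; rewrite lee_fin.
by rewrite ge0_fin_numE//; apply: integral_ge0 => x _; rewrite lee_fin.
Qed.

End fubini.

Section rV_change.
Context {R : realType} (n : nat).
Local Notation mu := (lebesgue_rV R n).

Lemma integrable_rV_affine (e : R) (v : 'rV[R]_n) (f : 'rV[R]_n -> R) : 0 < e ->
  mu.-integrable setT (EFin \o f) ->
  mu.-integrable setT (EFin \o (fun x => f (e *: x + v))).
Proof.
move=> e0 /integrableP[mf fy]; apply/integrableP; split.
  exact: measurableT_comp mf (measurable_rV_affine _ _).
rewrite /= (@ge0_integral_rV_affine _ _ e v (fun x => `|(f x)%:E|)%E)//; last first.
  exact: measurableT_comp.
rewrite lte_mul_pinfty// ?lee_fin ?invr_ge0 ?exprn_ge0 ?ltW//.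
Qed.

Lemma Rint_rV_affine (e : R) (v : 'rV[R]_n) (f : 'rV[R]_n -> R) : 0 < e ->
  mu.-integrable setT (EFin \o f) ->
  (\int[mu]_x f (e *: x + v))%R = e ^- n * (\int[mu]_x f x)%R.
Proof.
move=> e0 If; have mf : measurable_fun setT (EFin \o f) by exact: measurable_int If.
rewrite /Rintegral.
have h (g : 'rV[R]_n -> \bar R) := @ge0_integral_rV_affine _ n e v g e0.
rewrite integralE [in RHS]integralE.
have mp : measurable_fun setT ((EFin \o f)^\+)%E by exact: measurable_funepos.
have mn : measurable_fun setT ((EFin \o f)^\-)%E by exact: measurable_funeneg.
have := h _ mp (fun x => funepos_ge0 _ x); have := h _ mn (fun x => funeneg_ge0 _ x).
rewrite (_ : (\int[mu]_x _)%E = (\int[mu]_x (fun x => (f (e *: x + v))%:E)^\- x)%E); last first.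
  by apply: eq_integral => x _; rewrite !funenegE.
move=> ->; rewrite (_ : (\int[mu]_x _)%E = (\int[mu]_x (fun x => (f (e *: x + v))%:E)^\+ x)%E); last first.
  by apply: eq_integral => x _; rewrite !funeposE.
move=> ->.
have fp := integral_funepos_lt_pinfty measurableT If; have fn := integral_funeneg_lt_pinfty measurableT If.
have : (\int[mu]_x ((EFin \o f)^\+ x) \is a fin_num)%E.
  by rewrite ge0_fin_numE//; exact: integral_ge0.
have : (\int[mu]_x ((EFin \o f)^\- x) \is a fin_num)%E.
  by rewrite ge0_fin_numE//; exact: integral_ge0.
move: (\int[mu]_x _)%E => a; move: (\int[mu]_x _)%E => b.
case: a => // a _; case: b => // b _ /=; ring.
Qed.

Lemma cinteg_rV_affine (e : R) (v : 'rV[R]_n) (f : 'rV[R]_n -> R[i]) : 0 < e ->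
  cinteg mu f -> cinteg mu (fun x => f (e *: x + v)).
Proof.
move=> e0 [fr fi]; split.
  exact: (@integrable_rV_affine e v (fun x => complex.Re (f x))).
exact: (@integrable_rV_affine e v (fun x => complex.Im (f x))).
Qed.

Lemma Cint_rV_affine (e : R) (v : 'rV[R]_n) (f : 'rV[R]_n -> R[i]) : 0 < e ->
  cinteg mu f ->
  Cintegral mu (fun x => f (e *: x + v)) = (e ^- n)%:C * Cintegral mu f.
Proof.
move=> e0 [fr fi]; apply: complex_eqP; rewrite ?Re_mulr ?Im_mulr !(Re_Cint, Im_Cint).
  exact: (@Rint_rV_affine e v (fun x => complex.Re (f x))).
exact: (@Rint_rV_affine e v (fun x => complex.Im (f x))).
Qed.

Lemma Cint_rV_shift (v : 'rV[R]_n) (f : 'rV[R]_n -> R[i]) :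
  cinteg mu f -> Cintegral mu (fun x => f (x + v)) = Cintegral mu f.
Proof.
move=> cf; have := Cint_rV_affine v (@ltr01 R) cf.
by rewrite expr1n invr1 mul1r => <-; apply: eq_Cint => x; rewrite scale1r.
Qed.

End rV_change.

(** * Derivatives of complex-valued functions of a real variable *)

Definition cder (R : realType) (g : R -> R[i]) (t : R) (l : R[i]) : Prop :=
  is_derive t 1 (fun x => complex.Re (g x)) (complex.Re l) /\
  is_derive t 1 (fun x => complex.Im (g x)) (complex.Im l).

Section cder.
Context {R : realType}.
Implicit Types (f g : R -> R[i]) (t : R).

Lemma cderD f g t a b : cder f t a -> cder g t b -> cder (fun x => f x + g x) t (a + b).
Proof.
move=> [fr fi] [gr gi]; split.
  by under eq_fun do rewrite Re_add; rewrite Re_add; exact: is_deriveD.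
by under eq_fun do rewrite Im_add; rewrite Im_add; exact: is_deriveD.
Qed.

Lemma cderM f g t a b : cder f t a -> cder g t b ->
  cder (fun x => f x * g x) t (a * g t + f t * b).
Proof.
move=> [fr fi] [gr gi]; split.
  under eq_fun do rewrite Re_mul.
  by apply: is_derive_eq; rewrite Re_add !Re_mul /GRing.scale/=; ring.
under eq_fun do rewrite Im_mul.
by apply: is_derive_eq; rewrite Im_add !Im_mul /GRing.scale/=; ring.
Qed.

Lemma cder_cst (c : R[i]) t : cder (fun _ => c) t 0.
Proof. by split => /=; exact: is_derive_cst. Qed.

Lemma cderZ c f t a : cder f t a -> cder (fun x => c * f x) t (c * a).
Proof.
by move=> fa; have := cderM (cder_cst c t) fa; rewrite mul0r add0r.
Qed.

Lemma cder_sum I (r : seq I) (F : I -> R -> R[i]) (L : I -> R[i]) t :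
  (forall i, cder (F i) t (L i)) ->
  cder (fun x => \sum_(i <- r) F i x) t (\sum_(i <- r) L i).
Proof.
move=> dF; elim: r => [|i r IH].
  by under eq_fun do rewrite big_nil; rewrite big_nil; exact: cder_cst.
by under eq_fun do rewrite big_cons; rewrite big_cons; exact: cderD.
Qed.

Lemma cder_expi (a b : R) t :
  cder (fun x => expi (a + x * b)) t ('i * b%:C * expi (a + t * b)).
Proof.
have d1 : is_derive t 1 (fun x : R => a + x * b) b.
  by apply: is_derive_eq; rewrite /GRing.scale/=; ring.
have dc : is_derive t 1 (fun x : R => cos (a + x * b)) (- sin (a + t * b) * b).
  have := @is_derive1_comp R cos (fun x => a + x * b) t _ _ (is_derive_cos (a + t * b)) d1. exact.
have ds : is_derive t 1 (fun x : R => sin (a + x * b)) (cos (a + t * b) * b).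
  have := @is_derive1_comp R sin (fun x => a + x * b) t _ _ (is_derive_sin (a + t * b)) d1. exact.
split; rewrite /expi /=.
  by apply: (is_derive_eq dc); ring.
by apply: (is_derive_eq ds); ring.
Qed.

Lemma cder_under_int d (Y : measurableType d) (mu : {measure set Y -> \bar R})
    (f f' : R -> Y -> R[i]) (a : R) (g : Y -> R) :
  (forall t, cinteg mu (f t)) -> (forall t y, cder (f^~ y) t (f' t y)) ->
  (forall t y, `|t - a| < 1 -> nC (f' t y) <= g y) ->
  mu.-integrable setT (EFin \o g) ->
  cder (fun t => Cintegral mu (f t)) a (Cintegral mu (f' a)).
Proof.
move=> cf df fg ig.
have g0 y : 0 <= g y by apply: le_trans (nC_ge0 _) (fg a y _); rewrite subrr normr0.
have Ia : `]a - 1, a + 1[%classic a by rewrite /= in_itv/= ltrBlDr ltrDl ltr01 /=.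
have h (k k' : R -> Y -> R) : (forall t, mu.-integrable setT (EFin \o k t)) ->
   (forall t y, is_derive t 1 (k^~ y) (k' t y)) ->
   (forall t y, `|t - a| < 1 -> `|k' t y| <= g y) ->
   is_derive a 1 (fun t => \int[mu]_y k t y)%R (\int[mu]_y k' a y)%R.
  move=> ik dk kg.
  have dE t y : partial1of2 k t y = k' t y by rewrite partial1of2E; exact: derive_val.
  have dk' t y : `]a - 1, a + 1[%classic t -> setT y -> derivable (k^~ y) t 1.
    by move=> _ _; exact: ex_derive.
  have kg' t y : `]a - 1, a + 1[%classic t -> setT y -> `|partial1of2 k t y| <= g y.
    move=> It _; rewrite dE; apply: kg; move: It; rewrite /= in_itv/= => /andP[? ?].
    by rewrite ltr_distl; apply/andP; split.
  have D := derivable_under_integral measurableT Ia (fun t _ => ik t) dk' g0 ig kg'.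
  have E := differentiation_under_integral measurableT Ia (fun t _ => ik t) dk' g0 ig kg'.
  apply: DeriveDef => //; rewrite -derive1E E.
  by apply: eq_Rintegral => y _; exact: dE.
split; [apply: (h (fun t y => complex.Re (f t y)) (fun t y =>
  complex.Re (f' t y)))|apply: (h (fun t y => complex.Im (f t y)) (fun t y => complex.Im (f' t y)))].
- by move=> t; case: (cf t).
- by move=> t y; case: (df t y).
- by move=> t y ta; apply: le_trans (fg t y ta); exact: nC_Re.
- by move=> t; case: (cf t).
- by move=> t y; case: (df t y).
- by move=> t y ta; apply: le_trans (fg t y ta); exact: nC_Im.
Qed.

Lemma cder_eq f t a b : cder f t a -> a = b -> cder f t b.
Proof. by move=> ? <-. Qed.

End cder.

(** * Cauchy-Schwarz inequality *)

Section cauchy_schwarz.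
Context d (T : measurableType d) {R : realType} (mu : {measure set T -> \bar R}).
Implicit Types f g : T -> R.

Definition norm2 (f : T -> R) : R := Num.sqrt (\int[mu]_x (f x ^+ 2))%R.

Lemma norm2_ge0 f : 0 <= norm2 f. Proof. exact: sqrtr_ge0. Qed.

Lemma norm2_sqr f : norm2 f ^+ 2 = (\int[mu]_x (f x ^+ 2))%R.
Proof. by rewrite sqr_sqrtr//; apply: Rintegral_ge0 => x _; exact: sqr_ge0. Qed.

Lemma integrable_M2 f g : measurable_fun setT f -> measurable_fun setT g ->
  mu.-integrable setT (EFin \o (fun x => f x ^+ 2)) ->
  mu.-integrable setT (EFin \o (fun x => g x ^+ 2)) ->
  mu.-integrable setT (EFin \o (fun x => f x * g x)).
Proof.
move=> mf mg i_f ig; apply: (@integrable_dom _ _ _ _ _ (fun x => f x ^+ 2 + g x ^+ 2)).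
- exact: measurable_funM.
- move=> x; rewrite ler_norml; apply/andP; split; nra.
- by have := integrableD measurableT i_f ig.
Qed.

(** Expand the integral of (s f - t g)^2, which is nonnegative for all s and t; s = |g| and t = |f|
    give the claim once both norms are nonzero. *)
Lemma norm2_cs f g : measurable_fun setT f -> measurable_fun setT g ->
  mu.-integrable setT (EFin \o (fun x => f x ^+ 2)) ->
  mu.-integrable setT (EFin \o (fun x => g x ^+ 2)) ->
  (\int[mu]_x (f x * g x))%R <= norm2 f * norm2 g.
Proof.
move=> mf mg i_f ig; have ifg := integrable_M2 mf mg i_f ig.
have [Af Ag] := (norm2_sqr f, norm2_sqr g).
have E s t : 0 <= s ^+ 2 * norm2 f ^+ 2 + t ^+ 2 * norm2 g ^+ 2
     - 2 * s * t * (\int[mu]_x (f x * g x))%R.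
  rewrite Af Ag -!RintegralZl//.
  have i1 := integrableZl measurableT (s ^+ 2) i_f.
  have i2 := integrableZl measurableT (t ^+ 2) ig.
  have i3 := integrableZl measurableT (2 * s * t) ifg.
  rewrite -RintegralD// -RintegralB//; last by have := integrableD measurableT i1 i2.
  by apply: Rintegral_ge0 => x _; have := sqr_ge0 (s * f x - t * g x); nra.
have [F0 G0] := (norm2_ge0 f, norm2_ge0 g).
(* If |f| = 0 the quadratic form is affine in s at t = 1, and a positive integral would make it
   negative for the s chosen here. The case |g| = 0 is symmetric. *)
have [f0'|f0] := eqVneq (norm2 f) 0; first rewrite f0'.
  rewrite mul0r leNgt; apply/negP => I0.
  have := E ((norm2 g ^+ 2 + 1) / (\int[mu]_x (f x * g x))%R) 1.
  by rewrite f0' expr0n mulr0 expr1n mulr1 mul1r -!mulrA mulVf ?gt_eqF//; nra.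
have [g0'|g0] := eqVneq (norm2 g) 0; first rewrite g0'.
  rewrite mulr0 leNgt; apply/negP => I0.
  have := E 1 ((norm2 f ^+ 2 + 1) / (\int[mu]_x (f x * g x))%R).
  by rewrite g0' expr0n mulr0 expr1n mulr1 mul1r -!mulrA mulVf ?gt_eqF//; nra.
have := E (norm2 g) (norm2 f); have : 0 < norm2 f * norm2 g by rewrite mulr_gt0// lt0r ?f0 ?g0.
nra.
Qed.

End cauchy_schwarz.

(** * Smooth functions *)

Section line_derivative.
Context {R : realType} {n : nat}.
Implicit Types (g p q : 'rV[R]_n -> R) (x v : 'rV[R]_n).
Local Notation ei := (@delta_mx R 1 n ord0).

Lemma rV_cvg g x : (forall e : R, 0 < e -> exists2 dl : R, 0 < dl &
    forall y : 'rV[R]_n, (forall i, `|x ord0 i - y ord0 i| < dl) -> `|g x - g y| < e) ->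
  g y @[y --> x] --> g x.
Proof.
move=> h; have F : ProperFilter (nbhs x) by exact: nbhs_pfilter.
apply/cvgrPdist_lt => e e0; have [dl dl0 H] := h e e0.
suff : nbhs x (fun t => `|g x - g t| < e) by [].
apply/nbhs_ballP; exists dl => //= y xy; apply: H => i.
by have [_ /(_ ord0 i)] := xy.
Qed.

Lemma rV_continuousP g : continuous g <->
  forall x (e : R), 0 < e -> exists2 dl : R, 0 < dl &
    forall y : 'rV[R]_n, (forall i, `|x ord0 i - y ord0 i| < dl) -> `|g x - g y| < e.
Proof.
split=> [cg x e e0|h x]; last by apply: rV_cvg; exact: h.
have /cvgrPdist_lt/(_ e e0)/nbhs_ballP[dl /= dl0 H] := cg x.
exists dl => // y xy; apply: H; split => // i j.
by rewrite (_ : i = ord0); [exact: xy|exact: ord1].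
Qed.

(** Both sides have the same difference quotient. Directional derivatives thus reduce to functions
    of one real variable, where the mean value theorem and the product rule are available. *)
Lemma line_derive g x v (t l : R) :
  is_derive t (1 : R) (fun s : R => g (x + s *: v)) l <-> is_derive (x + t *: v) v g l.
Proof.
have E : (fun h : R => h^-1 *: (((fun s => g (x + s *: v)) \o shift t) (h *: 1) - g (x + t *: v)))
   = (fun h => h^-1 *: ((g \o shift (x + t *: v)) (h *: v) - g (x + t *: v))).
  apply/funext => h /=; congr (_ *: (g _ - _)).
  by rewrite /shift /= scalerDl [h *: 1]mulr1 addrCA addrC -addrA [_ + h *: v]addrC.
by split=> -[D V]; constructor; move: D V; rewrite /derivable /derive -/(shift _) E.
Qed.

Lemma mvt (f df : R -> R) (s : R) : (forall x : R, is_derive x 1 f (df x)) ->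
  exists2 c, `|c| <= `|s| & f s - f 0 = df c * s.
Proof.
move=> d.
have cf (a b : R) : {within `[a, b], continuous f}.
  by apply: derivable_within_continuous => ? _; exact: ex_derive.
have [s0|s0] := leP 0 s.
  have [c + ->] := MVT_segment s0 (fun (x : R) _ => d x) (cf 0 s).
  by rewrite in_itv/= => /andP[c0 cs]; exists c; rewrite ?subr0// !ger0_norm.
have [c + E] := MVT_segment (ltW s0) (fun (x : R) _ => d x) (cf s 0).
rewrite in_itv/= => /andP[c0 cs]; exists c; last by rewrite -opprB E sub0r mulrN opprK.
by rewrite !ler0_norm ?lerN2// ltW.
Qed.

Definition pd (i : 'I_n) g : 'rV[R]_n -> R := fun x => 'D_(ei i) g x.

Lemma pd_line g i x (t : R) : (forall y, derivable g y (ei i)) ->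
  is_derive t (1 : R) (fun s : R => g (x + s *: ei i)) (pd i g (x + t *: ei i)).
Proof. by move=> dg; apply/line_derive; exact: DeriveDef. Qed.

Lemma line_pd g i x (l : R) : is_derive (0 : R) (1 : R) (fun s : R => g (x + s *: ei i)) l ->
  derivable g x (ei i) /\ pd i g x = l.
Proof.
move/line_derive; rewrite scale0r addr0 => D.
by split; [exact: ex_derive|rewrite /pd derive_val].
Qed.

(** As [r] grows to the full enumeration, these are the vertices of a path from 0 to v that changes
    one coordinate at a time, each leg being parallel to an axis. *)
Definition subvec (r : seq 'I_n) v := \sum_(i <- r) v ord0 i *: ei i.

Lemma subvec_enum v : subvec (enum 'I_n) v = v.
Proof.
rewrite /subvec [RHS]row_sum_delta.
by rewrite enumT.
Qed.

Lemma subvec_coord r v j : uniq r -> `|subvec r v ord0 j| <= `|v ord0 j|.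
Proof.
rewrite /subvec summxE => ur; have [jr|jr] := boolP (j \in r).
  rewrite (bigD1_seq j)//= big1 ?addr0; last first.
    by move=> i ij; rewrite !mxE eqxx/= eq_sym (negbTE ij) mulr0.
  by rewrite !mxE !eqxx mulr1.
rewrite big1_seq ?normr0// => i /andP[_ ir]; rewrite !mxE eqxx/=.
by case: eqP ir jr => [->->//|]; rewrite mulr0.
Qed.

Lemma bounded_pd_lipschitz g (B : R) : (forall i x, derivable g x (ei i)) ->
  (forall i x, `|pd i g x| <= B) ->
  forall x v, `|g (x + v) - g x| <= B * \sum_i `|v ord0 i|.
Proof.
move=> dg bg x v.
have H r : `|g (x + subvec r v) - g x| <= B * \sum_(i <- r) `|v ord0 i|.
  elim: r => [|i r IH]; first by rewrite /subvec !big_nil addr0 subrr normr0 mulr0.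
  rewrite /subvec !big_cons -/(subvec r v) mulrDr.
  have [c _] := mvt (v ord0 i) (fun t => pd_line (x + subvec r v) t (dg i)).
  rewrite scale0r addr0 -addrA [subvec r v + _]addrC => E.
  rewrite -(subrKA (g (x + subvec r v))) (le_trans (ler_normD _ _))// lerD//.
  by rewrite E normrM ler_wpM2r.
have := H (enum 'I_n); rewrite subvec_enum.
by rewrite enumT.
Qed.

Lemma bounded_pd_continuous g (B : R) : (forall i x, derivable g x (ei i)) ->
  (forall i x, `|pd i g x| <= B) -> continuous g.
Proof.
move=> dg bg; apply/rV_continuousP => x e e0.
have [n0|n0] := posnP n.
  exists 1 => // y _; rewrite (_ : y = x) ?subrr ?normr0//.
  by apply/rowP; case=> i ii; exfalso; move: (ii); rewrite n0.
have B0 : 0 <= B by apply: le_trans (bg (Ordinal n0) x).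
have n1 : 0 < (B + 1) * n%:R by rewrite mulr_gt0 ?ltr0n// ltr_wpDl.
exists (e / ((B + 1) * n%:R)); first by rewrite divr_gt0.
move=> y xy; rewrite distrC -[y](subrK x) [y - x + x]addrC.
apply: le_lt_trans (bounded_pd_lipschitz dg bg x (y - x)) _.
have S : \sum_i `|(y - x) ord0 i| <= n%:R * (e / ((B + 1) * n%:R)).
  rewrite -[X in X%:R * _]card_ord -sum1_card natr_sum mulr_suml.
  by apply: ler_sum => i _; rewrite mul1r !mxE distrC ltW.
apply: le_lt_trans (ler_wpM2l B0 S) _.
rewrite invfM !mulrA -[B * _ * e](mulrAC) .
have nn : n%:R != 0 :> R by rewrite pnatr_eq0 -lt0n.
rewrite (_ : _ * _ = e * (B / (B + 1))); last by field; rewrite nn gt_eqF// ltr_wpDl.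
rewrite gtr_pMr// ltr_pdivrMr ?mul1r ?ltrDl// ltr_wpDl//.
Qed.

(** Along the axis-parallel path from x to x + h v, the mean value theorem on each leg produces a
    partial derivative at an intermediate point, which tends to its value at x by continuity. *)
Lemma C1_is_derive g x v : (forall i x, derivable g x (ei i)) ->
  (forall i, continuous (pd i g)) ->
  is_derive (0 : R) (1 : R) (fun s : R => g (x + s *: v)) (\sum_i v ord0 i * pd i g x).
Proof.
move=> dg cg.
have H r : uniq r -> forall e : R, 0 < e -> exists2 dl : R, 0 < dl & forall h, `|h| < dl ->
    `|g (x + h *: subvec r v) - g x - h * \sum_(i <- r) v ord0 i * pd i g x| <= e * `|h|.
  elim: r => [_ e e0|i r IH /= /andP[ir ur] e e0].
    by exists 1 => // h _; rewrite /subvec !big_nil scaler0 addr0 subrr mulr0 subrr normr0 mulr_ge0// ltW.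
  have e20 : 0 < e / 2 by rewrite divr_gt0.
  have [d1 d10 H1] := IH ur _ e20.
  pose M := \sum_j `|v ord0 j| + 1.
  have M0 : 0 < M by rewrite ltr_wpDl// sumr_ge0.
  have e3 : 0 < e / 2 / M by rewrite divr_gt0.
  have [d2 d20 H2] := (rV_continuousP _).1 (cg i) x _ e3.
  (* M bounds every |v_i|, so the start of the last leg and the displacement c along it each move a
     coordinate by at most d2 / 2. *)
  exists (Num.min d1 (d2 / (2 * M))); first by rewrite lt_min d10/= divr_gt0// mulr_gt0.
  move=> h; rewrite lt_min => /andP[hd1 hd2].
  rewrite /subvec !big_cons -/(subvec r v) scalerDr scalerA mulrDr.
  have [c cc] := mvt (h * v ord0 i) (fun t => pd_line (x + h *: subvec r v) t (dg i)).
  rewrite scale0r addr0 -addrA [_ *: subvec r v + _]addrC => E.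
  rewrite (_ : _ - _ - _ = (g (x + h *: subvec r v) - g x - h * \sum_(j <- r) v ord0 j * pd j g x) +
    (pd i g (x + h *: subvec r v + c *: ei i) - pd i g x) * (h * v ord0 i)); last first.
    by rewrite mulrBl -E; ring.
  apply: le_trans (ler_normD _ _) _.
  rewrite [X in _ <= X](_ : _ = e / 2 * `|h| + e / 2 * `|h|); last by rewrite -mulrDl -splitr.
  apply: lerD; first exact: H1.
  have vM j : `|v ord0 j| <= M.
    rewrite /M (bigD1 j)//= -addrA lerDl addr_ge0// sumr_ge0//.
  rewrite normrM distrC.
  have : `|pd i g x - pd i g (x + h *: subvec r v + c *: ei i)| <= e / 2 / M.
    apply/ltW/H2 => j; rewrite !mxE -addrA opprD addNKr normrN.
    apply: le_lt_trans (ler_normD _ _) _; rewrite [d2]splitr ltr_leD//.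
      rewrite normrM; apply: le_lt_trans (ler_wpM2l (normr_ge0 _) (subvec_coord v j ur)) _.
      apply: le_lt_trans (ler_wpM2l (normr_ge0 _) (vM j)) _.
      by rewrite -ltr_pdivlMr// -mulrA -invfM.
    rewrite normrM eqxx/=.
    have : `|h * v ord0 i| <= d2 / 2.
      rewrite normrM; apply: le_trans (ler_wpM2l (normr_ge0 _) (vM i)) _.
      by rewrite -ler_pdivlMr// -mulrA -invfM ltW.
    move=> hv; apply: le_trans (le_trans cc hv).
    by case: (j == i); rewrite ?normr1 ?mulr1// normr0 mulr0.
  move=> Hp; apply: le_trans (ler_wpM2r (normr_ge0 _) Hp) _.
  rewrite normrM [`|h| * _]mulrC mulrA ler_wpM2r//.
  by rewrite -[e / 2 / M * _]mulrA ger_pMr// mulrC ler_pdivrMr// mul1r.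
have HH := H (enum 'I_n) (enum_uniq _).
have SE : \sum_(i <- enum 'I_n) v ord0 i * pd i g x = \sum_i v ord0 i * pd i g x.
  by rewrite enumT.
have C : h^-1 *: (((fun s => g (x + s *: v)) \o shift 0) (h *: 1) - g (x + 0 *: v)) @[h --> 0^']
   --> (\sum_i v ord0 i * pd i g x).
  apply/cvgrPdist_le => e e0; have [dl dl0 D] := HH e e0.
  near=> h; rewrite /= addr0 [h *: 1]mulr1 scale0r addr0.
  have h0 : h != 0 by near: h; exact: nbhs_dnbhs_neq.
  have hd : `|h| < dl by near: h; apply: dnbhs0_lt.
  have := D h hd; rewrite subvec_enum SE => D'.
  rewrite -[X in `|X - _|](mulKf h0) -mulrBr normrM distrC.
  by rewrite normfV ler_pdivrMl ?normr_gt0// [`|h| * e]mulrC.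
apply: DeriveDef; first by apply/cvg_ex; exists (\sum_i v ord0 i * pd i g x).
exact: cvg_lim C.
Unshelve. all: by end_near. Qed.

Lemma C1_line g x v (t : R) : (forall i x, derivable g x (ei i)) ->
  (forall i, continuous (pd i g)) ->
  is_derive t (1 : R) (fun s : R => g (x + s *: v)) (\sum_i v ord0 i * pd i g (x + t *: v)).
Proof.
move=> dg cg; apply/line_derive.
have := C1_is_derive (x + t *: v) v dg cg.
by move/line_derive; rewrite scale0r addr0.
Qed.

End line_derivative.

Section smooth.
Context {R : realType} {n : nat}.
Implicit Types (g p q : 'rV[R]_n -> R) (x v : 'rV[R]_n).
Local Notation ei := (@delta_mx R 1 n ord0).

(** Finite-order smoothness, recursive in the order: closure under products and quotients can then
    be proved by induction on k and transferred to [smooth] by [smoothP]. *)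
Fixpoint Ck (k : nat) g : Prop := continuous g /\
  if k is k'.+1 then forall i, (forall x, derivable g x (ei i)) /\ Ck k' (pd i g) else True.

Lemma Ck_continuous k g : Ck k g -> continuous g. Proof. by case: k => [|k] []. Qed.

Lemma CkW k g : Ck k.+1 g -> Ck k g.
Proof.
elim: k g => [|k IH] g [cg h]; first by [].
by split => // i; have [dg ck] := h i; split => //; exact: IH.
Qed.

Lemma dpartials_rcons s i g : dpartials (rcons s i) g = dpartials s (pd i g).
Proof. by rewrite /dpartials foldr_rcons. Qed.

Lemma smooth_pd i g : smooth g -> smooth (pd i g).
Proof.
by move=> sg s; have := sg (rcons s i); rewrite dpartials_rcons.
Qed.

Lemma smooth_continuous g : smooth g -> continuous g.
Proof. by move=> /(_ [::])[]. Qed.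

Lemma smooth_derivable g i x : smooth g -> derivable g x (ei i).
Proof. by move=> /(_ [::])[_]. Qed.

Lemma smoothP g : smooth g <-> forall k, Ck k g.
Proof.
split=> [sg k|h s].
  elim: k g sg => [|k IH] g sg /=; first by split=> //; exact: smooth_continuous.
  split; first exact: smooth_continuous.
  by move=> i; split; [move=> x; exact: smooth_derivable|exact/IH/smooth_pd].
have H k : Ck (size s + k) g -> Ck k (dpartials s g).
  elim: s k {h} => [|i s IH] k; first by [].
  by rewrite [size _]/= addSnnS => /IH[_ /(_ i)[]].
have [cg dg] := H 1%N (h _); split => // i x.
by have [] := dg i.
Qed.

Lemma pdD i p q x : derivable p x (ei i) -> derivable q x (ei i) ->
  pd i (fun x => p x + q x) x = pd i p x + pd i q x.
Proof. by move=> dp dq; rewrite /pd -deriveD. Qed.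

Lemma pdM i p q x : derivable p x (ei i) -> derivable q x (ei i) ->
  pd i (fun x => p x * q x) x = p x * pd i q x + q x * pd i p x.
Proof.
move=> dp dq; have := deriveM dp dq; rewrite /GRing.scale/= => <-.
by [].
Qed.

Lemma CkD k p q : Ck k p -> Ck k q -> Ck k (fun x => p x + q x).
Proof.
elim: k p q => [|k IH] p q [cp hp] [cq hq]; have c : continuous (fun x => p x + q x).
- by move=> x; exact: (cvgD (cp x) (cq x)).
- by [].
- by move=> x; exact: (cvgD (cp x) (cq x)).
split=> // i; have [dp Cp] := hp i; have [dq Cq] := hq i.
split; first by move=> x; exact: derivableD.
rewrite (_ : pd i _ = fun x => pd i p x + pd i q x); first exact: IH.
by apply/funext => x; exact: pdD.
Qed.

Lemma CkM k p q : Ck k p -> Ck k q -> Ck k (fun x => p x * q x).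
Proof.
elim: k p q => [|k IH] p q Cp Cq; have c : continuous (fun x => p x * q x).
- by move=> x; exact: (cvgM (@Ck_continuous _ _ Cp x) (@Ck_continuous _ _ Cq x)).
- by [].
- by move=> x; exact: (cvgM (@Ck_continuous _ _ Cp x) (@Ck_continuous _ _ Cq x)).
split=> // i; have [dp Cp'] := (proj2 Cp) i; have [dq Cq'] := (proj2 Cq) i.
split; first by move=> x; exact: derivableM.
rewrite (_ : pd i _ = fun x => p x * pd i q x + q x * pd i p x).
  by apply: CkD; apply: IH => //; exact: CkW.
by apply/funext => x; exact: pdM.
Qed.

Lemma pd_cst i (c : R) x : pd i (fun _ : 'rV[R]_n => c) x = 0.
Proof. exact: derive_cst. Qed.

Lemma Ck_cst k (c : R) : Ck k (fun _ => c).
Proof.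
elim: k c => [|k IH] c; first by split => //; exact: cst_continuous.
split; first exact: cst_continuous.
move=> i; split; first by move=> x; exact: derivable_cst.
rewrite (_ : pd i _ = fun _ => 0); first exact: IH.
by apply/funext => x; exact: pd_cst.
Qed.

Lemma smoothD p q : smooth p -> smooth q -> smooth (fun x => p x + q x).
Proof. by move=> /smoothP sp /smoothP sq; apply/smoothP => k; exact: CkD. Qed.
Lemma smoothM p q : smooth p -> smooth q -> smooth (fun x => p x * q x).
Proof. by move=> /smoothP sp /smoothP sq; apply/smoothP => k; exact: CkM. Qed.
Lemma smooth_cst (c : R) : smooth (fun _ : 'rV[R]_n => c).
Proof. by apply/smoothP => k; exact: Ck_cst. Qed.
Lemma smoothN p : smooth p -> smooth (fun x => - p x).
Proof.
move=> sp; rewrite (_ : (fun x => _) = fun x => (-1) * p x).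
  exact: smoothM (smooth_cst _) sp.
by apply/funext => x; rewrite mulN1r.
Qed.
Lemma smoothB p q : smooth p -> smooth q -> smooth (fun x => p x - q x).
Proof. by move=> sp sq; exact: (smoothD sp (smoothN sq)). Qed.

Lemma smooth_line g x v (t : R) : smooth g ->
  is_derive t (1 : R) (fun s : R => g (x + s *: v)) (\sum_i v ord0 i * pd i g (x + t *: v)).
Proof.
move=> sg; apply: C1_line; first by move=> i y; exact: smooth_derivable.
by move=> i; apply: smooth_continuous; exact: smooth_pd.
Qed.

Lemma smooth_coord j : smooth (fun x => x ord0 j).
Proof.
have D i x : derivable (fun x : 'rV[R]_n => x ord0 j) x (ei i) /\
    pd i (fun x : 'rV[R]_n => x ord0 j) x = (i == j)%:R.
  apply: line_pd.
  have -> : (fun s : R => (x + s *: ei i) ord0 j) = (fun s => x ord0 j + s * (i == j)%:R).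
    by apply/funext => s; rewrite !mxE eqxx eq_sym.
  by apply: is_derive_eq; rewrite /GRing.scale/=; ring.
have c : continuous (fun x : 'rV[R]_n => x ord0 j) by exact: coord_continuous.
apply/smoothP => -[|k]; first by split.
split => // i; split; first by move=> x; have [] := D i x.
rewrite (_ : pd i _ = fun _ => (i == j)%:R); first exact: Ck_cst.
by apply/funext => x; have [] := D i x.
Qed.

Lemma pd_eq0 i g x : ~ closure [set x | g x != 0] x -> pd i g x = 0.
Proof.
move=> xs; rewrite -(pd_cst i 0 x); apply: near_eq_derive.
have : nbhs x (~` closure [set x | g x != 0]).
  by apply: open_nbhs_nbhs; split=> //; apply: closed_openC; exact: closed_closure.
apply: filterS => y ys; apply/eqP/negPn/negP => gy.
by apply: ys; exact: subset_closure.
Qed.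

Lemma closure_neq0W p q : (forall x, q x != 0 -> closure [set y | p y != 0] x) ->
  closure [set x | q x != 0] `<=` closure [set x | p x != 0].
Proof.
move=> h; have H : [set x | q x != 0] `<=` closure [set x | p x != 0] by move=> x; exact: h.
have := closure_subset H.
by have /closure_id <- := @closed_closure _ [set x | p x != 0].
Qed.

Lemma notin_closure_eq0 p x : ~ closure [set y | p y != 0] x ->
  \forall y \near x, p y = 0.
Proof.
move=> xs; have : nbhs x (~` closure [set x | p x != 0]).
  by apply: open_nbhs_nbhs; split=> //; apply: closed_openC; exact: closed_closure.
apply: filterS => y ys; apply/eqP/negPn/negP => gy.
by apply: ys; exact: subset_closure.
Qed.

Section division.
Variables (p q : 'rV[R]_n -> R).
Hypotheses (sp : smooth p) (sq : smooth q).
Hypothesis pq : forall x, closure [set y | p y != 0] x -> q x != 0.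

(** Off the closed support of p the quotient is locally 0 whatever q does there, because division by
    zero returns 0. *)
Let z x : ~ closure [set y | p y != 0] x -> \forall y \near x, p y / q y = 0.
Proof. by move/notin_closure_eq0; apply: filterS => y ->; rewrite mul0r. Qed.

Lemma continuous_div : continuous (fun x => p x / q x).
Proof.
move=> x; have [xs|xs] := pselect (closure [set y | p y != 0] x).
  have cV : (q y)^-1 @[y --> x] --> (q x)^-1.
    exact: (cvgV (pq xs) (@smooth_continuous _ sq x)).
  exact: (cvgM (@smooth_continuous _ sp x) cV).
have zx := z xs; rewrite /continuous_at (nbhs_singleton zx).
exact: cvg_near_cst zx.
Qed.

Lemma pd_div i x : derivable (fun x => p x / q x) x (ei i) /\
  pd i (fun x => p x / q x) x = (pd i p x * q x - p x * pd i q x) / (q x * q x).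
Proof.
have [xs|xs] := pselect (closure [set y | p y != 0] x); last first.
  have zx := z xs; have zx' : \forall y \near x, 0 = p y / q y by move: zx; apply: filterS => y ->.
  split.
    have d0 : derivable (fun _ : 'rV[R]_n => 0 : R) x (ei i) by exact: derivable_cst.
    exact: near_eq_derivable zx' d0.
  rewrite /pd (near_eq_derive _ zx) -/(pd i p x) pd_eq0// derive_cst.
  by rewrite (nbhs_singleton (notin_closure_eq0 xs)) !mul0r subrr mul0r.
apply: line_pd.
have dp := pd_line x 0 (fun y => @smooth_derivable _ i y sp).
have dq := pd_line x 0 (fun y => @smooth_derivable _ i y sq).
have q0 : q (x + 0 *: ei i) != 0 by rewrite scale0r addr0; exact: pq.
have := is_deriveM dp (is_deriveV q0 dq).
rewrite scale0r addr0 => H; apply: (is_derive_eq H).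
by rewrite /GRing.scale/=; field; exact: pq.
Qed.

Lemma closure_div_num i x :
  closure [set y | pd i p y * q y - p y * pd i q y != 0] x -> q x * q x != 0.
Proof.
move=> xs; suff /pq qx : closure [set y | p y != 0] x by rewrite mulf_neq0.
move: x xs; apply: (@closure_neq0W p _) => x; apply: contraPP => nx.
by rewrite pd_eq0// (nbhs_singleton (notin_closure_eq0 nx)) !mul0r subrr eqxx.
Qed.

End division.

(** A derivative of p / q is a quotient of the same kind: its numerator is supported where p is, and
    its denominator q^2 has no zero there. The induction therefore runs over all such pairs. *)
Lemma smooth_div p q : smooth p -> smooth q ->
  (forall x, closure [set y | p y != 0] x -> q x != 0) ->
  smooth (fun x => p x / q x).
Proof.
move=> sp sq pq; apply/smoothP => k.
elim: k p q sp sq pq => [|k IH] p q sp sq pq.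
  by split => //; exact: continuous_div.
split; first exact: continuous_div.
move=> i; split; first by move=> x; have [] := pd_div sp sq pq i x.
rewrite (_ : pd i _ = fun x => (pd i p x * q x - p x * pd i q x) / (q x * q x)); last first.
  by apply/funext => x; have [] := pd_div sp sq pq i x.
apply: IH.
- exact: (smoothB (smoothM (smooth_pd i sp) sq) (smoothM sp (smooth_pd i sq))).
- exact: smoothM.
- by move=> x; exact: closure_div_num.
Qed.

Lemma Ck_scale_coord k (c : 'I_n -> R) g : smooth g ->
  Ck k (fun x => g (\row_i (c i * x ord0 i))).
Proof.
have D h i x : smooth h -> derivable (fun x => h (\row_i (c i * x ord0 i))) x (ei i) /\
    pd i (fun x => h (\row_i (c i * x ord0 i))) x = c i * pd i h (\row_i (c i * x ord0 i)).
  move=> sh; apply: line_pd.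
  have := smooth_line (\row_i (c i * x ord0 i)) (c i *: ei i) 0 sh.
  rewrite scale0r addr0 (bigD1 i)//= big1 ?addr0; last first.
    by move=> j ij; rewrite !mxE eqxx/= (negbTE ij) mulr0 mul0r.
  rewrite !mxE !eqxx mulr1 => H.
  rewrite (_ : (fun s => _) = (fun s : R => h (\row_j (c j * x ord0 j) + s *: (c i *: ei i)))) //.
  apply/funext => s; congr h; apply/rowP => j; rewrite !mxE eqxx/=.
  by case: eqP => [->|_]; rewrite ?mulr1 ?mulr0 ?addr0//; ring.
have C h : smooth h -> continuous (fun x => h (\row_i (c i * x ord0 i))).
  move=> sh; apply/rV_continuousP => x e e0.
  have [d d0 H] := (rV_continuousP _).1 (smooth_continuous sh) (\row_i (c i * x ord0 i)) e e0.
  pose M := \sum_i `|c i| + 1.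
  have M0 : 0 < M by rewrite ltr_wpDl// sumr_ge0.
  exists (d / M); first by rewrite divr_gt0.
  move=> y xy; apply: H => i; rewrite !mxE -mulrBr normrM.
  have cM : `|c i| <= M by rewrite /M (bigD1 i)//= -addrA lerDl addr_ge0// sumr_ge0.
  apply: le_lt_trans (ler_wpM2r (normr_ge0 _) cM) _.
  by rewrite mulrC -ltr_pdivlMr.
elim: k g => [|k IH] g sg; first by split => //; exact: C.
split; first exact: C.
move=> i; split; first by move=> x; have [] := D g i x sg.
rewrite (_ : pd i _ = fun x => c i * pd i g (\row_i (c i * x ord0 i))); last first.
  by apply/funext => x; have [] := D g i x sg.
by apply: CkM; [exact: Ck_cst|apply: IH; exact: smooth_pd].
Qed.

Lemma pd_scale_coord (c : 'I_n -> R) g i x : smooth g ->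
  pd i (fun x => g (\row_i (c i * x ord0 i))) x = c i * pd i g (\row_i (c i * x ord0 i)).
Proof.
move=> sh.
have H : is_derive (0 : R) (1 : R) (fun s : R => g (\row_j (c j * (x + s *: ei i) ord0 j)))
   (c i * pd i g (\row_j (c j * x ord0 j))).
  have := smooth_line (\row_i (c i * x ord0 i)) (c i *: ei i) 0 sh.
  rewrite scale0r addr0 (bigD1 i)//= big1 ?addr0; last first.
    by move=> j ij; rewrite !mxE eqxx/= (negbTE ij) mulr0 mul0r.
  rewrite !mxE !eqxx mulr1 => H.
  rewrite (_ : (fun s => _) = (fun s : R => g (\row_j (c j * x ord0 j) + s *: (c i *: ei i)))) //.
  apply/funext => s; congr g; apply/rowP => j; rewrite !mxE eqxx/=.
  by case: eqP => [->|_]; rewrite ?mulr1 ?mulr0 ?addr0//; ring.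
by have [_] := @line_pd _ _ (fun x => g (\row_i (c i * x ord0 i))) i x _ H.
Qed.

End smooth.

(** * Complex-valued smooth functions and their supports *)

Section csmooth.
Context {R : realType} {n : nat}.
Implicit Types (f g a b : 'rV[R]_n -> R[i]) (x v : 'rV[R]_n).

Definition cD (i : 'I_n) f : 'rV[R]_n -> R[i] := fun x =>
  pd i (fun y => complex.Re (f y)) x +i* pd i (fun y => complex.Im (f y)) x.

Definition cX (i : 'I_n) f : 'rV[R]_n -> R[i] := fun x => (x ord0 i)%:C * f x.

Lemma cdpartials_rcons s i f : cdpartials (rcons s i) f = cdpartials s (cD i f).
Proof. by apply/funext => x; rewrite /cdpartials !dpartials_rcons. Qed.

Lemma csmooth_cD i f : csmooth f -> csmooth (cD i f).
Proof. by move=> [fr fi]; split; exact: smooth_pd. Qed.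

Lemma csmoothD f g : csmooth f -> csmooth g -> csmooth (fun x => f x + g x).
Proof.
move=> [fr fi] [gr gi]; split.
  by under eq_fun do rewrite Re_add; exact: (smoothD fr gr).
by under eq_fun do rewrite Im_add; exact: (smoothD fi gi).
Qed.

Lemma csmoothM f g : csmooth f -> csmooth g -> csmooth (fun x => f x * g x).
Proof.
move=> [fr fi] [gr gi]; split.
  by under eq_fun do rewrite Re_mul; exact: (smoothB (smoothM fr gr) (smoothM fi gi)).
by under eq_fun do rewrite Im_mul; exact: (smoothD (smoothM fr gi) (smoothM fi gr)).
Qed.

Lemma csmooth_cst (c : R[i]) : csmooth (fun _ : 'rV[R]_n => c).
Proof. by split; exact: smooth_cst. Qed.

Lemma csmoothZ (c : R[i]) f : csmooth f -> csmooth (fun x => c * f x).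
Proof. exact: csmoothM (csmooth_cst c). Qed.

Lemma csmooth_cmeas f : csmooth f -> cmeas f.
Proof.
move=> [fr fi]; by split; apply: continuous_measurable_rV; [move: fr|move: fi]; exact: smooth_continuous.
Qed.

Lemma csmooth_line f x v (t : R) : csmooth f ->
  cder (fun s => f (x + s *: v)) t (\sum_i (v ord0 i)%:C * cD i f (x + t *: v)).
Proof.
move=> [fr fi]; split.
  apply: (is_derive_eq (smooth_line x v t fr)); rewrite Re_sum.
  by apply: eq_bigr => i _; rewrite Re_mulr.
apply: (is_derive_eq (smooth_line x v t fi)); rewrite Im_sum.
by apply: eq_bigr => i _; rewrite Im_mulr.
Qed.

Lemma cDD i f g x : csmooth f -> csmooth g ->
  cD i (fun y => f y + g y) x = cD i f x + cD i g x.
Proof.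
move=> [fr fi] [gr gi]; apply: complex_eqP; rewrite ?Re_add ?Im_add /=.
  by under eq_fun do rewrite Re_add; rewrite pdD//; exact: smooth_derivable.
by under eq_fun do rewrite Im_add; rewrite pdD//; exact: smooth_derivable.
Qed.

Lemma pdB i (p q : 'rV[R]_n -> R) x : smooth p -> smooth q ->
  pd i (fun x => p x - q x) x = pd i p x - pd i q x.
Proof.
move=> sp sq; rewrite (pdD (q := fun x => - q x)) /=.
- congr (_ + _); rewrite -[RHS]mulN1r.
  rewrite (_ : (fun _ => _) = fun x => (-1) * q x); last by apply/funext => y; rewrite mulN1r.
  have dc : derivable (fun _ : 'rV[R]_n => (-1 : R)) x (delta_mx ord0 i) by exact: derivable_cst.
  by rewrite (pdM dc) ?pd_cst ?mulr0 ?addr0//; exact: smooth_derivable.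
- exact: smooth_derivable.
- by have := smoothN sq; exact: smooth_derivable.
Qed.

Lemma cDM i f g x : csmooth f -> csmooth g ->
  cD i (fun y => f y * g y) x = cD i f x * g x + f x * cD i g x.
Proof.
move=> [fr fi] [gr gi]; have D p : smooth p -> derivable p x (delta_mx ord0 i) by exact: smooth_derivable.
apply: complex_eqP; rewrite ?Re_add ?Im_add ?Re_mul ?Im_mul /=.
  under eq_fun do rewrite Re_mul.
  rewrite (@pdB _ (fun y => complex.Re (f y) * complex.Re (g y)) (fun y =>
    complex.Im (f y) * complex.Im (g y))).
  - by rewrite (pdM (D _ fr) (D _ gr)) (pdM (D _ fi) (D _ gi)); ring.
  - exact: (smoothM fr gr).
  - exact: (smoothM fi gi).
under eq_fun do rewrite Im_mul.
rewrite (@pdD _ _ i (fun y => complex.Re (f y) * complex.Im (g y)) (fun y =>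
  complex.Im (f y) * complex.Re (g y))).
- by rewrite (pdM (D _ fr) (D _ gi)) (pdM (D _ fi) (D _ gr)); ring.
- exact: (D _ (smoothM fr gi)).
- exact: (D _ (smoothM fi gr)).
Qed.

Lemma cD_cst i (c : R[i]) x : cD i (fun _ : 'rV[R]_n => c) x = 0.
Proof. by rewrite /cD !pd_cst. Qed.

Lemma cDZ i (c : R[i]) f x : csmooth f -> cD i (fun y => c * f y) x = c * cD i f x.
Proof.
by move=> sf; rewrite (cDM i x (csmooth_cst c) sf) cD_cst mul0r add0r.
Qed.

Lemma supp_sub f g : (forall x, f x != 0 -> supp g x) -> supp f `<=` supp g.
Proof.
move=> h; have H : [set x | f x != 0] `<=` supp g by move=> x; exact: h.
have := closure_subset H.
by have /closure_id <- : closed (supp g) by exact: closed_closure.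
Qed.

Lemma supp_neq0 f x : f x != 0 -> supp f x.
Proof. exact: (@subset_closure _ [set x | f x != 0] x). Qed.

Lemma notin_supp f x : ~ supp f x -> f x = 0.
Proof. by move=> h; apply/eqP/negPn/negP => /supp_neq0. Qed.

Lemma cD_supp i f : supp (cD i f) `<=` supp f.
Proof.
apply: supp_sub => x; apply: contraPP => nx.
have S (q : 'rV[R]_n -> R) : (forall y, f y = 0 -> q y = 0) ->
    ~ closure [set y | q y != 0] x.
  move=> fq xs; apply: nx; move: xs; apply: closure_subset => y /= qy.
  by apply: contra qy => /eqP fy; rewrite fq.
move/eqP; apply; rewrite /cD !pd_eq0//; apply: S => y fy; by rewrite fy.
Qed.

Lemma compact_bound (K : set 'rV[R]_n) (g : 'rV[R]_n -> R) : compact K -> continuous g ->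
  exists2 M : R, 0 <= M & forall x, K x -> `|g x| <= M.
Proof.
move=> cK cg; have cgK : compact (g @` K).
  by apply: continuous_compact => //; exact: continuous_subspaceT.
have [M [Mr MH]] := compact_bounded cgK.
exists (`|M| + 1); first by rewrite addr_ge0.
move=> x Kx; apply: MH; last by exists x.
by rewrite (le_lt_trans (ler_norm M))// ltrDl.
Qed.

Lemma Cc_bound a : Cc_infty a -> exists B rho : R, [/\ 0 <= B, 0 < rho,
  forall z, nC (a z) <= B & forall z, a z != 0 -> forall i, `|z ord0 i| <= rho].
Proof.
move=> [[sr si] ca].
have [B1 B10 H1] := compact_bound ca (smooth_continuous sr).
have [B2 B20 H2] := compact_bound ca (smooth_continuous si).
have /choice[M HM] : forall i : 'I_n, exists M : R, 0 <= M /\ forall x, supp a x -> `|x ord0 i| <= M.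
  move=> i; have ci : continuous (fun x : 'rV[R]_n => x ord0 i) by exact: coord_continuous.
  by have [M M0 H] := compact_bound ca ci; exists M.
exists (B1 + B2), (\sum_i M i + 1); split.
- exact: addr_ge0.
- by rewrite ltr_wpDl// sumr_ge0// => i _; have [] := HM i.
- move=> z; have [zs|zs] := pselect (supp a z).
    by apply: le_trans (nC_le _) _; apply: lerD; [exact: H1|exact: H2].
  by rewrite notin_supp// nC0 addr_ge0.
- move=> z az i; have [_ Hi] := HM i.
  apply: le_trans (Hi _ (supp_neq0 az)) _.
  rewrite (bigD1 i)//= -addrA lerDl addr_ge0// sumr_ge0// => j _; by have [] := HM j.
Qed.

Lemma Cc_sub a f : Cc_infty a -> csmooth f -> (forall x, f x != 0 -> supp a x) -> Cc_infty f.
Proof.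
move=> [sa ca] sf fa; split => //; apply: subclosed_compact ca _; first exact: closed_closure.
exact: supp_sub.
Qed.

Lemma Cc_cD i a : Cc_infty a -> Cc_infty (cD i a).
Proof.
move=> ca; apply: (Cc_sub ca); first by apply: csmooth_cD; case: ca.
by move=> x /supp_neq0; exact: cD_supp.
Qed.

Lemma CcMl f a : csmooth f -> Cc_infty a -> Cc_infty (fun x => f x * a x).
Proof.
move=> sf ca; apply: (Cc_sub ca); first exact: (csmoothM sf (proj1 ca)).
by move=> x; rewrite mulf_eq0 negb_or => /andP[_]; exact: supp_neq0.
Qed.

Lemma CcZ c a : Cc_infty a -> Cc_infty (fun x => c * a x).
Proof. exact: CcMl (csmooth_cst c). Qed.

Lemma Cc_cX i a : Cc_infty a -> Cc_infty (cX i a).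
Proof. by apply: CcMl; split; [exact: smooth_coord|exact: smooth_cst]. Qed.

Lemma CcD a b : Cc_infty a -> Cc_infty b -> Cc_infty (fun x => a x + b x).
Proof.
move=> [sa ca] [sb cb]; split; first exact: csmoothD.
apply: (@subclosed_compact _ _ (supp a `|` supp b)).
- exact: closed_closure.
- exact: compactU.
have H : [set x | a x + b x != 0] `<=` supp a `|` supp b.
  move=> x /=; have [ax|ax] := eqVneq (a x) 0; last by move=> _; left; exact: supp_neq0.
  by rewrite ax add0r => bx; right; exact: supp_neq0.
have := closure_subset H.
by have /closure_id <- : closed (supp a `|` supp b) by apply: closedU; exact: closed_closure.
Qed.

Lemma Cc0 : Cc_infty (fun _ : 'rV[R]_n => 0).
Proof.
split; first exact: csmooth_cst.
rewrite /supp (_ : [set x | _] = set0) ?closure0; first exact: compact0.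
by apply/seteqP; split => // x /=; rewrite eqxx.
Qed.

Lemma Cc_sum I (r : seq I) (F : I -> 'rV[R]_n -> R[i]) :
  (forall i, Cc_infty (F i)) -> Cc_infty (fun x => \sum_(i <- r) F i x).
Proof.
move=> sF; elim: r => [|i r IH].
  by under eq_fun do rewrite big_nil; exact: Cc0.
by under eq_fun do rewrite big_cons; exact: CcD.
Qed.

(** Diagonal substitutions are the common form of the dilation by h and of the reflection in xi,
    which are both handled through it. *)
Definition scale_coord (c : 'I_n -> R) x : 'rV[R]_n := \row_i (c i * x ord0 i).

Lemma scale_coord_continuous (c : 'I_n -> R) : continuous (scale_coord c).
Proof.
move=> x; have F : ProperFilter (nbhs x) by exact: nbhs_pfilter.
apply/cvg_ballP => e e0.
pose M := \sum_i `|c i| + 1.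
have M0 : 0 < M by rewrite ltr_wpDl// sumr_ge0.
suff : nbhs x (fun t => ball (scale_coord c x) e (scale_coord c t)) by [].
apply/nbhs_ballP; exists (e / M); first by rewrite /= divr_gt0.
move=> y [_ xy]; split => // j i; rewrite (_ : j = ord0); last exact: ord1.
have := xy ord0 i; rewrite /ball/= !mxE -mulrBr normrM => H.
have cM : `|c i| <= M by rewrite /M (bigD1 i)//= -addrA lerDl addr_ge0// sumr_ge0.
apply: le_lt_trans (ler_wpM2r (normr_ge0 _) cM) _.
by rewrite mulrC -ltr_pdivlMr.
Qed.

Lemma Cc_scale_coord (c : 'I_n -> R) a : (forall i, c i != 0) -> Cc_infty a ->
  Cc_infty (fun x => a (scale_coord c x)).
Proof.
move=> c0 [[sr si] ca]; split.
  split; apply/smoothP => k.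
    exact: (Ck_scale_coord k c sr).
  exact: (Ck_scale_coord k c si).
pose K := scale_coord (fun i => (c i)^-1) @` supp a.
have cK : compact K.
  apply: continuous_compact => //; apply: continuous_subspaceT.
  exact: scale_coord_continuous.
apply: (subclosed_compact _ cK); first exact: closed_closure.
have H : [set x | a (scale_coord c x) != 0] `<=` K.
  move=> x /= ax; exists (scale_coord c x); first exact: supp_neq0.
  by apply/rowP => i; rewrite !mxE mulKf.
have := closure_subset H.
have /closure_id <- : closed K by apply: compact_closed => //; exact: norm_hausdorff.
by [].
Qed.

Lemma cD_scale_coord (c : 'I_n -> R) i a x : csmooth a ->
  cD i (fun x => a (scale_coord c x)) x = (c i)%:C * cD i a (scale_coord c x).
Proof.
move=> [sr si]; apply: complex_eqP; rewrite ?Re_mulr ?Im_mulr /=.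
  exact: (pd_scale_coord c i x sr).
exact: (pd_scale_coord c i x si).
Qed.

End csmooth.

(** * Dilation and reflection of symbols *)

Section symbols.
Context {R : realType} {d : nat}.
Implicit Types (a b : 'rV[R]_(d + d) -> R[i]).

Lemma dilateE h a : dilate h a = fun z => a (scale_coord (fun _ => h) z).
Proof.
apply/funext => z; rewrite /dilate; congr a.
by apply/rowP => i; rewrite !mxE.
Qed.

Lemma reflectE a : reflect_xi a =
  fun z => a (scale_coord (fun i => if fintype.split i is inl _ then 1 else -1) z).
Proof.
apply/funext => z; rewrite /reflect_xi; congr a.
apply/rowP => i; case: (split_ordP i) => j ->; rewrite !(row_mxEl, row_mxEr) !mxE /=.
  by rewrite (unsplitK (inl j)) mul1r.
by rewrite (unsplitK (inr j)) mulN1r.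
Qed.

Lemma Cc_dilate h a : h != 0 -> Cc_infty a -> Cc_infty (dilate h a).
Proof. by move=> h0 ca; rewrite dilateE; exact: Cc_scale_coord. Qed.

Lemma Cc_reflect a : Cc_infty a -> Cc_infty (reflect_xi a).
Proof.
move=> ca; rewrite reflectE; apply: Cc_scale_coord => // i.
by case: (fintype.split i) => _; rewrite ?oppr_eq0 oner_neq0.
Qed.

Lemma cD_dilate h i a : csmooth a -> cD i (dilate h a) = fun z => h%:C * dilate h (cD i a) z.
Proof. by move=> sa; apply/funext => z; rewrite !dilateE cD_scale_coord. Qed.

Lemma reflect_xiK a : reflect_xi (reflect_xi a) = a.
Proof.
apply/funext => z; rewrite /reflect_xi row_mxKl row_mxKr opprK.
by rewrite hsubmxK.
Qed.

Lemma reflect_dilate h a : reflect_xi (dilate h a) = dilate h (reflect_xi a).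
Proof.
apply/funext => z; rewrite /reflect_xi /dilate; congr a.
apply/rowP => i; case: (split_ordP i) => j ->; rewrite [LHS]mxE !(row_mxEl, row_mxEr) !mxE//.
by rewrite mulrN.
Qed.

End symbols.

Lemma Cc_div (R : realType) n (a b : 'rV[R]_n -> R[i]) : csmooth a -> Cc_infty b ->
  (forall x, supp b x -> a x != 0) -> Cc_infty (fun x => b x / a x).
Proof.
move=> sa cb ba; have [[ar ai] [[br bi] _]] := (sa, cb).
pose q x := complex.Re (a x) * complex.Re (a x) + complex.Im (a x) * complex.Im (a x).
have sq : smooth q by exact: (smoothD (smoothM ar ar) (smoothM ai ai)).
have q0 x : a x != 0 -> q x != 0.
  move=> ax; rewrite /q -!expr2 -nC_sqr expf_eq0 /=.
  by apply: contra ax => /eqP/nC_eq0/eqP.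
have dq (p : 'rV[R]_n -> R) : smooth p -> (forall y, b y = 0 -> p y = 0) -> smooth (fun x => p x / q x).
  move=> sp pb; apply: smooth_div => // x xs; apply/q0/ba; move: x xs.
  by apply: closure_subset => y /= py; apply: contra py => /eqP by0; rewrite pb.
apply: (Cc_sub cb); last first.
  by move=> x; rewrite mulf_eq0 negb_or => /andP[+ _]; exact: supp_neq0.
(* Multiplication by the conjugate of a reduces the claim to real quotients by q = |a|^2. With the
   convention 1/0 = 0 the formula holds at the zeros of a as well. *)
have E x : b x / a x =
  ((complex.Re (b x) * complex.Re (a x) + complex.Im (b x) * complex.Im (a x)) / q x) +i*
  ((complex.Im (b x) * complex.Re (a x) - complex.Re (b x) * complex.Im (a x)) / q x).
  rewrite /q; case: (a x) (b x) => [a1 a2] [b1 b2].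
  by apply: complex_eqP; rewrite ?Re_mul ?Im_mul /= -!expr2; ring.
split.
  under eq_fun do rewrite E; apply: dq; first exact: (smoothD (smoothM br ar) (smoothM bi ai)).
  by move=> y -> /=; rewrite !mul0r addr0.
under eq_fun do rewrite E; apply: dq; first exact: (smoothB (smoothM bi ar) (smoothM br ai)).
by move=> y -> /=; rewrite !mul0r subr0.
Qed.

(** * Partial Fourier transform of a symbol *)

Section weights.
Context {R : realType}.
Local Notation leb := (@lebesgue_measure R).

Section product_function.
Variables (f : R -> R) (c : R).
Hypotheses (mf : measurable_fun setT f) (f0 : forall t, 0 <= f t).
Hypothesis fc : (\int[leb]_t (f t)%:E)%E = c%:E.

Definition prodf n (x : 'rV[R]_n) : R := \prod_(i < n) f (x ord0 i).

Lemma prodf_ge0 n (x : 'rV[R]_n) : 0 <= prodf x.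
Proof. exact: prodr_ge0. Qed.

Lemma measurable_prodf n : measurable_fun setT (@prodf n).
Proof. by apply: (measurable_rV_prod (f := fun _ => f)). Qed.

Lemma integral_prodf n : (\int[lebesgue_rV R n]_x (prodf x)%:E)%E = (c ^+ n)%:E.
Proof.
rewrite (ge0_integral_rV_prod (f := fun _ => f))//.
under eq_bigr do rewrite fc.
by rewrite prodEFin prodr_const card_ord.
Qed.

Lemma integrable_prodf n : (lebesgue_rV R n).-integrable setT (EFin \o @prodf n).
Proof.
apply: ge0_integrable; [exact: measurable_prodf|exact: prodf_ge0|].
by rewrite integral_prodf ltry.
Qed.

Lemma Rint_prodf n : (\int[lebesgue_rV R n]_x (prodf x))%R = c ^+ n.
Proof. by rewrite /Rintegral integral_prodf. Qed.

End product_function.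

Lemma integral_oneDsqrV : exists c : R, (\int[leb]_t ((1 + t ^+ 2)^-1)%:E)%E = c%:E.
Proof.
have c1 : continuous (fun t : R => (1 + t ^+ 2)^-1) by exact: continuous_oneDsqrV.
have p0 t : 0 <= (1 + t ^+ 2)^-1 :> R by rewrite invr_ge0 addr_ge0// sqr_ge0.
exists (2 * (pi / 2)).
rewrite ge0_symfun_integralT//; last by move=> t /=; rewrite sqrrN.
rewrite -set_itvcy (@ge0_continuous_FTC2y _ _ (@atan R) 0 (pi / 2)).
- by rewrite atan0 sube0 EFinM.
- by move=> t _.
- exact: continuous_subspaceT.
- exact: cvgy_atan.
- by move=> x _; exact: derivable_atan.
- by apply: cvg_at_right_filter; exact: continuous_atan.
- by move=> x _; rewrite derive1_atan.
Qed.

(** The product form matters: the weight is integrable by a one-dimensional computation, and each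
    factor 1 / (1 + v_j^2) is what two integrations by parts in xi_j provide. *)
Definition wt n (x : 'rV[R]_n) : R := prodf (fun t => (1 + t ^+ 2)^-1) x.

Lemma measurable_oneDsqrV : measurable_fun [set: R] (fun t : R => (1 + t ^+ 2)^-1).
Proof. by apply: continuous_measurable_fun; exact: continuous_oneDsqrV. Qed.

Lemma oneDsqrV_ge0 (t : R) : 0 <= (1 + t ^+ 2)^-1.
Proof. by rewrite invr_ge0 addr_ge0// sqr_ge0. Qed.

Lemma wt_ge0 n (x : 'rV[R]_n) : 0 <= wt x.
Proof. by apply: prodf_ge0 => t; exact: oneDsqrV_ge0. Qed.

Lemma wt_le1 n (x : 'rV[R]_n) : wt x <= 1.
Proof.
rewrite /wt /prodf; apply: prodr_ile1 => i.
by rewrite oneDsqrV_ge0/= invf_le1 ?lerDl ?sqr_ge0// ltr_wpDr// sqr_ge0.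
Qed.

Lemma wt_gt0 n (x : 'rV[R]_n) : 0 < wt x.
Proof.
by apply: prodr_gt0 => i _; rewrite invr_gt0 ltr_wpDr// sqr_ge0.
Qed.

Lemma wtN n (x : 'rV[R]_n) : wt (- x) = wt x.
Proof. by apply: eq_bigr => i _; rewrite mxE sqrrN. Qed.

Lemma wtV n (x : 'rV[R]_n) : wt x * \prod_(i < n) (1 + x ord0 i ^+ 2) = 1.
Proof.
rewrite /wt /prodf -big_split big1// => i _ /=.
by rewrite mulVf// gt_eqF// ltr_wpDr// sqr_ge0.
Qed.

Lemma measurable_wt n : measurable_fun setT (@wt n).
Proof. by have := @measurable_prodf _ measurable_oneDsqrV n. Qed.

Lemma integrable_wt n : (lebesgue_rV R n).-integrable setT (EFin \o @wt n).
Proof.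
have [c hc] := integral_oneDsqrV.
exact: integrable_prodf measurable_oneDsqrV oneDsqrV_ge0 hc _.
Qed.

Lemma integrable_wt2 n : (lebesgue_rV R n).-integrable setT (EFin \o (fun x => @wt n x ^+ 2)).
Proof.
apply: (integrable_dom _ _ (integrable_wt n)).
  by apply: measurable_funX; exact: measurable_wt.
by move=> x; rewrite ger0_norm ?sqr_ge0// expr2 ler_piMr ?wt_ge0 ?wt_le1.
Qed.

(** The indicator of a cube; it is the majorant in xi for compactly supported symbols. *)
Definition bx n (rho : R) (x : 'rV[R]_n) : R := prodf (\1_(`[- rho, rho]%classic : set R)) x.

Lemma indic_itv_fin (rho : R) : 0 <= rho ->
  (\int[leb]_t ((\1_(`[- rho, rho]%classic : set R) t)%:E))%E = (2 * rho)%:E.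
Proof.
move=> r0; rewrite integral_indic// setIT.
rewrite [LHS]lebesgue_measure_itv/= lte_fin.
case: ltP => h; first by rewrite -EFinB; congr EFin; ring.
by congr EFin; lra.
Qed.

Lemma bx_ge0 n rho (x : 'rV[R]_n) : 0 <= bx rho x.
Proof. by apply: prodf_ge0 => t; rewrite indicE ler0n. Qed.

Lemma bx_eq1 n rho (x : 'rV[R]_n) : (forall i, `|x ord0 i| <= rho) -> bx rho x = 1.
Proof.
move=> h; rewrite /bx /prodf big1// => i _.
by rewrite indicE mem_set//= in_itv/= -ler_norml.
Qed.

Lemma integrable_bx n rho : 0 <= rho -> (lebesgue_rV R n).-integrable setT (EFin \o @bx n rho).
Proof.
move=> r0; apply: integrable_prodf (indic_itv_fin r0) _; first exact: measurable_indic.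
by move=> t; rewrite indicE ler0n.
Qed.

Lemma Rint_bx n rho : 0 <= rho -> (\int[lebesgue_rV R n]_x (bx rho x))%R = (2 * rho) ^+ n.
Proof.
move=> r0; apply: Rint_prodf (indic_itv_fin r0) _; first exact: measurable_indic.
by move=> t; rewrite indicE ler0n.
Qed.

End weights.

Section measurable_rV_ops.
Context {R : realType} dd (T : measurableType dd).

Lemma measurable_rV_coord_comp n (f : T -> 'rV[R]_n) i : measurable_fun setT f ->
  measurable_fun setT (fun p => f p ord0 i).
Proof. by move=> mf; exact: measurableT_comp (@measurable_rV_coord R n i) mf. Qed.

Lemma measurable_rVD n (f g : T -> 'rV[R]_n) : measurable_fun setT f -> measurable_fun setT g ->
  measurable_fun setT (fun p => f p + g p).
Proof.
move=> mf mg; apply: measurable_fun_rV => i.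
rewrite (_ : _ \o _ = fun p => f p ord0 i + g p ord0 i); last by apply/funext => p; rewrite /= /rV_coord mxE.
by apply: measurable_funD; exact: measurable_rV_coord_comp.
Qed.

Lemma measurable_rVZ n (c : R) (f : T -> 'rV[R]_n) : measurable_fun setT f ->
  measurable_fun setT (fun p => c *: f p).
Proof.
move=> mf; apply: measurable_fun_rV => i.
rewrite (_ : _ \o _ = fun p => c * f p ord0 i); last by apply/funext => p; rewrite /= /rV_coord mxE.
by apply: measurable_funM => //; exact: measurable_rV_coord_comp.
Qed.

Lemma measurable_rVB n (f g : T -> 'rV[R]_n) : measurable_fun setT f -> measurable_fun setT g ->
  measurable_fun setT (fun p => f p - g p).
Proof.
move=> mf mg; have := measurable_rVD mf (measurable_rVZ (-1) mg).
by under eq_fun do rewrite scaleN1r.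
Qed.

Lemma measurable_row_mx n m (f : T -> 'rV[R]_n) (g : T -> 'rV[R]_m) :
  measurable_fun setT f -> measurable_fun setT g ->
  measurable_fun setT (fun p => row_mx (f p) (g p)).
Proof.
move=> mf mg; apply: measurable_fun_rV => i.
case: (split_ordP i) => j ->.
  rewrite (_ : _ \o _ = fun p => f p ord0 j); last by apply/funext => p; rewrite /= /rV_coord row_mxEl.
  exact: measurable_rV_coord_comp.
rewrite (_ : _ \o _ = fun p => g p ord0 j); last by apply/funext => p; rewrite /= /rV_coord row_mxEr.
exact: measurable_rV_coord_comp.
Qed.

Lemma measurable_dotp n (f g : T -> 'rV[R]_n) : measurable_fun setT f -> measurable_fun setT g ->
  measurable_fun setT (fun p => dotp (f p) (g p)).
Proof.
move=> mf mg; rewrite /dotp; apply: measurable_sum => i.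
by apply: measurable_funM; exact: measurable_rV_coord_comp.
Qed.

End measurable_rV_ops.

Section dotp.
Context {R : realType} {d : nat}.
Implicit Types x y z : 'rV[R]_d.

Lemma dotpDl x y z : dotp (x + y) z = dotp x z + dotp y z.
Proof. by rewrite -big_split; apply: eq_bigr => i _; rewrite mxE mulrDl. Qed.
Lemma dotpZl c x z : dotp (c *: x) z = c * dotp x z.
Proof. by rewrite /dotp mulr_sumr; apply: eq_bigr => i _; rewrite mxE mulrA. Qed.
Lemma dotpC x y : dotp x y = dotp y x.
Proof. by apply: eq_bigr => i _; rewrite mulrC. Qed.
Lemma dotpDr x y z : dotp z (x + y) = dotp z x + dotp z y.
Proof. by rewrite dotpC dotpDl ![dotp z _]dotpC. Qed.
Lemma dotpZr c x z : dotp z (c *: x) = c * dotp z x.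
Proof. by rewrite dotpC dotpZl dotpC. Qed.
Lemma dotp_ei x j : dotp x (delta_mx ord0 j) = x ord0 j.
Proof.
rewrite /dotp (bigD1 j)//= big1 ?addr0 ?mxE ?eqxx ?mulr1//.
by move=> i ij; rewrite mxE eqxx/= (negbTE ij) mulr0.
Qed.
Lemma dotp_cder x y v (t : R) :
  cder (fun s => expi (dotp v (x + s *: y))) t ('i * (dotp v y)%:C * expi (dotp v (x + t *: y))).
Proof.
have E s : dotp v (x + s *: y) = dotp v x + s * dotp v y by rewrite dotpDr dotpZr.
rewrite E; under [X in cder X]eq_fun do rewrite E; exact: cder_expi.
Qed.

End dotp.

Section hat.
Context {R : realType} {d : nat}.
Local Notation mu := (lebesgue_rV R d).
Implicit Types (a b : 'rV[R]_(d + d) -> R[i]) (m v x y xi s : 'rV[R]_d).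

(** Fourier transform of the symbol in xi alone. The kernel of a^w at (x, y) is [kap] times its
    value at m = (x + y) / 2 and v = x - y, see [weylE]. *)
Definition hat a m v : R[i] := Cintegral mu (fun xi => expi (dotp v xi) * a (row_mx m xi)).

Lemma cmeas_hat_integrand dd (T : measurableType dd) a (f g h : T -> 'rV[R]_d) : csmooth a ->
  measurable_fun setT f -> measurable_fun setT g -> measurable_fun setT h ->
  cmeas (fun p => expi (dotp (g p) (h p)) * a (row_mx (f p) (h p))).
Proof.
move=> sa mf mg mh; apply: cmeasM; first by apply: cmeas_expi; exact: measurable_dotp.
by apply: (cmeas_comp (csmooth_cmeas sa)); exact: measurable_row_mx.
Qed.

Lemma Cc_box a : Cc_infty a -> exists B rho : R, [/\ 0 <= B, 0 < rho &
  forall h m xi, 0 < h -> nC (dilate h a (row_mx m xi)) <= B * bx (rho / h) xi].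
Proof.
move=> /Cc_bound[B [rho [B0 r0 aB arho]]]; exists B, rho; split => // h m xi h0.
rewrite /dilate; have [->|az] := eqVneq (a (h *: row_mx m xi)) 0.
  by rewrite nC0 mulr_ge0 ?bx_ge0.
rewrite bx_eq1 ?mulr1// => i.
have := arho _ az (rshift d i); rewrite mxE row_mxEr normrM (gtr0_norm h0).
by rewrite ler_pdivlMr// mulrC.
Qed.

Lemma dilate1 a : dilate 1 a = a.
Proof. by apply/funext => z; rewrite /dilate scale1r. Qed.

Lemma Cc_box1 a : Cc_infty a -> exists B rho : R, [/\ 0 <= B, 0 < rho &
  forall m xi, nC (a (row_mx m xi)) <= B * bx rho xi].
Proof.
move=> /Cc_box[B [rho [B0 r0 H]]]; exists B, rho; split => // m xi.
by have := H 1 m xi ltr01; rewrite dilate1 divr1.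
Qed.

Lemma integrable_Mbx (B rho : R) : 0 < rho -> mu.-integrable setT (EFin \o (fun x => B * bx rho x)).
Proof.
move=> r0; exact: (integrable_scale B (integrable_bx d (ltW r0))).
Qed.

Lemma cmeas_hat1 a m v : csmooth a ->
  cmeas (fun xi : 'rV[R]_d => expi (dotp v xi) * a (row_mx m xi)).
Proof.
by move=> sa; apply: (@cmeas_hat_integrand _ _ a (fun=> m) (fun=> v) id).
Qed.

Lemma cinteg_hat a m v : Cc_infty a ->
  cinteg mu (fun xi => expi (dotp v xi) * a (row_mx m xi)).
Proof.
move=> ca; have [B [rho [B0 r0 H]]] := Cc_box1 ca.
apply: (@cinteg_dom _ _ _ _ _ (fun xi => B * bx rho xi)).
- by apply: cmeas_hat1; case: ca.
- by move=> xi; rewrite nCM nC_expi mul1r.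
- exact: integrable_Mbx.
Qed.

Lemma hatD a b m v : Cc_infty a -> Cc_infty b ->
  hat (fun z => a z + b z) m v = hat a m v + hat b m v.
Proof.
move=> ca cb; rewrite -CintD; [|exact: cinteg_hat|exact: cinteg_hat].
by apply: eq_Cint => xi; rewrite mulrDr.
Qed.

Lemma hatZ c a m v : Cc_infty a -> hat (fun z => c * a z) m v = c * hat a m v.
Proof.
move=> ca; rewrite -CintZ; last exact: cinteg_hat.
by apply: eq_Cint => xi; rewrite mulrCA.
Qed.

Lemma hat_sum I (r : seq I) (F : I -> 'rV[R]_(d + d) -> R[i]) m v :
  (forall i, Cc_infty (F i)) ->
  hat (fun z => \sum_(i <- r) F i z) m v = \sum_(i <- r) hat (F i) m v.
Proof.
move=> cF; rewrite -Cint_sum; last by move=> i; exact: cinteg_hat.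
by apply: eq_Cint => xi; rewrite mulr_sumr.
Qed.

Lemma hat_cX a j m v : Cc_infty a -> hat (cX (lshift d j) a) m v = (m ord0 j)%:C * hat a m v.
Proof.
move=> ca; rewrite -CintZ; last exact: cinteg_hat.
by apply: eq_Cint => xi; rewrite /cX row_mxEl mulrCA.
Qed.

Lemma row_line m s xi y (t : R) : row_mx (m + t *: s) (xi + t *: y) = row_mx m xi + t *: row_mx s y.
Proof. by rewrite scale_row_mx add_row_mx. Qed.

Lemma csmooth_line_x a m s xi (t : R) : csmooth a ->
  cder (fun t => a (row_mx (m + t *: s) xi)) t
    (\sum_j (s ord0 j)%:C * cD (lshift d j) a (row_mx (m + t *: s) xi)).
Proof.
move=> sa; have E r : row_mx (m + r *: s) xi = row_mx m xi + r *: row_mx s 0.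
  by rewrite -row_line scaler0 addr0.
under [X in cder X]eq_fun do rewrite E.
apply: (cder_eq (csmooth_line _ _ _ sa)); rewrite big_split_ord /= [X in _ + X]big1 ?addr0.
  by apply: eq_bigr => j _; rewrite row_mxEl E.
by move=> j _; rewrite row_mxEr mxE mul0r.
Qed.

Lemma csmooth_line_xi a m xi (t : R) j : csmooth a ->
  cder (fun t => a (row_mx m (xi + t *: delta_mx ord0 j))) t
    (cD (rshift d j) a (row_mx m (xi + t *: delta_mx ord0 j))).
Proof.
move=> sa; have E r : row_mx m (xi + r *: delta_mx ord0 j) = row_mx m xi + r *: row_mx 0 (delta_mx ord0 j).
  by rewrite -row_line scaler0 addr0.
under [X in cder X]eq_fun do rewrite E.
apply: (cder_eq (csmooth_line _ _ _ sa)); rewrite big_split_ord /= big1 ?add0r; last first.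
  by move=> i _; rewrite row_mxEl mxE mul0r.
rewrite (bigD1 j)//= [X in _ + X]big1 ?addr0; last first.
  by move=> i ij; rewrite row_mxEr mxE eqxx/= (negbTE ij) mul0r.
by rewrite row_mxEr mxE !eqxx mul1r E.
Qed.

(** Enlarging the cube by 1 yields a single majorant for all translates with |t| < 1, as
    differentiation under the integral requires. *)
Lemma bx_shift (rho : R) xi j (t : R) : `|t| < 1 -> forall B (z : R[i]),
  0 <= B -> nC z <= B * bx rho (xi + t *: delta_mx ord0 j) -> nC z <= B * bx (rho + 1) xi.
Proof.
move=> t1 B z B0 H; apply: (le_trans H); apply: ler_wpM2l => //.
have [h|h] := pselect (forall i, `|(xi + t *: delta_mx ord0 j) ord0 i| <= rho).
  rewrite !bx_eq1// => i; have := h i; rewrite !mxE eqxx/=.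
  move=> hi; rewrite -[xi ord0 i](addrK (t * (i == j)%:R)) (le_trans (ler_normB _ _))// lerD//.
  by case: eqP => _; rewrite ?mulr1 ?mulr0 ?normr0 ?ltW.
have /existsNP[i ih] := h.
suff -> : bx rho (xi + t *: delta_mx ord0 j) = 0 by exact: bx_ge0.
rewrite /bx /prodf (bigD1 i)//= indicE memNset ?mul0r//=.
by rewrite in_itv/= -ler_norml.
Qed.

(** Integration by parts as translation invariance: the integral of the integrand shifted by t along
    xi_j does not depend on t, so its derivative at t = 0, which is i v_j [hat a] plus the transform
    of the xi_j-derivative, vanishes. *)
Lemma hat_ibp a j m v : Cc_infty a ->
  (v ord0 j)%:C * hat a m v = 'i * hat (cD (rshift d j) a) m v.
Proof.
move=> ca; have sa := proj1 ca; have cb := Cc_cD (rshift d j) ca.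
have [B [rho [B0 r0 H]]] := Cc_box1 ca.
have [B' [rho' [B0' r0' H']]] := Cc_box1 cb.
pose e := delta_mx ord0 j : 'rV[R]_d.
pose f (t : R) xi := expi (dotp v (xi + t *: e)) * a (row_mx m (xi + t *: e)).
pose f' (t : R) xi := 'i * (dotp v e)%:C * expi (dotp v (xi + t *: e)) * a (row_mx m (xi + t *: e))
  + expi (dotp v (xi + t *: e)) * cD (rshift d j) a (row_mx m (xi + t *: e)).
have If t : cinteg mu (f t).
  have := cinteg_rV_affine (t *: e) (@ltr01 R) (cinteg_hat m v ca).
  by under eq_fun do rewrite scale1r.
have df t xi : cder (f^~ xi) t (f' t xi).
  exact: (cderM (dotp_cder _ _ _ _) (csmooth_line_xi _ _ _ _ sa)).
have bf t xi : `|t - 0| < 1 -> nC (f' t xi) <= `|dotp v e| * B * bx (rho + 1) xi + B' * bx (rho' + 1) xi.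
  rewrite subr0 => t1; apply: le_trans (nCD _ _) _; apply: lerD.
    rewrite !nCM nCi nCr nC_expi mul1r mulr1 -mulrA ler_wpM2l//.
    by apply: (bx_shift (j := j) (t := t)) => //; exact: H.
  rewrite nCM nC_expi mul1r.
  by apply: (bx_shift (j := j) (t := t)) => //; exact: H'.
have ig : mu.-integrable setT (EFin \o (fun xi => `|dotp v e| * B * bx (rho + 1) xi + B' * bx (rho' + 1) xi)).
  have i1 := @integrable_Mbx (`|dotp v e| * B) (rho + 1) (addr_gt0 r0 ltr01).
  have i2 := @integrable_Mbx B' (rho' + 1) (addr_gt0 r0' ltr01).
  by have := integrableD measurableT i1 i2.
have D := cder_under_int If df bf ig.
have K t : Cintegral mu (f t) = hat a m v.
  exact: (Cint_rV_shift (t *: e) (cinteg_hat m v ca)).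
have Z : Cintegral mu (f' 0) = 0.
  have [Dr Di] := D; move: Dr Di.
  under eq_fun do rewrite K; under [X in _ -> is_derive _ _ X _ -> _]eq_fun do rewrite K.
  move=> Dr Di; apply: complex_eqP.
    by have <- := @derive_val _ _ _ _ _ _ _ Dr; rewrite derive_cst.
  by have <- := @derive_val _ _ _ _ _ _ _ Di; rewrite derive_cst.
have : Cintegral mu (f' 0) = 'i * (v ord0 j)%:C * hat a m v + hat (cD (rshift d j) a) m v.
  rewrite -CintZ; last exact: cinteg_hat.
  rewrite -CintD; [|by apply: cintegZ; exact: cinteg_hat|exact: cinteg_hat].
  by apply: eq_Cint => xi; rewrite /f' scale0r addr0 dotp_ei -mulrA.
rewrite Z => /esym/eqP; rewrite addrC addr_eq0 => /eqP ->.
by rewrite mulrN !mulrA -expr2 sqr_i !mulN1r mulNr opprK.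
Qed.

Lemma hat_cder a m s v y (t : R) : Cc_infty a ->
  cder (fun t => hat a (m + t *: s) (v + t *: y)) t
   (\sum_j (s ord0 j)%:C * hat (cD (lshift d j) a) (m + t *: s) (v + t *: y)
    + \sum_j 'i * (y ord0 j)%:C * hat (cX (rshift d j) a) (m + t *: s) (v + t *: y)).
Proof.
move=> ca; have sa := proj1 ca.
pose f (t : R) xi := expi (dotp (v + t *: y) xi) * a (row_mx (m + t *: s) xi).
pose F (t : R) j xi := (s ord0 j)%:C * (expi (dotp (v + t *: y) xi) * cD (lshift d j) a (row_mx (m + t
  *: s) xi))
  + 'i * (y ord0 j)%:C * (expi (dotp (v + t *: y) xi) * cX (rshift d j) a (row_mx (m + t *: s) xi)).
pose f' (t : R) xi := \sum_j F t j xi.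
have Ff t' j : cinteg mu (F t' j).
  apply: cintegD; apply: cintegZ; apply: cinteg_hat; [exact: Cc_cD|exact: Cc_cX].
apply: (@cder_eq _ _ _ (Cintegral mu (f' t))); last first.
  rewrite Cint_sum; last exact: Ff.
  rewrite -big_split; apply: eq_bigr => j _ /=.
  rewrite CintD; [|by apply: cintegZ; apply: cinteg_hat; exact: Cc_cD|by apply: cintegZ;
    apply: cinteg_hat; exact: Cc_cX].
  by rewrite !CintZ//; apply: cinteg_hat; [exact: Cc_cX|exact: Cc_cD].
have df t' xi : cder (f^~ xi) t' (f' t' xi).
  have dE : cder (fun t => expi (dotp (v + t *: y) xi)) t' ('i * (dotp y xi)%:C * expi (dotp (v + t' *: y) xi)).
    rewrite [dotp y xi]dotpC [dotp (v + _) xi]dotpC.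
    by under [X in cder X]eq_fun do rewrite dotpC; exact: dotp_cder.
  apply: (cder_eq (cderM dE (csmooth_line_x _ _ _ _ sa))).
  rewrite /f' /F big_split /= addrC; congr (_ + _).
    rewrite /dotp rmorph_sum mulr_sumr !mulr_suml; apply: eq_bigr => j _.
    by rewrite /cX row_mxEr rmorphM; ring.
  by rewrite mulr_sumr; apply: eq_bigr => j _; rewrite mulrCA.
have /choice[K1 HK1] : forall j, exists p : R * R, [/\ 0 <= p.1, 0 < p.2 &
  forall m xi, nC (cD (lshift d j) a (row_mx m xi)) <= p.1 * bx p.2 xi].
  by move=> j; have [B [r [? ? ?]]] := Cc_box1 (Cc_cD (lshift d j) ca); exists (B, r).
have /choice[K2 HK2] : forall j, exists p : R * R, [/\ 0 <= p.1, 0 < p.2 &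
  forall m xi, nC (cX (rshift d j) a (row_mx m xi)) <= p.1 * bx p.2 xi].
  by move=> j; have [B [r [? ? ?]]] := Cc_box1 (Cc_cX (rshift d j) ca); exists (B, r).
apply: (@cder_under_int _ _ _ _ f f' t (fun xi => \sum_j
   (`|s ord0 j| * (K1 j).1 * bx (K1 j).2 xi + `|y ord0 j| * (K2 j).1 * bx (K2 j).2 xi))).
- by move=> t'; exact: cinteg_hat.
- exact: df.
- move=> t' xi _; apply: le_trans (nC_sum _ _) _; apply: ler_sum => j _.
  apply: le_trans (nCD _ _) _; apply: lerD.
    by rewrite !nCM nC_expi mul1r nCr -mulrA ler_wpM2l//; have [_ _] := HK1 j; exact.
  rewrite (nCM ('i * _)) (nCM 'i) nCi mul1r nCr (nCM (expi _)) nC_expi mul1r -mulrA ler_wpM2l//.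
  by have [_ _] := HK2 j; exact.
- have : mu.-integrable setT (fun xi => \sum_j
    ((`|s ord0 j| * (K1 j).1 * bx (K1 j).2 xi)%:E + (`|y ord0 j| * (K2 j).1 * bx (K2 j).2 xi)%:E)%E)%E.
    apply: integrable_sum => // j _; apply: integrableD => //.
      by have [_ r0 _] := HK1 j; exact: integrable_Mbx.
    by have [_ r0 _] := HK2 j; exact: integrable_Mbx.
  by apply: eq_integrable => // xi _; rewrite /= -sumEFin.
Qed.

Lemma cmeas_hat dd (T : measurableType dd) a (f g : T -> 'rV[R]_d) : csmooth a ->
  measurable_fun setT f -> measurable_fun setT g -> cmeas (fun p => hat a (f p) (g p)).
Proof.
move=> sa mf mg.
apply: (@cmeas_Cint_param _ _ _ _ _ mu (fun q : T * 'rV[R]_d =>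
  expi (dotp (g q.1) q.2) * a (row_mx (f q.1) q.2))).
apply: (@cmeas_hat_integrand _ _ a (fun q => f q.1) (fun q => g q.1) snd) => //.
  exact: measurableT_comp mf measurable_fst.
exact: measurableT_comp mg measurable_fst.
Qed.

(** The loss h^-d is the volume of a cube of side 2 rho / h. The factors 1 + v_j^2 are absorbed one
    coordinate after the other, which replaces the symbol by derivatives; hence the induction over
    all symbols. *)
Lemma hat_dilate_bound a : Cc_infty a -> exists2 C : R, 0 <= C &
  forall h m v, 0 < h <= 1 -> nC (hat (dilate h a) m v) <= C * h ^- d * wt v.
Proof.
move=> ca; suff [C C0 H] : exists2 C : R, 0 <= C &
    forall h m v, 0 < h <= 1 ->
    \prod_(j <- enum 'I_d) (1 + v ord0 j ^+ 2) * nC (hat (dilate h a) m v) <= C * h ^- d.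
  exists C => // h m v hh; have := H h m v hh.
  rewrite enumT -(ler_pM2l (wt_gt0 v)) mulrA wtV mul1r; by rewrite [wt v * _]mulrC.
elim: (enum 'I_d) a ca => [|j l IH] a ca.
  have [B [rho [B0 r0 H]]] := Cc_box ca.
  exists (2 * (B * (2 * rho) ^+ d)); first by rewrite !mulr_ge0// exprn_ge0// mulr_ge0// ltW.
  move=> h m v /andP[h0 h1]; rewrite big_nil mul1r.
  have cah : Cc_infty (dilate h a) by apply: Cc_dilate => //; rewrite gt_eqF.
  have rh : 0 < rho / h by rewrite divr_gt0.
  apply: le_trans (nC_Cint_le (cinteg_hat m v cah) (g := fun xi => B * bx (rho / h) xi) _ _) _.
  - by move=> xi; rewrite nCM nC_expi mul1r; exact: H.
  - exact: integrable_Mbx.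
  rewrite RintegralZl//; last exact: integrable_bx (ltW rh).
  rewrite Rint_bx; last exact: ltW.
  by rewrite mulrA [2 * (rho / h)]mulrA exprMn exprVn -!mulrA.
have cc := Cc_cD (rshift d j) (Cc_cD (rshift d j) ca).
have [C1 C10 H1] := IH a ca; have [C2 C20 H2] := IH _ cc.
exists (C1 + C2); first exact: addr_ge0.
move=> h m v hh; have [h0 h1] := andP hh.
have hn0 : h != 0 by rewrite gt_eqF.
rewrite big_cons [_ * \prod_(_ <- _) _]mulrC -mulrA.
(* Two integrations by parts turn v_j^2 into minus a second derivative; on a dilated symbol it
   carries a harmless h^2 <= 1. *)
have E : ((1 + v ord0 j ^+ 2))%:C * hat (dilate h a) m v =
   hat (dilate h a) m v - (h ^+ 2)%:C * hat (dilate h (cD (rshift d j) (cD (rshift d j) a))) m v.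
  have cah : Cc_infty (dilate h a) by exact: Cc_dilate.
  have cah' : Cc_infty (dilate h (cD (rshift d j) a)) by apply: Cc_dilate => //; exact: Cc_cD.
  have sb : csmooth (cD (rshift d j) a) by apply: csmooth_cD; case: ca.
  rewrite rmorphD rmorph1 mulrDl mul1r; congr (_ + _).
  rewrite expr2 rmorphM -mulrA hat_ibp// cD_dilate; last by case: ca.
  rewrite hatZ// mulrCA; rewrite [(v ord0 j)%:C * (h%:C * _)]mulrCA hat_ibp// cD_dilate//.
  rewrite hatZ; last by apply: Cc_dilate.
  move: (hat _ m v) => X; transitivity (('i * 'i) * (h%:C * h%:C) * X :> R[i]); first by ring.
  by rewrite -!expr2 sqr_i -rmorphXn mulN1r mulNr.
have -> : (1 + v ord0 j ^+ 2) * nC (hat (dilate h a) m v) =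
    nC ((1 + v ord0 j ^+ 2)%:C * hat (dilate h a) m v).
  by rewrite nCM nCr ger0_norm// addr_ge0// sqr_ge0.
rewrite E.
have P0 : 0 <= \prod_(j <- l) (1 + v ord0 j ^+ 2).
  by apply: prodr_ge0 => i _; rewrite addr_ge0// sqr_ge0.
apply: le_trans (ler_wpM2l P0 (nCB _ _)) _; rewrite mulrDr [X in _ <= X]mulrDl.
apply: lerD; first exact: H1.
apply: le_trans _ (H2 h m v hh); rewrite ler_wpM2l// nCM nCr ger0_norm ?sqr_ge0//.
by rewrite ler_piMl ?nC_ge0// expr_le1// ltW.
Qed.

End hat.

(** * Weyl operators on Schwartz functions *)

Section decay.
Context {R : realType} {d : nat}.
Local Notation mu := (lebesgue_rV R d).
Implicit Types (a b : 'rV[R]_(d + d) -> R[i]) (phi psi : 'rV[R]_d -> R[i]).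
Implicit Types (x y : 'rV[R]_d) (j : 'I_d).

Definition decay phi : Prop := cmeas phi /\ exists C : R, forall x, nC (phi x) <= C * wt x.

Definition n2 phi : R := norm2 mu (fun x => nC (phi x)).

Lemma n2_ge0 phi : 0 <= n2 phi. Proof. exact: norm2_ge0. Qed.

Lemma integrable_Mwt (C : R) : mu.-integrable setT (EFin \o (fun x => C * wt x)).
Proof.
exact: (integrable_scale C (integrable_wt d)).
Qed.

Lemma decay_cinteg phi : decay phi -> cinteg mu phi.
Proof. by move=> [mp [C pC]]; exact: (cinteg_dom mp pC (integrable_Mwt C)). Qed.

Lemma decay_sq phi : decay phi -> mu.-integrable setT (EFin \o (fun x => nC (phi x) ^+ 2)).
Proof.
move=> [mp [C pC]]; apply: (@integrable_dom _ _ _ _ _ (fun x => C ^+ 2 * wt x ^+ 2)).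
- by apply: measurable_funX; exact: cmeas_nC.
- move=> x; rewrite ger0_norm ?sqr_ge0// -exprMn ler_sqr ?nnegrE ?nC_ge0//.
  exact: le_trans (nC_ge0 _) (pC x).
- exact: (integrable_scale (C ^+ 2) (integrable_wt2 d)).
Qed.

Lemma decayZD (c : R[i]) phi psi : decay phi -> decay psi -> decay (fun x => c * phi x + psi x).
Proof.
move=> [mp [C pC]] [mq [C' qC]]; split.
  by apply: cmeasD => //; apply: cmeasM => //; exact: cmeas_cst.
exists (nC c * C + C') => x; apply: le_trans (nCD _ _) _.
by rewrite mulrDl lerD// nCM -mulrA ler_wpM2l ?nC_ge0.
Qed.

Definition kap : R[i] := ((2 * pi) ^- d)%:C.

Lemma cmeas_weyl_kernel a x : csmooth a ->
  cmeas (fun y : 'rV[R]_d => hat a (2^-1 *: (x + y)) (x - y)).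
Proof.
move=> sa; apply: (cmeas_hat (f := fun y : 'rV[R]_d => 2^-1 *: (x + y)) (g := fun y => x - y)) => //.
  by apply: measurable_rVZ; exact: measurable_rVD.
exact: measurable_rVB.
Qed.

Lemma hat_bound a : Cc_infty a -> exists2 C : R, 0 <= C & forall m v, nC (hat a m v) <= C * wt v.
Proof.
move=> ca; have [C C0 H] := hat_dilate_bound ca; exists C => // m v.
by have := H 1 m v; rewrite dilate1 expr1n invr1 mulr1; apply; rewrite ltr01 lexx.
Qed.

Lemma cinteg_weyl a phi x : Cc_infty a -> decay phi ->
  cinteg mu (fun y => hat a (2^-1 *: (x + y)) (x - y) * phi y).
Proof.
move=> ca dp; have [C C0 H] := hat_bound ca.
apply: (@cinteg_dom _ _ _ _ _ (fun y => C * nC (phi y))).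
- by apply: cmeasM; [apply: cmeas_weyl_kernel; case: ca|case: dp].
- move=> y; rewrite nCM ler_wpM2r ?nC_ge0//; apply: le_trans (H _ _) _.
  by rewrite ler_piMr ?wt_le1.
- exact: (integrable_scale C (cinteg_nC (decay_cinteg dp))).
Qed.

(** Fubini, justified by the product majorant |phi(y)| times a cube indicator in xi. *)
Lemma weylE a phi x : Cc_infty a -> decay phi ->
  weyl a phi x = kap * Cintegral mu (fun y => hat a (2^-1 *: (x + y)) (x - y) * phi y).
Proof.
move=> ca dp; rewrite /weyl /kap; congr (_ * _).
have [B [rho [B0 r0 H]]] := Cc_box1 ca.
rewrite -Cint_fubini1; last first.
  apply: (@cinteg_dom _ _ _ _ _ (fun p => nC (phi p.1) * (B * bx rho p.2))).
  - rewrite (_ : (fun _ => _) = fun p : 'rV[R]_d * 'rV[R]_d =>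
      expi (dotp (x - p.1) p.2) * a (row_mx (2^-1 *: (x + p.1)) p.2) * phi p.1); last by apply/funext => -[].
    apply: cmeasM; last by apply: (cmeas_comp (proj1 dp)); exact: measurable_fst.
    apply: (@cmeas_hat_integrand _ _ _ _ a (fun p => 2^-1 *: (x + p.1)) (fun p => x - p.1) snd).
    + by case: ca.
    + by apply: measurable_rVZ; apply: measurable_rVD => //; exact: measurable_fst.
    + by apply: measurable_rVB => //; exact: measurable_fst.
    + exact: measurable_snd.
  - move=> [y xi] /=; rewrite !nCM nC_expi mul1r mulrC ler_wpM2l ?nC_ge0//.
  - apply: (@integrable_prod _ _ _ _ _ _ _ (fun y => nC (phi y)) (fun xi => B * bx rho xi)).
    + by move=> y; exact: nC_ge0.
    + by move=> xi; rewrite mulr_ge0 ?bx_ge0.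
    + exact: (cinteg_nC (decay_cinteg dp)).
    + exact: integrable_Mbx.
apply: eq_Cint => y; rewrite [RHS]mulrC -CintZ; last exact: cinteg_hat.
by apply: eq_Cint => xi; rewrite mulrC.
Qed.

Lemma weylD a b phi x : Cc_infty a -> Cc_infty b -> decay phi ->
  weyl (fun z => a z + b z) phi x = weyl a phi x + weyl b phi x.
Proof.
move=> ca cb dp; rewrite !weylE//; last exact: CcD.
rewrite -mulrDr -CintD; [|exact: cinteg_weyl|exact: cinteg_weyl].
by congr (_ * _); apply: eq_Cint => y; rewrite hatD// mulrDl.
Qed.

Lemma weylZ c a phi x : Cc_infty a -> decay phi ->
  weyl (fun z => c * a z) phi x = c * weyl a phi x.
Proof.
move=> ca dp; rewrite !weylE//; last exact: CcZ.
rewrite mulrCA -(CintZ c (cinteg_weyl x ca dp)).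
by congr (_ * _); apply: eq_Cint => y; rewrite hatZ// mulrA.
Qed.

Lemma weyl_lin a c phi psi : Cc_infty a -> decay phi -> decay psi ->
  weyl a (fun x => c * phi x + psi x) = fun x => c * weyl a phi x + weyl a psi x.
Proof.
move=> ca dp dq; apply/funext => x; rewrite !weylE//; last exact: decayZD.
rewrite mulrCA -mulrDr -(CintZ c (cinteg_weyl x ca dp)).
rewrite -(CintD (cintegZ c (cinteg_weyl x ca dp)) (cinteg_weyl x ca dq)).
by congr (_ * _); apply: eq_Cint => y; rewrite mulrDr mulrCA.
Qed.

(** [Dop j a] and [Xop j a] are the Weyl symbols of the compositions of d/dx_j and of multiplication
    by x_j with a^w: the Moyal product with a linear symbol stops after its first-order term. *)
Definition Dop j a := fun z => (2^-1)%:C * cD (lshift d j) a z + 'i * cX (rshift d j) a z.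
Definition Xop j a := fun z => cX (lshift d j) a z + ('i * (2^-1)%:C) * cD (rshift d j) a z.

Lemma Cc_Dop j a : Cc_infty a -> Cc_infty (Dop j a).
Proof. by move=> ca; apply: CcD; apply: CcZ; [exact: Cc_cD|exact: Cc_cX]. Qed.

Lemma Cc_Xop j a : Cc_infty a -> Cc_infty (Xop j a).
Proof. by move=> ca; apply: CcD; [exact: Cc_cX|apply: CcZ; exact: Cc_cD]. Qed.

Lemma hat_Dop j a m v : Cc_infty a ->
  hat (Dop j a) m v = (2^-1)%:C * hat (cD (lshift d j) a) m v + 'i * hat (cX (rshift d j) a) m v.
Proof.
move=> ca; rewrite hatD; [|by apply: CcZ; exact: Cc_cD|by apply: CcZ; exact: Cc_cX].
by rewrite !hatZ//; [exact: Cc_cX|exact: Cc_cD].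
Qed.

(** Moving x moves the midpoint at half speed, which gives half the x_j-derivative of the symbol,
    and x - y at full speed, which gives the factor i xi_j. *)
Lemma weyl_cder a phi x j (t : R) : Cc_infty a -> decay phi ->
  cder (fun t => weyl a phi (x + t *: delta_mx ord0 j)) t (weyl (Dop j a) phi (x + t *: delta_mx ord0 j)).
Proof.
move=> ca dp; pose e := delta_mx ord0 j : 'rV[R]_d.
rewrite weylE//; last exact: Cc_Dop.
under [X in cder X]eq_fun do rewrite weylE//.
apply: cderZ.
have [C C0 H] := hat_bound (Cc_Dop j ca).
apply: (@cder_under_int _ _ _ _ (fun t y => hat a (2^-1 *: (x + t *: e + y)) (x + t *: e - y) * phi y)
  (fun t y => hat (Dop j a) (2^-1 *: (x + t *: e + y)) (x + t *: e - y) * phi y) t (fun y => C * nC (phi y))).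
- by move=> t'; exact: cinteg_weyl.
- move=> t' y.
  have E1 s : 2^-1 *: (x + s *: e + y) = 2^-1 *: (x + y) + s *: (2^-1 *: e).
    by rewrite addrAC scalerDr !scalerA mulrC.
  have E2 s : x + s *: e - y = (x - y) + s *: e by rewrite addrAC.
  under [X in cder X]eq_fun do rewrite E1 E2.
  apply: (cder_eq (cderM (hat_cder _ _ _ _ _ ca) (cder_cst _ _))).
  rewrite mulr0 addr0 hat_Dop// E1 E2; congr (_ * _).
  have S (F : 'I_d -> R[i]) (c : R) : \sum_k (c * e ord0 k)%:C * F k = c%:C * F j.
    rewrite (bigD1 j)//= big1 ?addr0; first by rewrite mxE !eqxx mulr1.
    by move=> k kj; rewrite mxE eqxx/= (negbTE kj) mulr0 mul0r.
  congr (_ + _).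
    by rewrite -(S (fun k => hat (cD (lshift d k) a) _ _)); apply: eq_bigr => k _; rewrite mxE.
  under eq_bigr do rewrite -mulrA; rewrite -mulr_sumr; congr (_ * _).
  rewrite -[RHS]mul1r -(S (fun k => hat (cX (rshift d k) a) _ _)).
  by apply: eq_bigr => k _; rewrite mul1r.
- move=> t' y _; rewrite nCM ler_wpM2r ?nC_ge0//; apply: le_trans (H _ _) _.
  by rewrite ler_piMr ?wt_le1.
- exact: (integrable_scale C (cinteg_nC (decay_cinteg dp))).
Qed.

(** Split x_j as (x_j + y_j) / 2 + (x_j - y_j) / 2: the first part multiplies the symbol, the second
    is integrated by parts in xi_j. *)
Lemma weyl_mulX a phi x j : Cc_infty a -> decay phi ->
  (x ord0 j)%:C * weyl a phi x = weyl (Xop j a) phi x.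
Proof.
move=> ca dp; rewrite !weylE//; last exact: Cc_Xop.
rewrite mulrCA -(CintZ _ (cinteg_weyl x ca dp)).
congr (_ * _); apply: eq_Cint => y; rewrite mulrA; congr (_ * _).
rewrite hatD; [|exact: Cc_cX|by apply: CcZ; exact: Cc_cD].
rewrite hat_cX// hatZ; last exact: Cc_cD.
have := hat_ibp j (2^-1 *: (x + y)) (x - y) ca.
rewrite -mulrA [(2^-1)%:C * _]mulrC mulrA => <-.
rewrite [_ * (2^-1)%:C]mulrC mulrA -mulrDl -rmorphM -rmorphD !mxE.
by congr (_%:C * _); field.
Qed.

Lemma wt_conv2 x : mu.-integrable setT (EFin \o (fun y => wt (x - y) ^+ 2)) /\
  norm2 mu (fun y => wt (x - y)) = norm2 mu (@wt R d).
Proof.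
have E : (fun y : 'rV[R]_d => wt (x - y) ^+ 2) = fun y => wt (1 *: y + (- x)) ^+ 2.
  by apply/funext => y; rewrite scale1r -wtN opprB.
split.
  by rewrite E; exact: (integrable_rV_affine (- x) ltr01 (integrable_wt2 d)).
rewrite /norm2 E (Rint_rV_affine (- x) ltr01 (integrable_wt2 d)).
by rewrite expr1n invr1 mul1r.
Qed.

Lemma wt_cs phi x : decay phi ->
  mu.-integrable setT (EFin \o (fun y => wt (x - y) * nC (phi y))) /\
  (\int[mu]_y (wt (x - y) * nC (phi y)))%R <= norm2 mu (@wt R d) * n2 phi.
Proof.
move=> dp; have [i1 E] := wt_conv2 x.
have m1 : measurable_fun setT (fun y : 'rV[R]_d => wt (x - y)).
  by apply: (measurableT_comp (@measurable_wt R d)); exact: measurable_rVB.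
have m2 : measurable_fun setT (fun y => nC (phi y)) by apply: cmeas_nC; case: dp.
split; first exact: integrable_M2 m1 m2 i1 (decay_sq dp).
by rewrite -E; exact: norm2_cs m1 m2 i1 (decay_sq dp).
Qed.

(** The kernel is at most a constant times h^-d [wt (x - y)], and Cauchy-Schwarz against the square
    integrable weight leaves only the L^2 norm of phi. *)
Lemma weyl_sup a : Cc_infty a -> exists2 C : R, 0 <= C & forall h phi x, 0 < h <= 1 -> decay phi ->
  nC (weyl (dilate h a) phi x) <= C * h ^- d * n2 phi.
Proof.
move=> ca; have [C C0 H] := hat_dilate_bound ca.
exists (nC kap * (2 * (C * norm2 mu (@wt R d)))).
  by rewrite !mulr_ge0 ?nC_ge0 ?norm2_ge0.
move=> h phi x hh dp; have [h0 h1] := andP hh.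
have cah : Cc_infty (dilate h a) by apply: Cc_dilate => //; rewrite gt_eqF.
rewrite weylE// nCM -!mulrA ler_wpM2l ?nC_ge0//.
have [i1 cs] := wt_cs x dp.
have hd0 : 0 <= h ^- d by rewrite invr_ge0 exprn_ge0 ?ltW.
apply: le_trans (nC_Cint_le (cinteg_weyl x cah dp) (g := fun y =>
  C * h ^- d * (wt (x - y) * nC (phi y))) _ _) _.
- by move=> y; rewrite nCM mulrA ler_wpM2r ?nC_ge0//; exact: H.
- exact: (integrable_scale (C * h ^- d) i1).
rewrite RintegralZl// ler_wpM2l// -!mulrA ler_wpM2l// [X in _ <= X]mulrCA ler_wpM2l//.
Qed.

Lemma weyl_pd a phi j : Cc_infty a -> decay phi ->
  ((forall x, derivable (fun x => complex.Re (weyl a phi x)) x (delta_mx ord0 j)) /\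
   pd j (fun x => complex.Re (weyl a phi x)) = fun x => complex.Re (weyl (Dop j a) phi x)) /\
  ((forall x, derivable (fun x => complex.Im (weyl a phi x)) x (delta_mx ord0 j)) /\
   pd j (fun x => complex.Im (weyl a phi x)) = fun x => complex.Im (weyl (Dop j a) phi x)).
Proof.
move=> ca dp; have D x := weyl_cder x j 0 ca dp.
split; split.
- move=> x; have [+ _] := D x; rewrite scale0r addr0.
  by move/(@line_pd _ _ (fun x => complex.Re (weyl a phi x)) j x _) => [].
- apply/funext => x; have [+ _] := D x; rewrite scale0r addr0.
  by move/(@line_pd _ _ (fun x => complex.Re (weyl a phi x)) j x _) => [].
- move=> x; have [_] := D x; rewrite scale0r addr0.
  by move/(@line_pd _ _ (fun x => complex.Im (weyl a phi x)) j x _) => [].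
- apply/funext => x; have [_] := D x; rewrite scale0r addr0.
  by move/(@line_pd _ _ (fun x => complex.Im (weyl a phi x)) j x _) => [].
Qed.

Lemma cD_weyl a phi j : Cc_infty a -> decay phi -> cD j (weyl a phi) = weyl (Dop j a) phi.
Proof.
move=> ca dp; have [[_ E1] [_ E2]] := weyl_pd j ca dp.
by apply/funext => x; apply: complex_eqP; rewrite /= ?E1 ?E2.
Qed.

Lemma weyl_sup1 a phi : Cc_infty a -> decay phi -> exists M : R, forall x, nC (weyl a phi x) <= M.
Proof.
move=> ca dp; have [C C0 H] := weyl_sup ca; exists (C * 1 ^- d * n2 phi) => x.
by have := H 1 phi x; rewrite dilate1; apply => //; rewrite ltr01 lexx.
Qed.

(** A partial derivative of a^w phi is again a Weyl operator with compactly supported symbol, hence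
    bounded. Bounded partial derivatives give continuity, and induction on the order over all
    symbols gives smoothness. *)
Lemma csmooth_weyl a phi : Cc_infty a -> decay phi -> csmooth (weyl a phi).
Proof.
move=> ca dp.
have cont b : Cc_infty b -> continuous (fun x => complex.Re (weyl b phi x)) /\
    continuous (fun x => complex.Im (weyl b phi x)).
  move=> cb.
  have /choice[M HM] : forall j, exists M : R, forall x, nC (weyl (Dop j b) phi x) <= M.
    by move=> j; apply: weyl_sup1 => //; exact: Cc_Dop.
  have MM j : M j <= \sum_j `|M j|.
    by apply: le_trans (ler_norm _) _; rewrite (bigD1 j)//= lerDl sumr_ge0.
  split; apply: (bounded_pd_continuous (B := \sum_j `|M j|)).
  - by move=> j x; have [[+ _] _] := weyl_pd j cb dp; exact.
  - move=> j x; have [[_ ->] _] := weyl_pd j cb dp.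
    exact: le_trans (nC_Re _) (le_trans (HM j x) (MM j)).
  - by move=> j x; have [_ [+ _]] := weyl_pd j cb dp; exact.
  - move=> j x; have [_ [_ ->]] := weyl_pd j cb dp.
    exact: le_trans (nC_Im _) (le_trans (HM j x) (MM j)).
split; apply/smoothP => k.
  elim: k a ca => [|k IH] b cb; first by split => //; have [] := cont b cb.
  split; first by have [] := cont b cb.
  move=> j; have [[D ->] _] := weyl_pd j cb dp; split => //.
  by apply: IH; exact: Cc_Dop.
elim: k a ca => [|k IH] b cb; first by split => //; have [] := cont b cb.
split; first by have [] := cont b cb.
move=> j; have [_ [D ->]] := weyl_pd j cb dp; split => //.
by apply: IH; exact: Cc_Dop.
Qed.

Lemma cdpartials0 (f : 'rV[R]_d -> R[i]) : cdpartials [::] f = f.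
Proof. by apply/funext => x; exact: complex_eqP. Qed.

Lemma cdpartials_lin l (c1 c2 : R[i]) phi psi : csmooth phi -> csmooth psi ->
  cdpartials l (fun x => c1 * phi x + c2 * psi x) =
  fun x => c1 * cdpartials l phi x + c2 * cdpartials l psi x.
Proof.
elim/last_ind: l phi psi => [|l j IH] phi psi sp sq.
  by rewrite !cdpartials0.
rewrite !cdpartials_rcons -IH; [|exact: csmooth_cD|exact: csmooth_cD].
congr cdpartials; apply/funext => x.
by rewrite (cDD j x (csmoothZ c1 sp) (csmoothZ c2 sq)) (cDZ j c1 x sp) (cDZ j c2 x sq).
Qed.

(** Multiplication by xi_j becomes h^-1 times a dilated symbol, whereas a derivative gains h; so
    every differentiation of a_h^w phi costs one power of h. *)
Lemma Dop_dilate a j h : csmooth a -> h != 0 -> Dop j (dilate h a) = fun z =>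
  (2^-1 * h)%:C * dilate h (cD (lshift d j) a) z + 'i * (h^-1)%:C * dilate h (cX (rshift d j) a) z.
Proof.
move=> sa h0; apply/funext => z; rewrite /Dop (cD_dilate h _ sa) mulrA -rmorphM; congr (_ + _).
by rewrite -mulrA; congr (_ * _); rewrite /cX /dilate mxE mulrA -rmorphM mulKf.
Qed.

Lemma Xop_dilate a j h : csmooth a -> h != 0 -> Xop j (dilate h a) = fun z =>
  (h^-1)%:C * dilate h (cX (lshift d j) a) z + 'i * (2^-1 * h)%:C * dilate h (cD (rshift d j) a) z.
Proof.
move=> sa h0; apply/funext => z; rewrite /Xop (cD_dilate h _ sa); congr (_ + _).
  by rewrite /cX /dilate mxE mulrA -rmorphM mulKf.
by rewrite mulrA; congr (_ * _); rewrite -mulrA -rmorphM.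
Qed.

Lemma weyl_Dop_dilate a phi j h : Cc_infty a -> decay phi -> h != 0 ->
  weyl (Dop j (dilate h a)) phi = fun x =>
   (2^-1 * h)%:C * weyl (dilate h (cD (lshift d j) a)) phi x +
   ('i * (h^-1)%:C) * weyl (dilate h (cX (rshift d j) a)) phi x.
Proof.
move=> ca dp h0; have sa := proj1 ca.
have c1 : Cc_infty (dilate h (cD (lshift d j) a)) by exact: (Cc_dilate h0 (Cc_cD _ ca)).
have c2 : Cc_infty (dilate h (cX (rshift d j) a)) by exact: (Cc_dilate h0 (Cc_cX _ ca)).
apply/funext => x; rewrite -(weylZ _ x c1 dp) -(weylZ _ x c2 dp) -(weylD x (CcZ _ c1) (CcZ _ c2) dp).
by rewrite Dop_dilate.
Qed.

Lemma weyl_Xop_dilate a phi j h : Cc_infty a -> decay phi -> h != 0 ->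
  weyl (Xop j (dilate h a)) phi = fun x =>
   (h^-1)%:C * weyl (dilate h (cX (lshift d j) a)) phi x +
   ('i * (2^-1 * h)%:C) * weyl (dilate h (cD (rshift d j) a)) phi x.
Proof.
move=> ca dp h0; have sa := proj1 ca.
have c1 : Cc_infty (dilate h (cD (rshift d j) a)) by exact: (Cc_dilate h0 (Cc_cD _ ca)).
have c2 : Cc_infty (dilate h (cX (lshift d j) a)) by exact: (Cc_dilate h0 (Cc_cX _ ca)).
apply/funext => x; rewrite -(weylZ _ x c2 dp) -(weylZ _ x c1 dp) -(weylD x (CcZ _ c2) (CcZ _ c1) dp).
by rewrite Xop_dilate.
Qed.

(** Each factor x_j and each derivative is moved into the symbol at the price h^-1; the remaining
    h^-d is that of [weyl_sup]. *)
Lemma weyl_seminorm l1 l2 a : Cc_infty a -> exists2 C : R, 0 <= C &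
  forall h phi x, 0 < h <= 1 -> decay phi ->
  `|\prod_(j <- l1) x ord0 j| * nC (cdpartials l2 (weyl (dilate h a) phi) x)
  <= C * h ^- (size l1 + size l2 + d) * n2 phi.
Proof.
have step (C1 C2 A B N c1 c2 h : R) k : 0 < h <= 1 -> 0 <= N -> 0 <= C1 -> 0 <= C2 ->
    0 <= A -> 0 <= B ->
    A <= C1 * h ^- k * N -> B <= C2 * h ^- k * N -> 0 <= c1 <= h^-1 -> 0 <= c2 <= h^-1 ->
    c1 * A + c2 * B <= (C1 + C2) * h ^- k.+1 * N.
  move=> hh N0 C10 C20 A0 B0 HA HB /andP[c10 c1h] /andP[c20 c2h].
  have [h0 h1] := andP hh.
  have -> : (C1 + C2) * h ^- k.+1 * N = h^-1 * (C1 * h ^- k * N) + h^-1 * (C2 * h ^- k * N).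
    by rewrite exprS invfM; move: (h^-1) (h ^- k) => p q; ring.
  by apply: lerD; apply: ler_pM.
have hb (h : R) : 0 < h <= 1 -> 0 <= 2^-1 * h <= h^-1.
  move=> /andP[h0 h1]; apply/andP; split; first by rewrite mulr_ge0// ltW.
  apply: (@le_trans _ _ 1); first by nra.
  by rewrite invf_ge1.
have hV (h : R) : 0 < h <= 1 -> 0 <= h^-1 <= h^-1.
  by move=> /andP[h0 h1]; rewrite lexx andbT invr_ge0 ltW.
(* [cdpartials] applies the last entry of [l2] first, so derivatives are peeled from the right; the
   factors x_j are treated once no derivative is left. *)
elim/last_ind: l2 a => [|l2 j IH] a ca; last first.
  have [C1 C10 H1] := IH _ (Cc_cD (lshift d j) ca).
  have [C2 C20 H2] := IH _ (Cc_cX (rshift d j) ca).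
  exists (C1 + C2); first exact: addr_ge0.
  move=> h phi x hh dp; have [h0 h1] := andP hh; have hn : h != 0 by rewrite gt_eqF.
  have cah : Cc_infty (dilate h a) by exact: Cc_dilate.
  rewrite cdpartials_rcons cD_weyl// weyl_Dop_dilate// cdpartials_lin; last 2 first.
  - exact: (csmooth_weyl (Cc_dilate hn (Cc_cD _ ca)) dp).
  - exact: (csmooth_weyl (Cc_dilate hn (Cc_cX _ ca)) dp).
  rewrite size_rcons addnS addSn.
  apply: le_trans (ler_wpM2l (normr_ge0 _) (nCD _ _)) _.
  rewrite mulrDr !nCM nCi mul1r !nCr 2![`|\prod_(_ <- _) _| * (_ * _)]mulrCA.
  rewrite (ger0_norm (proj1 (andP (hb h hh)))) (ger0_norm (proj1 (andP (hV h hh)))).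
  by apply: (step C1 C2 _ _ _ _ _ h _ hh (n2_ge0 phi) C10 C20 _ _ (H1 h phi x hh dp) (H2 h phi x hh dp)
    (hb h hh) (hV h hh)); rewrite mulr_ge0 ?nC_ge0.
elim: l1 a ca => [|j l1 IH] a ca.
  have [C C0 H] := weyl_sup ca; exists C => // h phi x hh dp.
  rewrite big_nil normr1 mul1r add0n; apply: le_trans (H h phi x hh dp).
  by apply: eq_ler; congr nC; exact: complex_eqP.
have [C1 C10 H1] := IH _ (Cc_cX (lshift d j) ca).
have [C2 C20 H2] := IH _ (Cc_cD (rshift d j) ca).
exists (C1 + C2); first exact: addr_ge0.
move=> h phi x hh dp; have [h0 h1] := andP hh; have hn : h != 0 by rewrite gt_eqF.
have cah : Cc_infty (dilate h a) by exact: Cc_dilate.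
have E0 (f : 'rV[R]_d -> R[i]) : cdpartials [::] f x = f x by exact: complex_eqP.
rewrite big_cons normrM E0 [`|x ord0 j| * _]mulrC -[_ * `|x ord0 j| * _]mulrA.
have -> : `|x ord0 j| * nC (weyl (dilate h a) phi x) = nC (weyl (Xop j (dilate h a)) phi x).
  by rewrite -weyl_mulX// nCM nCr.
rewrite weyl_Xop_dilate// [size (_ :: _)]/= !addSn.
have := H1 h phi x hh dp; have := H2 h phi x hh dp; rewrite !E0.
move: (weyl (dilate h (cX (lshift d j) a)) phi x) => w1.
move: (weyl (dilate h (cD (rshift d j) a)) phi x) => w2 h2 h1'.
apply: le_trans (ler_wpM2l (normr_ge0 _) (nCD _ _)) _.
rewrite mulrDr !nCM nCi mul1r !nCr 2![`|\prod_(_ <- _) _| * (_ * _)]mulrCA.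
rewrite (ger0_norm (proj1 (andP (hb h hh)))) (ger0_norm (proj1 (andP (hV h hh)))).
by apply: (step C1 C2 _ _ _ _ _ h _ hh (n2_ge0 phi) C10 C20 _ _ h1' h2 (hV h hh) (hb h hh));
  rewrite mulr_ge0 ?nC_ge0.
Qed.

End decay.

(** * Schwartz seminorms and interpolation *)

Section schwartz_lists.
Context {R : realType} {d : nat}.
Local Notation mu := (lebesgue_rV R d).
Implicit Types (a b : 'rV[R]_(d + d) -> R[i]) (phi psi f : 'rV[R]_d -> R[i]).
Implicit Types (x y : 'rV[R]_d) (j : 'I_d) (l : seq 'I_d) (alpha beta : 'I_d -> nat).

(** A multi-index as the list of its coordinates with multiplicity: estimates on monomials and
    derivatives can then be proved by induction on lists. *)
Definition mlist alpha : seq 'I_d := flatten [seq nseq (alpha i) i | i <- enum 'I_d].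

Lemma monomialE alpha x : monomial alpha x = \prod_(j <- mlist alpha) x ord0 j.
Proof.
rewrite big_flatten big_map big_enum /=; apply: eq_bigr => i _.
by rewrite big_nseq iter_mulr_1.
Qed.

Lemma size_mlist alpha : size (mlist alpha) = (\sum_i alpha i)%N.
Proof.
rewrite size_flatten /shape -map_comp sumnE big_map big_enum /=.
by apply: eq_bigr => i _; rewrite size_nseq.
Qed.

Lemma mlist0 : mlist (fun=> 0%N) = [::].
Proof. by rewrite /mlist; elim: (enum _). Qed.

Lemma mpartialE beta f : mpartial beta f = cdpartials (mlist beta) f.
Proof. by []. Qed.

Lemma mpartial0 f : mpartial (fun=> 0%N) f = f.
Proof. by rewrite mpartialE mlist0 cdpartials0. Qed.

Lemma seminorm_le alpha beta f (S : R) :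
  (forall x, `|\prod_(j <- mlist alpha) x ord0 j| * nC (cdpartials (mlist beta) f x) <= S) ->
  (schwartz_seminorm alpha beta f <= S%:E)%E.
Proof.
move=> H; apply: ge_ereal_sup => _ [x _ <-].
by rewrite lee_fin nCM nCr monomialE; exact: H.
Qed.

Lemma seminorm_ub alpha beta f : (schwartz_seminorm alpha beta f < +oo)%E ->
  exists C : R, forall x, `|monomial alpha x| * nC (mpartial beta f x) <= C.
Proof.
move=> fy; exists (fine (schwartz_seminorm alpha beta f)) => x.
have h : ((`|monomial alpha x| * nC (mpartial beta f x))%:E <= schwartz_seminorm alpha beta f)%E.
  by apply: ereal_sup_ubound; exists x => //; rewrite nCM nCr.
have fn : schwartz_seminorm alpha beta f \is a fin_num.
  by rewrite fin_numE gt_eqF ?(lt_le_trans _ h) ?ltNyr//= lt_eqF.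
by rewrite -lee_fin fineK.
Qed.

(** Expanding the product of the 1 + x_j^2 yields monomials, each controlled by a seminorm. The
    extra monomial [alpha] in the induction collects the squares already chosen. *)
Lemma schwartz_decay phi : schwartz phi -> decay phi.
Proof.
move=> [sp semi]; split; first exact: csmooth_cmeas.
suff [C HC] : exists C : R, forall x, \prod_(j <- enum 'I_d) (1 + x ord0 j ^+ 2) * nC (phi x) <= C.
  exists C => x; have := HC x; rewrite -(ler_pM2l (wt_gt0 x)) enumT mulrA wtV mul1r.
  by rewrite [_ * C]mulrC.
suff H l alpha : exists C : R, forall x,
    `|monomial alpha x| * (\prod_(j <- l) (1 + x ord0 j ^+ 2) * nC (phi x)) <= C.
  have [C HC] := H (enum 'I_d) (fun=> 0%N); exists C => x; have := HC x.
  by rewrite monomialE mlist0 big_nil normr1 mul1r.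
elim: l alpha => [|j l IH] alpha.
  have [C HC] := seminorm_ub (semi alpha (fun=> 0%N)).
  by exists C => x; rewrite big_nil mul1r; have := HC x; rewrite mpartial0.
have [C1 H1] := IH alpha; have [C2 H2] := IH (fun i => alpha i + 2 * (i == j))%N.
exists (C1 + C2) => x; rewrite big_cons -mulrA mulrDl mul1r mulrDr lerD//.
have E : monomial (fun i => alpha i + 2 * (i == j))%N x = monomial alpha x * x ord0 j ^+ 2.
  rewrite /monomial; under eq_bigr do rewrite exprD; rewrite big_split /=; congr (_ * _).
  rewrite (bigD1 j)//= eqxx muln1 big1 ?mulr1// => i ij.
  by rewrite (negbTE ij) muln0 expr0.
have := H2 x; rewrite E normrM [`|x ord0 j ^+ 2|]ger0_norm ?sqr_ge0//.
by rewrite !mulrA.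
Qed.

Lemma schwartz_lists phi : csmooth phi -> (forall l1 l2, exists C : R, forall x,
    `|\prod_(j <- l1) x ord0 j| * nC (cdpartials l2 phi x) <= C) -> schwartz phi.
Proof.
move=> sp H; split => // alpha beta; have [C HC] := H (mlist alpha) (mlist beta).
by apply: le_lt_trans (seminorm_le HC) _; rewrite ltry.
Qed.

Lemma schwartz_lin (c1 c2 : R[i]) phi psi : schwartz phi -> schwartz psi ->
  schwartz (fun x => c1 * phi x + c2 * psi x).
Proof.
move=> [sp hp] [sq hq]; split; first exact: (csmoothD (csmoothZ c1 sp) (csmoothZ c2 sq)).
move=> alpha beta; have [C HC] := seminorm_ub (hp alpha beta).
have [C' HC'] := seminorm_ub (hq alpha beta).
apply: (@le_lt_trans _ _ (nC c1 * C + nC c2 * C')%:E); last by rewrite ltry.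
apply: seminorm_le => x; rewrite (cdpartials_lin _ c1 c2 sp sq).
apply: le_trans (ler_wpM2l (normr_ge0 _) (nCD _ _)) _.
rewrite mulrDr !nCM ![`|_| * (_ * _)]mulrCA -monomialE.
by apply: lerD; apply: ler_wpM2l; rewrite ?nC_ge0.
Qed.

Lemma schwartz0 : schwartz (fun _ : 'rV[R]_d => 0 : R[i]).
Proof.
split; first exact: csmooth_cst.
move=> alpha beta; apply: (@le_lt_trans _ _ 0%:E); last by rewrite ltry.
apply: seminorm_le => x.
have -> : (fun _ : 'rV[R]_d => 0 : R[i]) = fun x => 0 * (fun=> 0) x + 0 * (fun=> 0) x.
  by apply/funext => y; rewrite mul0r addr0.
by rewrite (cdpartials_lin _ 0 0 (csmooth_cst 0) (csmooth_cst 0)) !mul0r addr0 nC0 mulr0.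
Qed.

Lemma schwartz_weyl a phi : Cc_infty a -> decay phi -> schwartz (weyl a phi).
Proof.
move=> ca dp; apply: schwartz_lists; first exact: csmooth_weyl.
move=> l1 l2; have [C C0 H] := weyl_seminorm l1 l2 ca.
exists (C * 1 ^- (size l1 + size l2 + d) * n2 phi) => x.
by have := H 1 phi x; rewrite dilate1; apply => //; rewrite ltr01 lexx.
Qed.

(** Only finitely many lists over ['I_d] have bounded length, and P is monotone in the constant, so
    constants may be added up. *)
Lemma unif_list (P : seq 'I_d -> R -> Prop) k :
  (forall l (C C' : R), C <= C' -> P l C -> P l C') ->
  (forall l, exists2 C : R, 0 <= C & P l C) ->
  exists2 C : R, 0 <= C & forall l, (size l <= k)%N -> P l C.
Proof.
elim: k P => [|k IH] P mon ex.
  have [C C0 H] := ex [::]; exists C => // l; rewrite leqn0 size_eq0 => /eqP -> //.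
have [C C0 H] := ex [::].
have [|l|C' C'0 H'] := IH (fun l C => forall j, P (j :: l) C).
- by move=> l C1 C2 C12 H1 j; exact: mon C12 (H1 j).
- have /choice[K HK] : forall j, exists C : R, 0 <= C /\ P (j :: l) C.
    by move=> j; have [C1 ? ?] := ex (j :: l); exists C1.
  exists (\sum_j K j); first by apply: sumr_ge0 => j _; have [] := HK j.
  move=> j; have [Kj0 HPj] := HK j; apply: mon HPj.
  by rewrite (bigD1 j)//= lerDl sumr_ge0// => i _; have [] := HK i.
exists (C + C'); first exact: addr_ge0.
move=> [|j l] /=; first by move=> _; apply: mon H; rewrite lerDl.
by rewrite ltnS => lk; apply: mon (H' l lk j); rewrite lerDr.
Qed.

Lemma weyl_seminorm_unif k a : Cc_infty a -> exists2 C : R, 0 <= C &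
  forall l1 l2, (size l1 <= k)%N -> (size l2 <= k)%N -> forall h phi x, 0 < h <= 1 -> decay phi ->
  `|\prod_(j <- l1) x ord0 j| * nC (cdpartials l2 (weyl (dilate h a) phi) x)
  <= C * h ^- (k + k + d) * n2 phi.
Proof.
move=> ca.
have Hp (h : R) n m : 0 < h <= 1 -> (n <= m)%N -> h ^- n <= h ^- m.
  move=> /andP[h0 h1] nm; rewrite lef_pV2 ?posrE ?exprn_gt0//.
  by apply: ler_wiXn2l => //; exact: ltW.
pose Q l1 l2 (C : R) := (size l1 <= k)%N -> (size l2 <= k)%N -> forall h phi x, 0 < h <= 1 -> decay phi ->
  `|\prod_(j <- l1) x ord0 j| * nC (cdpartials l2 (weyl (dilate h a) phi) x)
  <= C * h ^- (k + k + d) * n2 phi.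
have monQ l1 l2 C C' : C <= C' -> Q l1 l2 C -> Q l1 l2 C'.
  move=> CC H s1 s2 h phi x hh dp; apply: le_trans (H s1 s2 h phi x hh dp) _.
  rewrite ler_wpM2r ?n2_ge0// ler_wpM2r// invr_ge0 exprn_ge0//.
  by case/andP: hh => /ltW.
have [|l1|C C0 H] := @unif_list (fun l1 C => forall l2, (size l2 <= k)%N -> Q l1 l2 C) k.
- by move=> l1 C C' CC H l2 s2; exact: monQ CC (H l2 s2).
- apply: unif_list; first by move=> l2 C C'; exact: monQ.
  move=> l2; have [C C0 H] := weyl_seminorm l1 l2 ca; exists C => // s1 s2 h phi x hh dp.
  apply: le_trans (H h phi x hh dp) _; rewrite ler_wpM2r ?n2_ge0// ler_wpM2l//.
  by apply: Hp => //; rewrite leq_add2r leq_add.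
by exists C => // l1 l2 s1 s2; exact: H.
Qed.

(** Continuity at 0 with tolerance 1, made homogeneous by rescaling psi until its seminorms are at
    most [dl]. *)
Lemma tempered_bound (u : ('rV[R]_d -> R[i]) -> R[i]) : tempered u ->
  exists N : nat, exists2 K : R, 0 <= K & forall psi (S : R), schwartz psi -> 0 <= S ->
   (forall l1 l2, (size l1 <= N)%N -> (size l2 <= N)%N -> forall x,
     `|\prod_(j <- l1) x ord0 j| * nC (cdpartials l2 psi x) <= S) -> nC (u psi) <= K * S.
Proof.
move=> [ulin ucont].
have u0 : u (fun=> 0) = 0.
  have := ulin 1 _ _ schwartz0 schwartz0.
  rewrite (_ : (fun x => _) = fun=> 0); last by apply/funext => x; rewrite mulr0 addr0.
  by rewrite mul1r; move/eqP; rewrite -subr_eq0 opprD addNKr oppr_eq0 => /eqP.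
have [N [dl dl0 H]] := ucont _ schwartz0 1 ltr01.
exists N, dl^-1; first by rewrite invr_ge0 ltW.
move=> psi S sp S0 HS; apply/ler_addgt0Pr => e e0.
have Se : 0 < S + dl * e by rewrite ltr_wpDl// mulr_gt0.
(* The summand dl e keeps the scale finite when S = 0; it contributes exactly e to the final
   bound. *)
pose c := dl / (S + dl * e); have c0 : 0 < c by rewrite divr_gt0.
have scp : schwartz (fun x => c%:C * psi x).
  have := schwartz_lin c%:C 0 sp schwartz0.
  by under eq_fun do rewrite mul0r addr0.
have ucp : u (fun x => c%:C * psi x) = c%:C * u psi.
  have := ulin c%:C _ _ sp schwartz0; rewrite u0 addr0 => <-.
  by congr u; apply/funext => x; rewrite addr0.
have := H _ scp; rewrite u0 subr0 ucp nCM nCr gtr0_norm// => /(_ _)/ltW Hc.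
suff : c * nC (u psi) <= 1.
  rewrite -ler_pdivlMl// mulr1 /c invf_div => /le_trans; apply.
  by rewrite mulrDl mulrC lerD2l mulrAC divff ?mul1r// gt_eqF.
apply: Hc => alpha beta sa sb; apply: seminorm_le => x.
rewrite (_ : (fun x => _) = fun x => c%:C * psi x + 0 * psi x); last first.
  by apply/funext => z; rewrite mul0r addr0 subr0.
rewrite (cdpartials_lin _ _ _ (proj1 sp) (proj1 sp)) mul0r addr0 nCM nCr (gtr0_norm c0) mulrCA.
rewrite -ler_pdivlMl// /c invf_div divfK ?gt_eqF//.
apply: le_trans (HS _ _ _ _ x) _; rewrite ?size_mlist//.
by rewrite lerDl mulr_ge0// ltW.
Qed.

(** The Landau-Kolmogorov inequality with a free step r: a difference quotient of length r
    approximates the derivative up to r times the second derivative. The outer 2 accounts for real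
    and imaginary parts. *)
Lemma landau j f (E M r : R) : csmooth f -> 0 < r ->
  (forall x, nC (f x) <= E) -> (forall x, nC (cD j (cD j f) x) <= M) ->
  forall x, nC (cD j f x) <= 2 * (2 * E / r + r * M).
Proof.
move=> sf r0 fE fM x.
have H (g : 'rV[R]_d -> R) : smooth g -> (forall x, `|g x| <= E) ->
    (forall x, `|pd j (pd j g) x| <= M) -> `|pd j g x| <= 2 * E / r + r * M.
  move=> sg gE gM.
  have [c cr Ec] := mvt r (fun t => pd_line x t (fun y => @smooth_derivable _ _ _ j y sg)).
  have [c' _ Ec'] := mvt c (fun t => pd_line x t (fun y => @smooth_derivable _ _ _ j y (smooth_pd j sg))).
  move: Ec Ec'; rewrite scale0r addr0 => Ec Ec'.
  have -> : pd j g x = (g (x + r *: delta_mx ord0 j) - g x) / r -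
      pd j (pd j g) (x + c' *: delta_mx ord0 j) * c.
    by rewrite Ec -Ec' mulfK ?gt_eqF//; ring.
  apply: le_trans (ler_normB _ _) _; apply: lerD.
    rewrite normrM [`|r^-1|]gtr0_norm ?invr_gt0// ler_pM2r ?invr_gt0//.
    by apply: le_trans (ler_normB _ _) _; rewrite mulrDl mul1r lerD.
  rewrite normrM mulrC; apply: ler_pM => //.
  by apply: le_trans cr _; rewrite gtr0_norm.
apply: le_trans (nC_le _) _; rewrite mulrDl mul1r; case: sf => sr si; apply: lerD.
  apply: (H (fun x => complex.Re (f x))) => // y.
    exact: le_trans (nC_Re _) (fE y).
  exact: le_trans (nC_Re _) (fM y).
apply: (H (fun x => complex.Im (f x))) => // y.
  exact: le_trans (nC_Im _) (fE y).
exact: le_trans (nC_Im _) (fM y).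
Qed.

Lemma csmooth_cdpartials l f : csmooth f -> csmooth (cdpartials l f).
Proof.
elim: l => [|j l IH] sf; first by rewrite cdpartials0.
exact: (csmooth_cD j (IH sf)).
Qed.

(** Iterates [landau] on successive derivatives. The exponent P may be large, since r will be a
    power of h and E a far higher one. *)
Lemma interp_derivatives n : exists P : nat, exists2 C : R, 0 <= C &
  forall f (E M r : R), csmooth f -> 0 <= E -> 0 <= M -> 0 < r <= 1 ->
  (forall x, nC (f x) <= E) ->
  (forall l, (size l <= 2 * n)%N -> forall x, nC (cdpartials l f x) <= M) ->
  forall l, (size l <= n)%N -> forall x, nC (cdpartials l f x) <= C * (E * r ^- P + r * M).
Proof.
elim: n => [|n [P [C C0 IH]]].
  exists 0%N, 1 => // f E M r sf E0 M0 /andP[r0 r1] fE fM l.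
  rewrite leqn0 size_eq0 => /eqP -> x; rewrite cdpartials0 mul1r expr0 invr1 mulr1.
  by apply: le_trans (fE x) _; rewrite lerDl mulr_ge0// ltW.
exists (2 * P).+1, (4 * C + 3); first by rewrite addr_ge0// mulr_ge0.
move=> f E M r sf E0 M0 /andP[r0 r1] fE fM [|j l] ln x.
  rewrite cdpartials0; apply: le_trans (fE x) _.
  have : 1 <= r ^- (2 * P).+1 by rewrite invf_ge1 ?exprn_gt0// exprn_ile1// ltW.
  move: (r ^- _) => q q1; have rM := mulr_ge0 (ltW r0) M0.
  have EZ : E <= E * q + r * M by apply: (@le_trans _ _ (E * q)); [exact: ler_peMr|rewrite lerDl].
  apply: (le_trans EZ); apply: ler_peMl; [exact: le_trans EZ|].
  by have := mulr_ge0 (ler0n R 4) C0; lra.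
(* The induction hypothesis is taken at r^2: the division by r in [landau] turns r^2 M into r M and
   r^-(2P) into r^-(2P+1). *)
have rr : 0 < r ^+ 2 <= 1 by rewrite exprn_gt0//= exprn_ile1// ltW.
have g1 y : nC (cdpartials l f y) <= C * (E * r ^+ 2 ^- P + r ^+ 2 * M).
  apply: (IH f) => // l' sl' z; apply: fM.
  by apply: leq_trans sl' _; rewrite leq_mul2l/=.
have g2 y : nC (cD j (cD j (cdpartials l f)) y) <= M.
  by apply: (fM (j :: j :: l)); move: ln => /=; rewrite mulnS; lia.
have := landau (csmooth_cdpartials l sf) r0 g1 g2 x.
move/le_trans; apply.
rewrite -exprM [r ^+ (2 * P).+1]exprS invfM.
have -> : 2 * (2 * (C * (E * r ^- (2 * P) + r ^+ 2 * M)) / r + r * M) =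
   4 * C * (E * (r^-1 * r ^- (2 * P))) + (4 * C + 2) * (r * M).
  by field; rewrite ?expf_neq0 ?gt_eqF.
have : 0 <= r^-1 * r ^- (2 * P) by rewrite mulr_ge0 ?invr_ge0 ?exprn_ge0 ?ltW.
move: (r^-1 * _) => q q0; have := mulr_ge0 E0 q0; have := mulr_ge0 (ltW r0) M0; nra.
Qed.

(** Monomials are interpolated like derivatives: y is at most 1/r + r y^2, where y^2 falls under the
    bound M because M covers twice as many factors. *)
Lemma interpolation N : exists P : nat, exists2 C : R, 0 <= C &
  forall f (E M r : R), csmooth f -> 0 <= E -> 0 <= M -> 0 < r <= 1 ->
  (forall x, nC (f x) <= E) ->
  (forall l1 l2, (size l1 <= 2 * N)%N -> (size l2 <= 2 * N)%N -> forall x,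
     `|\prod_(j <- l1) x ord0 j| * nC (cdpartials l2 f x) <= M) ->
  forall l1 l2, (size l1 <= N)%N -> (size l2 <= N)%N -> forall x,
     `|\prod_(j <- l1) x ord0 j| * nC (cdpartials l2 f x) <= C * (E * r ^- P + r * M).
Proof.
have [P [C C0 H]] := interp_derivatives N.
exists (2 * P).+1, (C + 1); first exact: addr_ge0.
move=> f E M r sf E0 M0 rr fE fM l1 l2 s1 s2 x; have [r0 r1] := andP rr.
have rr2 : 0 < r ^+ 2 <= 1 by rewrite exprn_gt0//= exprn_ile1// ltW.
have g : nC (cdpartials l2 f x) <= C * (E * r ^+ 2 ^- P + r ^+ 2 * M).
  apply: H => // l sl y; have := fM [::] l isT sl y.
  by rewrite big_nil normr1 mul1r.
have g' : `|\prod_(j <- l1) x ord0 j| * `|\prod_(j <- l1) x ord0 j| * nC (cdpartials l2 f x) <= M.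
  rewrite -normrM -big_cat; apply: fM; first by rewrite size_cat mul2n -addnn leq_add.
  by apply: leq_trans s2 _; rewrite mul2n -addnn leq_addr.
move: g g'; set y := `|_|; set G := nC _ => g g'.
have y0 : 0 <= y by exact: normr_ge0.
have G0 : 0 <= G by exact: nC_ge0.
have K : y * G <= G / r + r * (y * y * G).
  rewrite -(ler_pM2r r0) [X in _ <= X]mulrDl divfK ?gt_eqF//.
  have : y * r <= 1 + (y * r) ^+ 2 by have := sqr_ge0 (y * r - 1); nra.
  move/(ler_wpM2r G0); nra.
apply: (le_trans K); apply: (@le_trans _ _ (C * (E * r ^+ 2 ^- P + r ^+ 2 * M) / r + r * M)).
  by apply: lerD; [rewrite ler_pM2r ?invr_gt0|rewrite ler_pM2l].
rewrite -exprM [r ^+ (2 * P).+1]exprS invfM.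
have -> : C * (E * r ^- (2 * P) + r ^+ 2 * M) / r + r * M =
   C * (E * (r^-1 * r ^- (2 * P))) + (C + 1) * (r * M).
  by field; rewrite ?expf_neq0 ?gt_eqF.
have : 0 <= r^-1 * r ^- (2 * P) by rewrite mulr_ge0 ?invr_ge0 ?exprn_ge0 ?ltW.
move: (r^-1 * _) => q q0; have := mulr_ge0 E0 q0; have := mulr_ge0 (ltW r0) M0; nra.
Qed.

End schwartz_lists.

(** * Fourier inversion *)

Section vanishing.
Context {R : realType} {d : nat}.
Local Notation mu := (lebesgue_rV R d).

(** If f(x0) > 0 then f is at least f(x0) / 2 on a small cube around x0, whose volume is
    positive. *)
Lemma continuous_Rint0 (f : 'rV[R]_d -> R) : continuous f -> (forall x, 0 <= f x) ->
  mu.-integrable setT (EFin \o f) -> (\int[mu]_x f x)%R = 0 -> forall x, f x = 0.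
Proof.
move=> cf f0 If I0 x0; apply/eqP; rewrite eq_le f0 andbT leNgt; apply/negP => fx0.
have [r r0 H] := (rV_continuousP f).1 cf x0 (f x0 / 2) (divr_gt0 fx0 (ltr0n _ 2)).
have r20 : 0 < r / 2 by rewrite divr_gt0.
pose g x := f x0 / 2 * bx (r / 2) (1 *: x + (- x0)).
have Ig : mu.-integrable setT (EFin \o g).
  have := integrable_rV_affine (- x0) (@ltr01 R) (integrable_bx d (ltW r20)).
  move/(integrableZl measurableT (f x0 / 2)).
  by apply: eq_integrable => // x _ /=; rewrite EFinM.
have gf x : g x <= f x.
  have [h|h] := pselect (forall i, `|(1 *: x + (- x0)) ord0 i| <= r / 2).
    rewrite /g bx_eq1// mulr1.
    have : `|f x0 - f x| < f x0 / 2.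
      apply: H => i; have := h i; rewrite !mxE mul1r distrC => /le_lt_trans; apply.
      by rewrite ltr_pdivrMr// ltr_pMr// ltr1n.
    by rewrite ltr_norml => /andP[_]; lra.
  have /existsNP[i ih] := h.
  suff E : bx (r / 2) (1 *: x + (- x0)) = 0 by rewrite /g E mulr0.
  by rewrite /bx /prodf (bigD1 i)//= indicE memNset ?mul0r//= in_itv/= -ler_norml.
have : (\int[mu]_x g x)%R <= (\int[mu]_x f x)%R by apply: le_Rintegral => // x _; exact: gf.
have Ib := integrable_rV_affine (- x0) (@ltr01 R) (integrable_bx d (ltW r20)).
rewrite I0 /g RintegralZl// (Rint_rV_affine (- x0) (@ltr01 R) (integrable_bx d (ltW r20))) Rint_bx;
  last exact: ltW.
rewrite leNgt => /negP; apply; rewrite expr1n invr1 mul1r.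
by rewrite mulr_gt0 ?divr_gt0// exprn_gt0// mulr_gt0.
Qed.

End vanishing.

Section fourier.
Context {R : realType} {d : nat}.
Local Notation mu := (lebesgue_rV R d).
Implicit Types (a b c : 'rV[R]_(d + d) -> R[i]) (m v x y xi w eta zeta : 'rV[R]_d).

Lemma dotpNl v w : dotp (- v) w = - dotp v w :> R.
Proof. by rewrite /dotp -sumrN; apply: eq_bigr => i _; rewrite mxE mulNr. Qed.

Lemma dotpNr v w : dotp v (- w) = - dotp v w :> R.
Proof. by rewrite dotpC dotpNl dotpC. Qed.

Lemma dotp0l v : dotp 0 v = 0 :> R.
Proof. by rewrite /dotp big1// => i _; rewrite mxE mul0r. Qed.

Lemma cinteg_slice a m : Cc_infty a -> cinteg mu (fun xi => a (row_mx m xi)).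
Proof.
move=> ca; have := cinteg_hat m 0 ca.
by under [X in cinteg _ X -> _]eq_fun do rewrite dotp0l expi0 mul1r.
Qed.

Lemma slice_cvg (f : 'rV[R]_(d + d) -> R) m xi zeta (e : nat -> R) :
  continuous f -> e n @[n --> \oo] --> (0 : R) ->
  (fun n => f (row_mx m (e n *: zeta + xi))) @ \oo --> f (row_mx m xi).
Proof.
move=> cf ecvg; apply/cvgrPdist_lt => eps eps0.
have [dl dl0 H] := (rV_continuousP f).1 cf (row_mx m xi) eps eps0.
pose M := \sum_i `|zeta ord0 i| + 1.
have M0 : 0 < M by rewrite ltr_wpDl// sumr_ge0.
have /cvgrPdist_lt/(_ _ (divr_gt0 dl0 M0)) := ecvg.
apply: filterS => n; rewrite sub0r normrN => en.
apply: H => i; case: (split_ordP i) => j ->.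
  by rewrite !row_mxEl subrr normr0.
rewrite !row_mxEr !mxE opprD addrCA subrr addr0 normrN normrM.
have zM : `|zeta ord0 j| <= M by rewrite /M (bigD1 j)//= -addrA lerDl addr_ge0// sumr_ge0.
by apply: le_lt_trans (ler_wpM2l (normr_ge0 _) zM) _; rewrite -ltr_pdivlMr.
Qed.

Lemma hat_continuous a m : Cc_infty a ->
  continuous (fun v => complex.Re (hat a m v)) /\ continuous (fun v => complex.Im (hat a m v)).
Proof.
move=> ca.
have /choice[K HK] : forall j, exists C : R, forall v, nC (hat (cX (rshift d j) a) m v) <= C.
  move=> j; have [C C0 H] := hat_bound (Cc_cX (rshift d j) ca); exists C => v.
  by apply: le_trans (H _ _) _; rewrite ler_piMr ?wt_le1.
have KK j : K j <= \sum_j `|K j|.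
  by apply: le_trans (ler_norm _) _; rewrite (bigD1 j)//= lerDl sumr_ge0.
have D j v : cder (fun t : R => hat a m (v + t *: delta_mx ord0 j)) 0 ('i * hat (cX (rshift d j) a) m v).
  have := hat_cder m 0 v (delta_mx ord0 j) 0 ca.
  under [X in cder X _ _ -> _]eq_fun do rewrite scaler0 addr0.
  move/cder_eq; apply; rewrite scaler0 addr0 scale0r addr0 big1 ?add0r; last first.
    by move=> i _; rewrite mxE mul0r.
  rewrite (bigD1 j)//= big1 ?addr0; first by rewrite mxE !eqxx mulr1.
  by move=> i ij; rewrite mxE eqxx/= (negbTE ij) mulr0 mul0r.
have B j v : nC ('i * hat (cX (rshift d j) a) m v) <= \sum_j `|K j|.
  by rewrite nCM nCi mul1r; exact: le_trans (HK j v) (KK j).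
split; apply: (bounded_pd_continuous (B := \sum_j `|K j|)) => j v; have [Dr Di] := D j v.
- by have [] := @line_pd _ _ (fun v => complex.Re (hat a m v)) j v _ Dr.
- have [_ ->] := @line_pd _ _ (fun v => complex.Re (hat a m v)) j v _ Dr.
  exact: le_trans (nC_Re _) (B j v).
- by have [] := @line_pd _ _ (fun v => complex.Im (hat a m v)) j v _ Di.
- have [_ ->] := @line_pd _ _ (fun v => complex.Im (hat a m v)) j v _ Di.
  exact: le_trans (nC_Im _) (B j v).
Qed.

Lemma cmeas_hatv a m : Cc_infty a -> cmeas (fun v => hat a m v).
Proof.
by move=> [sa _]; apply: (cmeas_hat (f := fun=> m) (g := id)).
Qed.

Lemma cinteg_hatv a m : Cc_infty a -> cinteg mu (fun v => hat a m v).
Proof.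
move=> ca; have [C C0 H] := hat_bound ca.
exact: (cinteg_dom (cmeas_hatv m ca) (H m) (integrable_Mwt C)).
Qed.

Section inversion.
Variables (a0 : 'rV[R]_(d + d) -> R[i]) (m0 xi0 : 'rV[R]_d).
Hypotheses (ca0 : Cc_infty a0) (a01 : a0 (row_mx m0 xi0) = 1).

Let G w := a0 (row_mx m0 (1 *: w + xi0)).
Let Ghat zeta := Cintegral mu (fun w => expi (dotp w zeta) * G w).

(* Replaces (2 pi)^d in the inversion formula: the regularising factor is G,
   a slice of a0 equal to 1 at the origin, instead of a Gaussian. That the
   constant is not 0 is read off the formula itself, see [inv_const_neq0]. *)
Definition inv_const : R[i] := Cintegral mu Ghat.

Let cG : cinteg mu G.
Proof. exact: (cinteg_rV_affine xi0 (@ltr01 R) (cinteg_slice m0 ca0)). Qed.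

Let GhatE zeta : Ghat zeta = expi (dotp (- xi0) zeta) * hat a0 m0 zeta.
Proof.
have := Cint_rV_shift xi0 (cinteg_hat m0 zeta ca0); rewrite -/(hat a0 m0 zeta) => <-.
rewrite -CintZ; last first.
  have := cinteg_rV_affine xi0 (@ltr01 R) (cinteg_hat m0 zeta ca0).
  by under [X in cinteg _ X -> _]eq_fun do rewrite scale1r.
apply: eq_Cint => w; rewrite /G scale1r mulrA; congr (_ * _).
by rewrite [dotp zeta _]dotpC -expiD -dotpDl addrC addrK.
Qed.

Let Ghat_bound : exists2 C : R, 0 <= C & forall zeta, nC (Ghat zeta) <= C * wt zeta.
Proof.
have [C C0 H] := hat_bound ca0; exists C => // zeta.
by rewrite GhatE nCM nC_expi mul1r; exact: H.
Qed.

Let mGhat : cmeas Ghat.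
Proof.
rewrite (_ : Ghat = fun z => expi (dotp (- xi0) z) * hat a0 m0 z); last by apply/funext => z; exact: GhatE.
by apply: cmeasM; [apply: cmeas_expi; exact: measurable_dotp|exact: cmeas_hatv].
Qed.

Let cGhat : cinteg mu Ghat.
Proof. by have [C C0 H] := Ghat_bound; exact: (cinteg_dom mGhat H (integrable_Mwt C)). Qed.

(** Insert the regularising factor G(e w) with e tending to 0. By dominated convergence the left
    side is recovered, as G(0) = 1. By Fubini and scaling the regularised integral is that of c(m,
    xi + e zeta) [Ghat zeta], which tends to c(m, xi) times the integral of [Ghat]. *)
Lemma fourier_inversion c m xi : Cc_infty c ->
  Cintegral mu (fun w => expi (dotp (- w) xi) * hat c m w) = inv_const * c (row_mx m xi).
Proof.
move=> cc; have sc := proj1 cc.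
have [B0 [rho0 [B00 r00 aB0 _]]] := Cc_bound ca0.
have [B [rho [B0' r0 cB _]]] := Cc_bound cc.
have [C C0 HC] := hat_bound cc; have [C' C'0 HC'] := Ghat_bound.
have [B1 [rho1 [B10 r10 cB1]]] := Cc_box1 cc.
pose e n : R := n.+1%:R^-1.
have e0 n : 0 < e n by rewrite invr_gt0.
have ecvg : (e n) @[n --> \oo] --> (0 : R) by exact: cvg_harmonic.
have mexp : cmeas (fun w : 'rV[R]_d => expi (dotp (- w) xi)).
  apply: cmeas_expi.
  rewrite (_ : (fun w : 'rV[R]_d => dotp (- w) xi) = fun w => dotp w (- xi)).
    exact: measurable_dotp.
  by apply/funext => w; rewrite dotpNl dotpNr.
have mG : cmeas G by exact: cinteg_cmeas cG.
have mGe n : cmeas (fun w : 'rV[R]_d => G (e n *: w)).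
  by apply: (cmeas_comp mG); exact: measurable_rVZ.
have [[cr0 ci0] [cr ci]] := (proj1 ca0, sc).
pose I_ n := Cintegral mu (fun w => G (e n *: w) * (expi (dotp (- w) xi) * hat c m w)).
have L1 : (fun n => complex.Re (I_ n)) @ \oo -->
       complex.Re (Cintegral mu (fun w => expi (dotp (- w) xi) * hat c m w)) /\
     (fun n => complex.Im (I_ n)) @ \oo -->
       complex.Im (Cintegral mu (fun w => expi (dotp (- w) xi) * hat c m w)).
  have mEh : cmeas (fun w => expi (dotp (- w) xi) * hat c m w).
    by apply: cmeasM => //; exact: cmeas_hatv.
  apply: (@Cint_cvg _ _ _ mu (fun n w => G (e n *: w) * (expi (dotp (- w) xi) * hat c m w)) _
     (fun w => B0 * C * wt w)).
  - by move=> n; apply: cmeasM.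
  - exact: mEh.
  - move=> w; move: (_ * hat c m w) => z.
    (* The limit is written with the factor a0(m0, xi0) = 1, so that it matches the product of the
       limits of the two factors. *)
    rewrite (_ : complex.Re z = complex.Re (a0 (row_mx m0 xi0)) * complex.Re z - complex.Im (a0 (row_mx
      m0 xi0)) * complex.Im z); last by rewrite a01 /= mul1r mul0r subr0.
    under eq_fun do rewrite Re_mul /G scale1r.
    apply: cvgB; apply: cvgM; try exact: cvg_cst.
      by apply: (@slice_cvg (fun z => complex.Re (a0 z))) => //; exact: smooth_continuous.
    by apply: (@slice_cvg (fun z => complex.Im (a0 z))) => //; exact: smooth_continuous.
  - move=> w; move: (_ * hat c m w) => z.
    rewrite (_ : complex.Im z = complex.Re (a0 (row_mx m0 xi0)) * complex.Im z + complex.Im (a0 (row_mx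
      m0 xi0)) * complex.Re z); last by rewrite a01 /= mul1r mul0r addr0.
    under eq_fun do rewrite Im_mul /G scale1r.
    apply: cvgD; apply: cvgM; try exact: cvg_cst.
      by apply: (@slice_cvg (fun z => complex.Re (a0 z))) => //; exact: smooth_continuous.
    by apply: (@slice_cvg (fun z => complex.Im (a0 z))) => //; exact: smooth_continuous.
  - exact: integrable_Mwt.
  - move=> n w; rewrite !nCM nC_expi mul1r -mulrA; apply: ler_pM; rewrite ?nC_ge0//.
    exact: aB0.
have E n : I_ n = Cintegral mu (fun zeta => c (row_mx m (e n *: zeta + xi)) * Ghat zeta).
  have en0 : e n != 0 by rewrite gt_eqF.
  have ceG : cinteg mu (fun w => G (e n *: w)).
    have := cinteg_rV_affine 0 (e0 n) cG.
    by under [X in cinteg _ X -> _]eq_fun do rewrite addr0.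
  pose F (p : 'rV[R]_d * 'rV[R]_d) := G (e n *: p.1) * expi (dotp (- p.1) xi) * (expi (dotp p.1 p.2) *
    c (row_mx m p.2)).
  have cF : cinteg (mu \x mu)%E F.
    apply: (@cinteg_dom _ _ _ _ _ (fun p : 'rV[R]_d * 'rV[R]_d => nC (G (e n *: p.1)) * (B1 * bx rho1 p.2))).
    - apply: cmeasM; last first.
        apply: cmeasM; first by apply: cmeas_expi; apply: measurable_dotp;
          [exact: measurable_fst|exact: measurable_snd].
        by apply: (cmeas_comp (csmooth_cmeas sc)); apply: measurable_row_mx => //; exact: measurable_snd.
      by apply: cmeasM; [exact: (cmeas_comp (mGe n))|exact: (cmeas_comp mexp)].
    - by move=> p; rewrite /F !nCM !nC_expi mulr1 mul1r ler_wpM2l ?nC_ge0.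
    - apply: (@integrable_prod _ _ _ _ _ _ _ (fun w => nC (G (e n *: w))) (fun eta => B1 * bx rho1 eta)).
      + by move=> w; exact: nC_ge0.
      + by move=> eta; rewrite mulr_ge0 ?bx_ge0.
      + exact: cinteg_nC.
      + exact: integrable_Mbx.
  transitivity (Cintegral mu (fun w => Cintegral mu (fun eta => F (w, eta)))).
    apply: eq_Cint => w; rewrite mulrA -CintZ; last exact: cinteg_hat.
    by apply: eq_Cint.
  rewrite (Cint_fubini1 cF) -(Cint_fubini2 cF).
  (* The w-integral is the transform of w -> G(e w) at eta - xi, that is e^-d
     [Ghat ((eta - xi) / e)]; the substitution eta = e zeta + xi absorbs e^-d. *)
  pose K eta := c (row_mx m eta) * Ghat ((e n)^-1 *: (eta - xi)).
  have cK : cinteg mu K.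
    apply: (@cinteg_dom _ _ _ _ _ (fun eta => B1 * C' * bx rho1 eta)).
    - apply: cmeasM; first exact: (cinteg_cmeas (cinteg_slice m cc)).
      apply: (cmeas_comp mGhat); apply: measurable_rVZ; exact: measurable_rVB.
    - move=> eta; rewrite /K nCM mulrAC; apply: ler_pM; rewrite ?nC_ge0//.
      by apply: le_trans (HC' _) _; rewrite ler_piMr ?wt_le1.
    - exact: integrable_Mbx.
  transitivity (Cintegral mu (fun zeta => K (e n *: zeta + xi))); last first.
    by apply: eq_Cint => zeta; rewrite /K addrK scalerA mulVf// scale1r.
  rewrite (Cint_rV_affine xi (e0 n) cK) -CintZ//; apply: eq_Cint => eta.
  rewrite /K; set z := (e n)^-1 *: _.
  have cz : cinteg mu (fun w => expi (dotp w z) * G w).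
    apply: (@cinteg_dom _ _ _ _ _ (fun w => nC (G w))).
    - by apply: cmeasM => //; apply: cmeas_expi; exact: measurable_dotp.
    - by move=> w; rewrite nCM nC_expi mul1r.
    - exact: cinteg_nC.
  rewrite mulrCA -(Cint_rV_affine 0 (e0 n) cz) -CintZ; last first.
    exact: (cinteg_rV_affine 0 (e0 n) cz).
  apply: eq_Cint => w; rewrite /F addr0 /= /z dotpZl dotpZr mulVKf//.
  have -> : dotp w (eta - xi) = dotp (- w) xi + dotp w eta.
    by rewrite dotpDr addrC dotpNl dotpNr.
  by rewrite expiD; ring.
have L2 : (fun n => complex.Re (I_ n)) @ \oo --> complex.Re (inv_const * c (row_mx m xi)) /\
     (fun n => complex.Im (I_ n)) @ \oo --> complex.Im (inv_const * c (row_mx m xi)).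
  under eq_fun do rewrite E; under [X in _ /\ (X @ _ --> _)]eq_fun do rewrite E.
  have -> : inv_const * c (row_mx m xi) = Cintegral mu (fun zeta => c (row_mx m xi) * Ghat zeta).
    by rewrite (CintZ _ cGhat) mulrC.
  apply: (@Cint_cvg _ _ _ mu (fun n zeta => c (row_mx m (e n *: zeta + xi)) * Ghat zeta) _
     (fun w => B * C' * wt w)).
  - move=> n; apply: cmeasM => //.
    by apply: (cmeas_comp (cinteg_cmeas (cinteg_slice m cc))); exact: measurable_rV_affine.
  - by apply: cmeasM => //; exact: cmeas_cst.
  - move=> w; move: (Ghat w) => z; rewrite Re_mul; under eq_fun do rewrite Re_mul.
    apply: cvgB; apply: cvgM; try exact: cvg_cst.
      by apply: (@slice_cvg (fun z => complex.Re (c z))) => //; exact: smooth_continuous.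
    by apply: (@slice_cvg (fun z => complex.Im (c z))) => //; exact: smooth_continuous.
  - move=> w; move: (Ghat w) => z; rewrite Im_mul; under eq_fun do rewrite Im_mul.
    apply: cvgD; apply: cvgM; try exact: cvg_cst.
      by apply: (@slice_cvg (fun z => complex.Re (c z))) => //; exact: smooth_continuous.
    by apply: (@slice_cvg (fun z => complex.Im (c z))) => //; exact: smooth_continuous.
  - exact: integrable_Mwt.
  - by move=> n w; rewrite nCM -mulrA; apply: ler_pM; rewrite ?nC_ge0.
have [L1r L1i] := L1; have [L2r L2i] := L2.
by apply: complex_eqP; [exact: (cvg_unique _ L1r L2r)|exact: (cvg_unique _ L1i L2i)].
Qed.

(** Write the first transform as an integral over xi and exchange the integrals; the integral over w
    is then Fourier inversion for c at xi, translated by y. *)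
Lemma hat_convolution a c m x y : Cc_infty a -> Cc_infty c ->
  Cintegral mu (fun w => hat a m (x - w) * hat c m (w - y)) =
  inv_const * hat (fun z => a z * c z) m (x - y).
Proof.
move=> ca cc.
have [B1 [rho1 [B10 r10 H1]]] := Cc_box1 ca.
have chs := cinteg_rV_affine (- y) (@ltr01 R) (cinteg_hatv m cc).
pose F (p : 'rV[R]_d * 'rV[R]_d) := expi (dotp (x - p.1) p.2) * a (row_mx m p.2) * hat c m (p.1 - y).
have cF : cinteg (mu \x mu)%E F.
  apply: (@cinteg_dom _ _ _ _ _ (fun p : 'rV[R]_d * 'rV[R]_d =>
    nC (hat c m (1 *: p.1 + (- y))) * (B1 * bx rho1 p.2))).
  - apply: cmeasM.
      apply: cmeasM.
        apply: cmeas_expi; apply: measurable_dotp; last exact: measurable_snd.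
        by apply: measurable_rVB => //; exact: measurable_fst.
      by apply: (cmeas_comp (csmooth_cmeas (proj1 ca))); apply: measurable_row_mx => //; exact: measurable_snd.
    apply: (cmeas_comp (cmeas_hatv m cc)); apply: measurable_rVB => //; exact: measurable_fst.
  - by move=> p; rewrite /F !nCM nC_expi mul1r mulrC scale1r ler_wpM2l ?nC_ge0.
  - apply: (@integrable_prod _ _ _ _ _ _ _ (fun w => nC (hat c m (1 *: w + (- y)))) (fun eta =>
      B1 * bx rho1 eta)).
    + by move=> w; exact: nC_ge0.
    + by move=> eta; rewrite mulr_ge0 ?bx_ge0.
    + exact: (cinteg_nC chs).
    + exact: integrable_Mbx.
transitivity (Cintegral mu (fun w => Cintegral mu (fun xi => F (w, xi)))).
  apply: eq_Cint => w; rewrite mulrC -CintZ; last exact: cinteg_hat.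
  by apply: eq_Cint => xi; rewrite /F /= mulrC.
rewrite (Cint_fubini1 cF) -(Cint_fubini2 cF) -CintZ; last exact: (cinteg_hat _ _ (CcMl (proj1 ca) cc)).
apply: eq_Cint => xi.
have cE : cinteg mu (fun w => expi (dotp (- w) xi) * hat c m w).
  apply: (@cinteg_dom _ _ _ _ _ (fun w => nC (hat c m w))).
  - apply: cmeasM; last exact: cmeas_hatv.
    apply: cmeas_expi.
    rewrite (_ : (fun w : 'rV[R]_d => dotp (- w) xi) = fun w => dotp w (- xi)).
      exact: measurable_dotp.
    by apply/funext => w; rewrite dotpNl dotpNr.
  - by move=> w; rewrite nCM nC_expi mul1r.
  - exact: (cinteg_nC (cinteg_hatv m cc)).
transitivity (expi (dotp (x - y) xi) * a (row_mx m xi) *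
   Cintegral mu (fun w => expi (dotp (- (1 *: w + (- y))) xi) * hat c m (1 *: w + (- y)))).
  rewrite -CintZ; last exact: (cinteg_rV_affine (- y) (@ltr01 R) cE).
  apply: eq_Cint => w; rewrite /F /= scale1r.
  have -> : dotp (x - w) xi = dotp (x - y) xi + dotp (- (w - y)) xi.
    by rewrite -dotpDl opprB addrA subrK.
  by rewrite expiD; ring.
rewrite (Cint_rV_affine (- y) (@ltr01 R) cE) expr1n invr1 mul1r fourier_inversion//.
by ring.
Qed.

Lemma Cc_conj a : Cc_infty a -> Cc_infty (fun z => (a z)^*).
Proof.
move=> ca; have [[sr si] _] := ca; apply: (Cc_sub ca).
  split.
    by rewrite (_ : (fun z => _) = fun x : 'rV[R]_(d + d) => complex.Re (a x))//; apply/funext => x;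
      case: (a x).
  rewrite (_ : (fun z => _) = fun x : 'rV[R]_(d + d) => - complex.Im (a x)); first exact: smoothN.
  by apply/funext => x; case: (a x).
by move=> x; rewrite conjc_eq0; exact: supp_neq0.
Qed.

Lemma hat_conj a m v : Cc_infty a -> hat (fun z => (a z)^*) m (- v) = (hat a m v)^*.
Proof.
move=> ca; have [_ Ii] := cinteg_hat m v ca.
have E xi : expi (dotp (- v) xi) * (a (row_mx m xi))^* = (expi (dotp v xi) * a (row_mx m xi))^*.
  rewrite rmorphM; congr (_ * _).
  by rewrite dotpNl /expi cosN sinN.
apply: complex_eqP.
  transitivity (complex.Re (hat a m v)); last by case: (hat a m v).
  by apply: eq_Rintegral => xi _; rewrite E; case: (_ * _).
transitivity (- complex.Im (hat a m v)); last by case: (hat a m v).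
rewrite -mulN1r -RintegralZl//; apply: eq_Rintegral => xi _.
by rewrite E mulN1r; case: (_ * _).
Qed.

Lemma conj_mul_self (z : R[i]) : z * z^* = (nC z ^+ 2)%:C.
Proof.
rewrite nC_sqr; case: z => p q; apply: complex_eqP; rewrite ?Re_mul ?Im_mul /=; ring.
Qed.

(** Were the constant 0, the convolution formula for c = |a0|^2 and its conjugate at x = y = 0 would
    say that the transform of c on the slice has zero L^2 norm. By continuity it would vanish, in
    particular at 0, where it is the integral of |a0|^2; then a0 would vanish on the slice, against
    a0 = 1. *)
Lemma inv_const_neq0 : inv_const != 0.
Proof.
apply/eqP => k0; have cconj := Cc_conj ca0.
have cc : Cc_infty (fun z => (a0 z)^* * a0 z) by apply: CcMl => //; case: cconj.
set c := (fun z => (a0 z)^* * a0 z) in cc.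
have [C C0 HC] := hat_bound cc.
have z1 v : nC (hat c m0 v) ^+ 2 = 0.
  move: v; apply: continuous_Rint0.
  - have [hr hi] := hat_continuous m0 cc.
    under [X in continuous X]eq_fun do rewrite nC_sqr !expr2.
    by move=> v; exact: (cvgD (cvgM (hr v) (hr v)) (cvgM (hi v) (hi v))).
  - by move=> v; exact: sqr_ge0.
  - apply: (@integrable_dom _ _ _ _ _ (fun v => C * C * wt v)).
    + by apply: measurable_funX; apply: cmeas_nC; exact: cmeas_hatv.
    + move=> v; rewrite ger0_norm ?sqr_ge0// expr2 -mulrA.
      apply: (ler_pM (nC_ge0 _) (nC_ge0 _)); last exact: HC.
      by apply: le_trans (HC _ _) _; rewrite ler_piMr ?wt_le1.
    + exact: integrable_Mwt.
  - have := hat_convolution m0 0 0 (Cc_conj cc) cc; rewrite k0 mul0r => /(congr1 (@complex.Re R)).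
    rewrite Re_Cint => E; rewrite -[RHS]/(complex.Re (0 : R[i])) -E; apply: eq_Rintegral => w _.
    by rewrite sub0r subr0 hat_conj// mulrC conj_mul_self.
have z2 : hat c m0 0 = 0.
  by apply: nC_eq0; have /eqP := z1 0; rewrite expf_eq0 /= => /eqP.
have [hr hi] := proj1 ca0.
have sl (f : 'rV[R]_(d + d) -> R) : continuous f -> continuous (fun xi => f (row_mx m0 xi)).
  move=> /rV_continuousP cf; apply/rV_continuousP => xi eps eps0.
  have [dl dl0 H] := cf (row_mx m0 xi) eps eps0; exists dl => // eta he.
  apply: H => i; case: (split_ordP i) => j ->; last by rewrite !row_mxEr.
  by rewrite !row_mxEl subrr normr0.
have /(_ xi0) : forall xi, nC (a0 (row_mx m0 xi)) ^+ 2 = 0.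
  apply: continuous_Rint0.
  - under [X in continuous X]eq_fun do rewrite nC_sqr !expr2.
    have c1 := sl _ (smooth_continuous hr); have c2 := sl _ (smooth_continuous hi).
    by move=> v; exact: (cvgD (cvgM (c1 v) (c1 v)) (cvgM (c2 v) (c2 v))).
  - by move=> v; exact: sqr_ge0.
  - have [+ _] := cinteg_slice m0 cc; apply: eq_integrable => // xi _ /=.
    by rewrite /c mulrC conj_mul_self.
  - move/(congr1 (@complex.Re R)) : z2; rewrite Re_Cint => E.
    rewrite -[RHS]/(complex.Re (0 : R[i])) -E; apply: eq_Rintegral => xi _.
    by rewrite dotp0l expi0 mul1r /c [_ * a0 _]mulrC conj_mul_self.
rewrite a01 => /eqP; rewrite expf_eq0 /=; apply/negP.
by rewrite expr1n expr0n addr0 sqrtr1 oner_neq0.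
Qed.

End inversion.

Lemma hat_convolution_const a0 z0 : Cc_infty a0 -> a0 z0 = 1 ->
  exists2 k : R[i], k != 0 & forall a c m x y, Cc_infty a -> Cc_infty c ->
  Cintegral mu (fun w => hat a m (x - w) * hat c m (w - y)) =
  k * hat (fun z => a z * c z) m (x - y).
Proof.
move=> ca0 a01; have a01' : a0 (row_mx (lsubmx z0) (rsubmx z0)) = 1 by rewrite hsubmxK.
exists (inv_const a0 (lsubmx z0) (rsubmx z0)); first exact: inv_const_neq0.
by move=> a c m x y ca cc; exact: hat_convolution.
Qed.

End fourier.

(** * The Moyal expansion *)

Section taylor.
Context {R : realType}.

Lemma cder_monomial k (t : R) :
  cder (fun t : R => (t ^+ k.+1 / k.+1`!%:R)%:C) t (t ^+ k / k`!%:R)%:C.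
Proof.
split => /=; last exact: is_derive_cst.
have h : forall c : R, is_derive t (1 : R) (fun t : R => t ^+ k.+1 * c) (k.+1%:R * t ^+ k * c).
  move=> c; have h := is_deriveM (is_deriveX k.+1 (is_derive_id t (1 : R))) (is_derive_cst c t (1 : R)).
  have -> : (fun t : R => t ^+ k.+1 * c) = (id : R -> R) ^+ k.+1 * cst c by apply/funext => r;
    rewrite fctE exprfctE.
  by apply: (is_derive_eq h); rewrite scaler0 add0r /= /GRing.scale/= mulr1 mulrC.
apply: (is_derive_eq (h _)).
have f0 : k`!%:R != 0 :> R by rewrite pnatr_eq0 -lt0n fact_gt0.
rewrite /GRing.scale/= factS natrM; field.
by rewrite f0 /= addrC natr1 pnatr_eq0.
Qed.

(** Induction on the order: the derivative of the remainder is the remainder for the shifted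
    sequence, and the mean value theorem integrates the bound. Each step costs a factor 2, real and
    imaginary parts having different mean value points. *)
Lemma taylor_bound J (g : nat -> R -> R[i]) (B : R) :
  (forall k t, cder (g k) t (g k.+1 t)) -> (forall t, nC (g J t) <= B) ->
  forall t, `|t| <= 1 ->
  nC (g 0%N t - \sum_(k < J) (t ^+ k / k`!%:R)%:C * g k 0) <= 2 ^+ J * B.
Proof.
elim: J g => [|J IH] g dg gB t t1.
  by rewrite big_ord0 subr0 expr0 mul1r.
pose D s := g 0%N s - \sum_(k < J.+1) (s ^+ k / k`!%:R)%:C * g k 0.
pose D' s := g 1%N s - \sum_(k < J) (s ^+ k / k`!%:R)%:C * g k.+1 0.
have B0 : 0 <= B by apply: le_trans (nC_ge0 _) (gB 0).
have D'B s : `|s| <= 1 -> nC (D' s) <= 2 ^+ J * B.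
  by move=> s1; apply: (IH (fun k => g k.+1)) => // k r; exact: dg.
have DE s : D s = g 0%N s + (-1) * (g 0%N 0 + \sum_(k < J) (s ^+ k.+1 / k.+1`!%:R)%:C * g k.+1 0).
  by rewrite /D big_ord_recl /= expr0 fact0 divr1 mul1r mulN1r.
have dD s : cder D s (D' s).
  have h : D = fun s => g 0%N s + (-1) * (g 0%N 0 + \sum_(k < J) (s ^+ k.+1 / k.+1`!%:R)%:C * g k.+1 0).
    by apply/funext => r; exact: DE.
  rewrite h.
  apply: (cder_eq (cderD (dg 0%N s) (cderZ (-1) (cderD (cder_cst (g 0%N 0) s)
    (cder_sum (index_enum 'I_J) (fun k : 'I_J => cderM (cder_monomial k s) (cder_cst (g k.+1 0) s))))))).
  rewrite add0r mulN1r; congr (_ - _); apply: eq_bigr => k _.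
  by rewrite mulr0 addr0.
have D0 : D 0 = 0.
  rewrite DE big1 ?addr0 ?mulN1r ?subrr// => k _.
  by rewrite expr0n mul0r mul0r.
have [c1 hc1 E1] := mvt t (fun s => proj1 (dD s)).
have [c2 hc2 E2] := mvt t (fun s => proj2 (dD s)).
move: E1 E2; rewrite D0 !subr0 => E1 E2.
rewrite -/(D t); apply: le_trans (nC_le _) _; rewrite E1 E2 !normrM exprS -mulrA mulrDl mul1r.
have K s (z : R) : `|s| <= 1 -> `|z| <= nC (D' s) -> `|z| * `|t| <= 2 ^+ J * B.
  move=> s1 zs; rewrite -[X in _ <= X]mulr1; apply: ler_pM => //.
  exact: le_trans zs (D'B s s1).
by apply: lerD; [apply: (K c1 _ (le_trans hc1 t1)); exact: nC_Re|apply: (K c2 _ (le_trans hc2 t1));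
  exact: nC_Im].
Qed.

End taylor.

Section moyal.
Context {R : realType} {d : nat}.
Local Notation mu := (lebesgue_rV R d).
Implicit Types (a b c : 'rV[R]_(d + d) -> R[i]) (x y w : 'rV[R]_d) (phi : 'rV[R]_d -> R[i]).

(** [dual_coord] and [moyal_sg] encode the symplectic bidifferential operator (i/2) sum_j (d_{x_j} a
    d_{xi_j} c - d_{xi_j} a d_{x_j} c) as a single sum over the coordinates of R^{2d}. *)
Definition dual_coord (k : 'I_(d + d)) : 'I_(d + d) :=
  match fintype.split k with inl j => rshift d j | inr j => lshift d j end.

Definition moyal_sg (k : 'I_(d + d)) : R[i] :=
  match fintype.split k with inl _ => 'i * (2^-1)%:C | inr _ => - ('i * (2^-1)%:C) end.

(* The kernel of a^w c^w at (x, y) is the integral over w of [moyal_ker a c 1],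
   while at t = 0 both symbols are taken at the midpoint (x + y) / 2.
   [moyal_dker n] is the n-th derivative in t, and [moyal n], which involves the
   same derivatives of a and c, is n! times the n-th term of the Moyal product. *)
Definition moyal_ker a c (t : R) x w y : R[i] :=
  hat a (2^-1 *: (x + y) + t *: (2^-1 *: (w - y))) (x - w) *
  hat c (2^-1 *: (x + y) + t *: (- 2^-1 *: (x - w))) (w - y).

Fixpoint moyal_dker n a c (t : R) x w y : R[i] :=
  if n is n'.+1 then \sum_k moyal_sg k * moyal_dker n' (cD k a) (cD (dual_coord k) c) t x w y
  else moyal_ker a c t x w y.

Fixpoint moyal n a c : 'rV[R]_(d + d) -> R[i] :=
  if n is n'.+1 then fun z => \sum_k moyal_sg k * moyal n' (cD k a) (cD (dual_coord k) c) z
  else fun z => a z * c z.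

Lemma hat_cder_x a m s v (t : R) : Cc_infty a ->
  cder (fun t => hat a (m + t *: s) v) t
   (\sum_j (s ord0 j)%:C * hat (cD (lshift d j) a) (m + t *: s) v).
Proof.
move=> ca; have := hat_cder m s v 0 t ca.
under [X in cder X _ _ -> _]eq_fun do rewrite scaler0 addr0.
rewrite scaler0 addr0 [X in _ + X]big1 ?addr0// => j _.
by rewrite mxE mulr0 mul0r.
Qed.

(** In t the midpoint of the first symbol moves by (w - y) / 2, and w - y is the Fourier variable of
    the second one: by [hat_ibp] this factor becomes i times a xi-derivative of c. The other
    midpoint moves by -(x - w) / 2, which gives the opposite sign. *)
Lemma moyal_ker_cder a c (t : R) x w y : Cc_infty a -> Cc_infty c ->
  cder (fun t => moyal_ker a c t x w y) t (\sum_k moyal_sg k * moyal_ker (cD k a) (cD (dual_coord k) c)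
    t x w y).
Proof.
move=> ca cc; apply: (cder_eq (cderM (hat_cder_x _ _ _ _ ca) (hat_cder_x _ _ _ _ cc))).
rewrite big_split_ord /=; congr (_ + _).
  rewrite mulr_suml; apply: eq_bigr => j _; rewrite /moyal_sg /dual_coord !(unsplitK (inl j)) /moyal_ker.
  rewrite mxE rmorphM.
  have := hat_ibp j (2^-1 *: (x + y) + t *: (- 2^-1 *: (x - w))) (w - y) cc.
  move: (hat c _ _) (hat (cD (rshift d j) c) _ _) (hat (cD (lshift d j) a) _ _) => A A' C' E.
  transitivity ((2^-1)%:C * C' * (((w - y) ord0 j)%:C * A)); first by ring.
  by rewrite E; ring.
rewrite mulr_sumr; apply: eq_bigr => j _; rewrite /moyal_sg /dual_coord !(unsplitK (inr j)) /moyal_ker.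
rewrite mxE rmorphM mulrA [_ * (_ * _)]mulrA.
have := hat_ibp j (2^-1 *: (x + y) + t *: (2^-1 *: (w - y))) (x - w) ca.
move: (hat a _ _) (hat (cD (rshift d j) a) _ _) (hat (cD (lshift d j) c) _ _) => A A' C' E.
rewrite rmorphN; transitivity (- ((2^-1)%:C * C' * (((x - w) ord0 j)%:C * A))); first by ring.
by rewrite E; ring.
Qed.

Lemma moyal_dker_cder n a c (t : R) x w y : Cc_infty a -> Cc_infty c ->
  cder (fun t => moyal_dker n a c t x w y) t (moyal_dker n.+1 a c t x w y).
Proof.
elim: n a c => [|n IH] a c ca cc; first exact: moyal_ker_cder.
rewrite [moyal_dker n.+2]/moyal_dker -/moyal_dker -/(moyal_dker n.+1); apply: cder_sum => k; apply: cderZ.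
by apply: IH; exact: Cc_cD.
Qed.

Lemma Cc_moyal n a c : Cc_infty a -> Cc_infty c -> Cc_infty (moyal n a c).
Proof.
elim: n a c => [|n IH] a c ca cc; first exact: (CcMl (proj1 ca) cc).
by apply: Cc_sum => k; apply: CcZ; apply: IH; exact: Cc_cD.
Qed.

Lemma moyal_supp n a c : supp (moyal n a c) `<=` supp c.
Proof.
apply: supp_sub => z; elim: n a c => [|n IH] a c.
  by rewrite /= mulf_eq0 negb_or => /andP[_]; exact: supp_neq0.
apply: contraPP => nc; apply/negP/negPn/eqP; rewrite /= big1// => k _.
have [->|h] := eqVneq (moyal n (cD k a) (cD (dual_coord k) c) z) 0; first by rewrite mulr0.
by exfalso; apply: nc; apply: (@cD_supp _ _ (dual_coord k)); exact: IH h.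
Qed.

Lemma cDZ_fun (k : 'I_(d + d)) (l : R[i]) a : csmooth a ->
  cD k (fun z => l * a z) = fun z => l * cD k a z.
Proof. by move=> sa; apply/funext => z; exact: cDZ. Qed.

Lemma moyalZ n (l m : R[i]) a c : csmooth a -> csmooth c ->
  moyal n (fun z => l * a z) (fun z => m * c z) = fun z => l * m * moyal n a c z.
Proof.
elim: n a c => [|n IH] a c sa sc; first by apply/funext => z /=; ring.
apply/funext => z /=; rewrite mulr_sumr; apply: eq_bigr => k _.
rewrite (cDZ_fun _ _ sa) (cDZ_fun _ _ sc) (IH _ _ (csmooth_cD _ sa) (csmooth_cD _ sc)).
by ring.
Qed.

Lemma moyal_dkerZ n (l m : R[i]) a c (t : R) x w y : Cc_infty a -> Cc_infty c ->
  moyal_dker n (fun z => l * a z) (fun z => m * c z) t x w y = l * m * moyal_dker n a c t x w y.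
Proof.
elim: n a c => [|n IH] a c ca cc.
  by rewrite /= /moyal_ker (hatZ _ _ _ ca) (hatZ _ _ _ cc); ring.
rewrite /= mulr_sumr; apply: eq_bigr => k _.
rewrite (cDZ_fun _ _ (proj1 ca)) (cDZ_fun _ _ (proj1 cc)) (IH _ _ (Cc_cD _ ca) (Cc_cD _ cc)).
by ring.
Qed.

Lemma csmooth_dilate h a : h != 0 -> Cc_infty a -> csmooth (dilate h a).
Proof. by move=> h0 ca; have [] := Cc_dilate h0 ca. Qed.

(** Each order differentiates both symbols once, hence the gain h^2 per order. *)
Lemma moyal_dilate n h a c : h != 0 -> Cc_infty a -> Cc_infty c ->
  moyal n (dilate h a) (dilate h c) = fun z => (h ^+ (2 * n))%:C * dilate h (moyal n a c) z.
Proof.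
move=> h0; elim: n a c => [|n IH] a c ca cc.
  by apply/funext => z; rewrite muln0 expr0 mul1r.
apply/funext => z; rewrite /= /dilate mulr_sumr; apply: eq_bigr => k _.
rewrite (cD_dilate h k (proj1 ca)) (cD_dilate h (dual_coord k) (proj1 cc)).
rewrite (moyalZ _ _ _ (csmooth_dilate h0 (Cc_cD _ ca)) (csmooth_dilate h0 (Cc_cD _ cc))).
rewrite (IH _ _ (Cc_cD _ ca) (Cc_cD _ cc)) /dilate mulnS exprD expr2 !rmorphM; ring.
Qed.

Lemma nC_moyal_sg k : nC (moyal_sg k) <= 1.
Proof.
have h : nC ('i * (2^-1)%:C : R[i]) <= 1.
  by rewrite nCM nCi mul1r nCr ger0_norm ?invr_ge0// invf_le1// ler1n.
by rewrite /moyal_sg; case: fintype.split => _ //; rewrite nCN.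
Qed.

(** The factor h^(2n) comes from the derivatives and h^-(2d) from the two transforms. The bound is
    uniform in t because [hat_dilate_bound] is uniform in the midpoint. *)
Lemma moyal_dker_bound n a c : Cc_infty a -> Cc_infty c -> exists2 C : R, 0 <= C &
  forall h t x w y, 0 < h <= 1 ->
  nC (moyal_dker n (dilate h a) (dilate h c) t x w y) <= C * (h ^+ (2 * n) * h ^- (d + d)) * (wt (x -
    w) * wt (w - y)).
Proof.
elim: n a c => [|n IH] a c ca cc.
  have [C1 C10 H1] := hat_dilate_bound ca; have [C2 C20 H2] := hat_dilate_bound cc.
  exists (C1 * C2); first exact: mulr_ge0.
  move=> h t x w y hh; rewrite /moyal_dker /moyal_ker nCM muln0 expr0 mul1r exprD invfM.
  apply: le_trans (ler_pM (nC_ge0 _) (nC_ge0 _) (H1 _ _ _ hh) (H2 _ _ _ hh)) _.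
  by apply: eq_ler; move: (h ^- d) => p; ring.
have /choice[K HK] : forall k, exists C : R, 0 <= C /\ forall h t x w y, 0 < h <= 1 ->
    nC (moyal_dker n (dilate h (cD k a)) (dilate h (cD (dual_coord k) c)) t x w y) <=
    C * (h ^+ (2 * n) * h ^- (d + d)) * (wt (x - w) * wt (w - y)).
  by move=> k; have [C C0 H] := IH _ _ (Cc_cD k ca) (Cc_cD (dual_coord k) cc); exists C.
exists (\sum_k K k); first by apply: sumr_ge0 => k _; have [] := HK k.
move=> h t x w y hh; have [h0 h1] := andP hh; have hn : h != 0 by rewrite gt_eqF.
rewrite [moyal_dker _]/moyal_dker -/moyal_dker; apply: le_trans (nC_sum _ _) _;
  rewrite -mulrA mulr_suml; apply: ler_sum => k _.
have [Kk0 Hk] := HK k.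
rewrite (cD_dilate h k (proj1 ca)) (cD_dilate h (dual_coord k) (proj1 cc)).
rewrite (moyal_dkerZ n _ _ t x w y (Cc_dilate hn (Cc_cD _ ca)) (Cc_dilate hn (Cc_cD _ cc))).
rewrite nCM [X in _ * X]nCM -rmorphM nCr ger0_norm; last by rewrite mulr_ge0 ?ltW.
have X0 : 0 <= h * h * nC (moyal_dker n (dilate h (cD k a)) (dilate h (cD (dual_coord k) c)) t x w y).
  by rewrite mulr_ge0 ?nC_ge0// mulr_ge0 ?ltW.
apply: le_trans (ler_piMl X0 (nC_moyal_sg k)) _.
have hh0 : 0 <= h * h by rewrite mulr_ge0 ?ltW.
apply: le_trans (ler_wpM2l hh0 (Hk h t x w y hh)) _.
by apply: eq_ler; rewrite mulnS (exprD h 2); move: (h ^+ (2 * n)) (_^-1) (wt _ * wt _) => r p s;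
  rewrite expr2; ring.
Qed.

Lemma cmeas_moyal_ker dd (T : measurableType dd) a c (t : R) (x : 'rV[R]_d) (fw fy : T -> 'rV[R]_d) :
  Cc_infty a -> Cc_infty c -> measurable_fun setT fw -> measurable_fun setT fy ->
  cmeas (fun p => moyal_ker a c t x (fw p) (fy p)).
Proof.
move=> ca cc mw my.
have mx : measurable_fun setT (fun _ : T => x) by exact: measurable_cst.
have m1 := measurable_rVZ 2^-1 (measurable_rVD mx my).
have m2 := measurable_rVB mw my; have m3 := measurable_rVB mx mw.
apply: cmeasM.
  apply: (cmeas_hat (f := fun p => 2^-1 *: (x + fy p) + t *: (2^-1 *: (fw p - fy p))) (g := fun p =>
    x - fw p)) => //.
    by case: ca.
  by apply: measurable_rVD => //; do 2 apply: measurable_rVZ.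
apply: (cmeas_hat (f := fun p => 2^-1 *: (x + fy p) + t *: (- 2^-1 *: (x - fw p))) (g := fun p =>
  fw p - fy p)) => //.
  by case: cc.
by apply: measurable_rVD => //; do 2 apply: measurable_rVZ.
Qed.

Lemma cmeas_moyal_dker dd (T : measurableType dd) n a c (t : R) (x : 'rV[R]_d) (fw fy : T -> 'rV[R]_d) :
  Cc_infty a -> Cc_infty c -> measurable_fun setT fw -> measurable_fun setT fy ->
  cmeas (fun p => moyal_dker n a c t x (fw p) (fy p)).
Proof.
move=> + + mw my; elim: n a c => [|n IH] a c ca cc; first exact: cmeas_moyal_ker.
apply: cmeas_sum => k; apply: cmeasM; first exact: cmeas_cst.
by apply: IH; exact: Cc_cD.
Qed.

Definition dblwt phi x (p : 'rV[R]_d * 'rV[R]_d) : R :=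
  wt (x - p.1) * (wt (p.1 - p.2) * nC (phi p.2)).

Lemma wt_shift x : mu.-integrable setT (EFin \o (fun w => wt (x - w))) /\
  (\int[mu]_w (wt (x - w)))%R = (\int[mu]_w (@wt R d w))%R.
Proof.
have E : (fun y : 'rV[R]_d => wt (x - y)) = fun y => wt (1 *: y + (- x)).
  by apply/funext => y; rewrite scale1r -wtN opprB.
rewrite E; split; first exact: (integrable_rV_affine (- x) (@ltr01 R) (integrable_wt d)).
by rewrite (Rint_rV_affine (- x) (@ltr01 R) (integrable_wt d)) expr1n invr1 mul1r.
Qed.

Lemma integrable_dblwt phi x : decay phi -> (mu \x mu)%E.-integrable setT (EFin \o dblwt phi x).
Proof.
move=> dp; have mp : measurable_fun setT (fun y => nC (phi y)) by apply: cmeas_nC; case: dp.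
have [i1 _] := wt_shift x.
have := @integrable_prod _ _ _ _ _ mu mu (fun w => wt (x - w)) (fun y => nC (phi y))
  (fun w => wt_ge0 _) (fun y => nC_ge0 _) i1 (cinteg_nC (decay_cinteg dp)).
apply: integrable_dom.
  apply: measurable_funM.
    apply: (measurableT_comp (@measurable_wt R d)); apply: measurable_rVB => //; exact: measurable_fst.
  apply: measurable_funM.
    by apply: (measurableT_comp (@measurable_wt R d)); apply: measurable_rVB;
      [exact: measurable_fst|exact: measurable_snd].
  exact: (measurableT_comp mp measurable_snd).
move=> p; rewrite ger0_norm; last by rewrite mulr_ge0 ?wt_ge0// mulr_ge0 ?wt_ge0 ?nC_ge0.
by rewrite ler_wpM2l ?wt_ge0// ler_piMl ?nC_ge0 ?wt_le1.
Qed.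

Lemma Rint_dblwt phi x : decay phi ->
  (\int[(mu \x mu)%E]_p (dblwt phi x p))%R <=
  (\int[mu]_w (@wt R d w))%R * norm2 mu (@wt R d) * n2 phi.
Proof.
move=> dp; rewrite -(Rint_fubini1 (integrable_dblwt x dp)) -mulrA mulrC.
have [i1 <-] := wt_shift x.
rewrite -RintegralZl//.
have B w : (\int[mu]_y (dblwt phi x (w, y)))%R <= norm2 mu (@wt R d) * n2 phi * wt (x - w).
  have [iw cs] := wt_cs w dp.
  rewrite /dblwt /= RintegralZl// mulrC ler_wpM2r ?wt_ge0//.
have mint : measurable_fun setT (fun w => (\int[mu]_y (dblwt phi x (w, y)))%R).
  apply: (@measurable_Rint_param _ _ _ _ _ mu (dblwt phi x)).
  by apply/measurable_EFinP; exact: measurable_int (integrable_dblwt x dp).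
have i2 : mu.-integrable setT (EFin \o (fun w => norm2 mu (@wt R d) * n2 phi * wt (x - w))).
  exact: (integrable_scale (norm2 mu (@wt R d) * n2 phi) i1).
apply: le_Rintegral => //.
apply: (@integrable_dom _ _ _ _ _ (fun w => norm2 mu (@wt R d) * n2 phi * wt (x - w))) => // w.
rewrite ger0_norm//; apply: Rintegral_ge0 => y _.
by rewrite /dblwt mulr_ge0 ?wt_ge0// mulr_ge0 ?wt_ge0 ?nC_ge0.
Qed.

Lemma cinteg_moyal_dker n a c (t : R) x phi : Cc_infty a -> Cc_infty c -> decay phi ->
  cinteg (mu \x mu)%E (fun p => moyal_dker n a c t x p.1 p.2 * phi p.2).
Proof.
move=> ca cc dp; have [C C0 H] := moyal_dker_bound n ca cc.
apply: (@cinteg_dom _ _ _ _ _ (fun p => C * dblwt phi x p)).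
- apply: cmeasM; last by apply: (cmeas_comp (proj1 dp)); exact: measurable_snd.
  by apply: (cmeas_moyal_dker n t x ca cc); [exact: measurable_fst|exact: measurable_snd].
- move=> p; rewrite nCM.
  have -> : C * dblwt phi x p = C * (wt (x - p.1) * wt (p.1 - p.2)) * nC (phi p.2) by rewrite /dblwt; ring.
  apply: ler_wpM2r; first exact: nC_ge0.
  have := H 1 t x p.1 p.2; rewrite !dilate1 !expr1n invr1 mulr1 mulr1; apply.
  by rewrite ltr01 lexx.
- exact: (integrable_scale C (integrable_dblwt x dp)).
Qed.

Lemma moyal_dker0E a c x w y :
  moyal_dker 0 a c 1 x w y = hat a (2^-1 *: (x + w)) (x - w) * hat c (2^-1 *: (w + y)) (w - y).
Proof.
rewrite /moyal_dker /moyal_ker !scale1r -!scalerDr scaleNr -scalerBr.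
have -> : x + y + (w - y) = x + w by apply/rowP => j; rewrite !mxE; ring.
by have -> : x + y - (x - w) = w + y by apply/rowP => j; rewrite !mxE; ring.
Qed.

Lemma moyal_dker0_weyl a c x phi : Cc_infty a -> Cc_infty c -> decay phi ->
  weyl a (weyl c phi) x = @kap R d * @kap R d * Cintegral (mu \x mu)%E (fun p =>
    moyal_dker 0 a c 1 x p.1 p.2 * phi p.2).
Proof.
move=> ca cc dp; have dw : decay (weyl c phi) by apply: schwartz_decay; exact: schwartz_weyl.
rewrite weylE// -mulrA; congr (_ * _).
have ci := cinteg_moyal_dker 0 1 x ca cc dp.
rewrite -(Cint_fubini1 ci) -CintZ; last first.
  (* Integrability of the inner integral in w is read off the kernel form of a^w applied to c^w phi,
     after division by [kap]. *)
  have dwp := cinteg_weyl x ca dw.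
  have k0 : @kap R d != 0.
    by rewrite /kap fmorph_eq0 invr_eq0 expf_eq0 mulf_eq0 pnatr_eq0 /= gt_eqF ?andbF// pi_gt0.
  have := cintegZ (@kap R d)^-1 dwp; congr cinteg; apply/funext => w.
  rewrite weylE// mulrCA mulKf// -CintZ; last exact: cinteg_weyl.
  by apply: eq_Cint => y; rewrite mulrA moyal_dker0E.
apply: eq_Cint => w; rewrite weylE// mulrCA; congr (_ * _).
rewrite -CintZ; last exact: cinteg_weyl.
by apply: eq_Cint => y; rewrite mulrA moyal_dker0E.
Qed.

Section convolution_constant.
Variable kc : R[i].
Hypothesis kcE : forall a c m x y, Cc_infty a -> Cc_infty c ->
  Cintegral mu (fun w => hat a m (x - w) * hat c m (w - y)) =
  kc * hat (fun z => a z * c z) m (x - y).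

Lemma cinteg_moyal_dkerw n a c x y : Cc_infty a -> Cc_infty c -> cinteg mu (fun w => moyal_dker n a c 0 x w y).
Proof.
move=> ca cc; have [C C0 H] := moyal_dker_bound n ca cc.
apply: (@cinteg_dom _ _ _ _ _ (fun w => C * wt (x - w))).
- apply: (@cmeas_moyal_dker _ _ n a c 0 x id (fun=> y) ca cc).
    exact: measurable_id.
  exact: measurable_cst.
- move=> w; have := H 1 0 x w y; rewrite !dilate1 !expr1n invr1 mulr1 mulr1 ltr01 lexx => /(_ isT).
  move/le_trans; apply; rewrite ler_wpM2l// ler_piMr ?wt_ge0 ?wt_le1//.
- have [i1 _] := wt_shift x; exact: (integrable_scale C i1).
Qed.

(** At t = 0 both midpoints equal (x + y) / 2 and no longer involve w, so every term is a
    convolution of partial transforms. *)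
Lemma moyal_dker_hat n a c x y : Cc_infty a -> Cc_infty c ->
  Cintegral mu (fun w => moyal_dker n a c 0 x w y) = kc * hat (moyal n a c) (2^-1 *: (x + y)) (x - y).
Proof.
elim: n a c => [|n IH] a c ca cc.
  rewrite -(kcE _ _ _ ca cc); apply: eq_Cint => w; rewrite /moyal_dker /moyal_ker.
  by rewrite !scale0r !addr0.
rewrite hat_sum; last by move=> k; apply: CcZ; apply: Cc_moyal; exact: Cc_cD.
rewrite Cint_sum; last by move=> k; apply: cintegZ; apply: cinteg_moyal_dkerw; exact: Cc_cD.
rewrite mulr_sumr; apply: eq_bigr => k _.
rewrite CintZ; last by apply: cinteg_moyal_dkerw; exact: Cc_cD.
rewrite IH; [|exact: Cc_cD|exact: Cc_cD].
by rewrite hatZ; [ring|apply: Cc_moyal; exact: Cc_cD].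
Qed.

Lemma moyal_weyl n a c x phi : Cc_infty a -> Cc_infty c -> decay phi ->
  @kap R d * kc * weyl (moyal n a c) phi x =
  @kap R d * @kap R d * Cintegral (mu \x mu)%E (fun p => moyal_dker n a c 0 x p.1 p.2 * phi p.2).
Proof.
move=> ca cc dp; have cP := Cc_moyal n ca cc.
rewrite weylE// -(Cint_fubini2 (cinteg_moyal_dker n 0 x ca cc dp)).
transitivity (@kap R d * @kap R d * (kc * Cintegral mu (fun y =>
  hat (moyal n a c) (2^-1 *: (x + y)) (x - y) * phi y))); first by ring.
congr (_ * _).
rewrite -CintZ; last exact: cinteg_weyl.
apply: eq_Cint => y; rewrite mulrA -moyal_dker_hat// mulrC -CintZ; last exact: cinteg_moyal_dkerw.
by apply: eq_Cint => w; rewrite mulrC.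
Qed.

(** Taylor's formula from t = 0 to t = 1 under the double integral: the terms at t = 0 are Weyl
    operators by [moyal_weyl], and the remainder is dominated by [dblwt]. *)
Lemma weyl_composition J a c : Cc_infty a -> Cc_infty c -> exists2 C : R, 0 <= C &
  forall h phi x, 0 < h <= 1 -> decay phi ->
  nC (weyl (dilate h a) (weyl (dilate h c) phi) x -
      @kap R d * kc * \sum_(k < J) (h ^+ (2 * k) / k`!%:R)%:C * weyl (dilate h (moyal k a c)) phi x)
  <= C * (h ^+ (2 * J) * h ^- (d + d)) * n2 phi.
Proof.
move=> ca cc; have [C C0 H] := moyal_dker_bound J ca cc.
pose W := (\int[mu]_w (@wt R d w))%R * norm2 mu (@wt R d).
have W0 : 0 <= W by rewrite mulr_ge0 ?norm2_ge0// Rintegral_ge0// => w _; exact: wt_ge0.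
exists (nC (@kap R d * @kap R d : R[i]) * (2 * (2 ^+ J * C * W))).
  apply: mulr_ge0; first exact: nC_ge0.
  by rewrite mulr_ge0// mulr_ge0// mulr_ge0// exprn_ge0.
move=> h phi x hh dp; have [h0 h1] := andP hh; have hn : h != 0 by rewrite gt_eqF.
have cah := Cc_dilate hn ca; have cch := Cc_dilate hn cc.
rewrite (moyal_dker0_weyl x cah cch dp).
have E (k : 'I_J) : @kap R d * kc * ((h ^+ (2 * k) / k`!%:R)%:C * weyl (dilate h (moyal k a c)) phi x) =
    @kap R d * @kap R d * Cintegral (mu \x mu)%E (fun p => (1 ^+ k / k`!%:R)%:C * (moyal_dker k (dilate
      h a) (dilate h c) 0 x p.1 p.2 * phi p.2)).
  rewrite CintZ; last exact: (cinteg_moyal_dker k 0 x cah cch dp).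
  rewrite [RHS]mulrCA -(moyal_weyl k x cah cch dp) (moyal_dilate k hn ca cc).
  rewrite weylZ//; last by apply: Cc_dilate => //; exact: Cc_moyal.
  by rewrite expr1n mulrC mul1r [h ^+ _ / _]mulrC rmorphM; ring.
rewrite mulr_sumr (eq_bigr _ (fun k _ => E k)) -mulr_sumr -mulrBr (nCM (@kap R d * @kap R d) (_ - _)).
rewrite -[X in _ <= X]mulrA -[X in _ <= X]mulrA -[X in _ <= _ * X]mulrA ler_wpM2l ?nC_ge0//.
have cT k : cinteg (mu \x mu)%E (fun p => (1 ^+ k / k`!%:R)%:C * (moyal_dker k (dilate h a) (dilate h
  c) 0 x p.1 p.2 * phi p.2)).
  by apply: cintegZ; exact: cinteg_moyal_dker.
rewrite -(Cint_sum _ (fun k : 'I_J => cT k)) -CintB; [|exact: (cinteg_moyal_dker 0 1 x cah cch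
  dp)|exact: cinteg_sum].
set Z := h ^+ (2 * J) * h ^- (d + d) in H *.
have i1 : (mu \x mu)%E.-integrable setT (EFin \o (fun p => 2 ^+ J * (C * Z) * dblwt phi x p)).
  exact: (integrable_scale (2 ^+ J * (C * Z)) (integrable_dblwt x dp)).
have Z0 : 0 <= Z by rewrite mulr_ge0 ?invr_ge0 ?exprn_ge0 ?ltW.
apply: le_trans (nC_Cint_le _ _ i1) _.
- by apply: cintegB; [exact: (cinteg_moyal_dker 0 1 x cah cch dp)|exact: cinteg_sum].
- move=> p.
  have -> : moyal_dker 0 (dilate h a) (dilate h c) 1 x p.1 p.2 * phi p.2 -
     \sum_(k < J) (1 ^+ k / k`!%:R)%:C * (moyal_dker k (dilate h a) (dilate h c) 0 x p.1 p.2 * phi p.2) =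
    (moyal_dker 0 (dilate h a) (dilate h c) 1 x p.1 p.2 - \sum_(k < J) (1 ^+ k / k`!%:R)%:C *
      moyal_dker k (dilate h a) (dilate h c) 0 x p.1 p.2) * phi p.2.
    by rewrite mulrBl mulr_suml; congr (_ - _); apply: eq_bigr => k _; rewrite mulrA.
  rewrite nCM /dblwt ![wt _ * (_ * _)]mulrA mulrA ler_wpM2r ?nC_ge0//.
  apply: le_trans (@taylor_bound _ J (fun k t => moyal_dker k (dilate h a) (dilate h c) t x p.1 p.2)
     (C * Z * (wt (x - p.1) * wt (p.1 - p.2))) _ _ 1 _) _.
  + by move=> k t; exact: moyal_dker_cder.
  + by move=> t; exact: H.
  + by rewrite normr1.
  + by rewrite mulrA.
rewrite RintegralZl//; last exact: integrable_dblwt.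
rewrite ler_wpM2l//.
have CZ0 : 0 <= 2 ^+ J * (C * Z) by rewrite mulr_ge0 ?exprn_ge0// mulr_ge0.
apply: le_trans (ler_wpM2l CZ0 (Rint_dblwt x dp)) _.
by rewrite -/W; apply: eq_ler; ring.
Qed.

End convolution_constant.

End moyal.

(** * Riesz representation on a space of square integrable functions *)

Section square_integrable.
Context dd (T : measurableType dd) (R : realType) (mu : {measure set T -> \bar R}).
Implicit Types (f g phi psi : T -> R[i]).

Definition sqi f : Prop := cmeas f /\ mu.-integrable setT (EFin \o (fun x => nC (f x) ^+ 2)).

(** The real part of f times the conjugate of g: L^2 is treated as a real Hilbert space, and the
    complex structure returns in [riesz]. *)
Definition ip f g (x : T) : R :=
  complex.Re (f x) * complex.Re (g x) + complex.Im (f x) * complex.Im (g x).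

Definition rip f g : R := (\int[mu]_x (ip f g x))%R.

Lemma ip_sqr f x : ip f f x = nC (f x) ^+ 2.
Proof. by rewrite nC_sqr !expr2. Qed.

Lemma ip_le f g x : `|ip f g x| <= nC (f x) ^+ 2 + nC (g x) ^+ 2.
Proof.
rewrite !nC_sqr /ip; move: (complex.Re _) (complex.Im _) (complex.Re _) (complex.Im _) => a b c e.
have := sqr_ge0 (a + c); have := sqr_ge0 (a - c); have := sqr_ge0 (b + e); have := sqr_ge0 (b - e).
have := sqr_ge0 a; have := sqr_ge0 b; have := sqr_ge0 c; have := sqr_ge0 e.
by rewrite ler_norml; move=> *; apply/andP; split; nra.
Qed.

Lemma measurable_ip f g : cmeas f -> cmeas g -> measurable_fun setT (ip f g).
Proof. by move=> [fr fi] [gr gi]; apply: measurable_funD; exact: measurable_funM. Qed.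

Lemma integrable_ip f g : sqi f -> sqi g -> mu.-integrable setT (EFin \o ip f g).
Proof.
move=> [mf sf] [mg sg].
apply: (@integrable_dom _ _ _ _ _ (fun x => nC (f x) ^+ 2 + nC (g x) ^+ 2)); first exact: measurable_ip.
  exact: ip_le.
by have := integrableD measurableT sf sg; apply: eq_integrable.
Qed.

Lemma sqiZD (c : R[i]) f g : sqi f -> sqi g -> sqi (fun x => c * f x + g x).
Proof.
move=> [mf sf] [mg sg].
have m : cmeas (fun x => c * f x + g x) by apply: cmeasD => //; apply: cmeasM => //; exact: cmeas_cst.
split => //; apply: (@integrable_dom _ _ _ _ _ (fun x => (2 * nC c ^+ 2) * nC (f x) ^+ 2 + 2 * nC (g x) ^+ 2)).
- by apply: measurable_funX; exact: cmeas_nC.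
- move=> x; rewrite ger0_norm ?sqr_ge0//.
  have h : nC (c * f x + g x) <= nC c * nC (f x) + nC (g x) by rewrite -nCM; exact: nCD.
  have h0 := nC_ge0 (c * f x + g x).
  apply: (@le_trans _ _ ((nC c * nC (f x) + nC (g x)) ^+ 2)).
    by rewrite ler_sqr// nnegrE// addr_ge0 ?mulr_ge0 ?nC_ge0.
  move: (nC c) (nC (f x)) (nC (g x)) => p q r.
  have := sqr_ge0 (p * q - r); rewrite !expr2; nra.
- have := integrableD measurableT (integrableZl measurableT (2 * nC c ^+ 2) sf) (integrableZl measurableT 2 sg).
  by apply: eq_integrable => // x _ /=; rewrite EFinD !EFinM.
Qed.

Lemma rip_ge0 f : 0 <= rip f f.
Proof. by apply: Rintegral_ge0 => x _; rewrite ip_sqr sqr_ge0. Qed.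

Lemma rip_norm2 f : rip f f = norm2 mu (fun x => nC (f x)) ^+ 2.
Proof. by rewrite norm2_sqr; apply: eq_Rintegral => x _; rewrite ip_sqr. Qed.

Lemma rip_line (t : R) f g : sqi f -> sqi g ->
  rip (fun x => t%:C * g x + f x) (fun x => t%:C * g x + f x) =
  rip f f + 2 * t * rip f g + t ^+ 2 * rip g g.
Proof.
move=> sf sg; rewrite /rip.
have iff := integrable_ip sf sf; have ifg := integrable_ip sf sg; have igg := integrable_ip sg sg.
rewrite -[2 * t * _]RintegralZl// -[t ^+ 2 * _]RintegralZl//.
have i1 : mu.-integrable setT (EFin \o (fun x => 2 * t * ip f g x)).
  exact: (integrable_scale (2 * t) ifg).
have i2 : mu.-integrable setT (EFin \o (fun x => t ^+ 2 * ip g g x)).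
  exact: (integrable_scale (t ^+ 2) igg).
have i3 : mu.-integrable setT (EFin \o (fun x => ip f f x + 2 * t * ip f g x)).
  by have := integrableD measurableT iff i1; apply: eq_integrable.
rewrite -RintegralD// -RintegralD//; apply: eq_Rintegral => x _.
by rewrite /ip !Re_add !Im_add !Re_mulr !Im_mulr; ring.
Qed.

Lemma ge0_fine_integrable (F : T -> \bar R) : measurable_fun setT F -> (forall x, 0 <= F x)%E ->
  (\int[mu]_x F x < +oo)%E -> mu.-integrable setT (EFin \o (fun x => fine (F x))).
Proof.
move=> mF F0 Fy; apply: ge0_integrable; first exact: measurableT_comp mF.
  by move=> x; exact: fine_ge0.
apply: le_lt_trans Fy; apply: ge0_le_integral => //.
- by move=> x _; rewrite lee_fin fine_ge0.
- by apply/measurable_EFinP; exact: measurableT_comp mF.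
- by move=> x _; have := F0 x; case: (F x) => //=.
Qed.

(** Riesz-Fischer for a geometric sequence, with weak convergence as conclusion. The integral of the
    sum of 4^k |D_k|^2 is at most that of the series M 4^-k, so almost everywhere |D_k| is at most a
    multiple of 2^-k and the telescoping series converges. *)
Lemma l2_complete (phi : nat -> T -> R[i]) (M : R) : (forall k, sqi (phi k)) ->
  (forall k, rip (fun x => (-1) * phi k x + phi k.+1 x) (fun x =>
    (-1) * phi k x + phi k.+1 x) <= M * 16 ^- k) ->
  exists2 f, sqi f & forall psi, sqi psi -> (fun k => rip (phi k) psi) @ \oo --> rip f psi.
Proof.
move=> sphi Hd; pose D k x := (-1) * phi k x + phi k.+1 x.
have sD k : sqi (D k) by exact: sqiZD.
pose t k x : \bar R := (4 ^+ k * nC (D k x) ^+ 2)%:E.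
have t0 k x : (0 <= t k x)%E by rewrite /t lee_fin; apply: mulr_ge0; [exact: exprn_ge0|exact: sqr_ge0].
have mt k : measurable_fun setT (t k).
  apply/measurable_EFinP; apply: measurable_funM => //; apply: measurable_funX; apply: cmeas_nC.
  by case: (sD k).
pose H x : \bar R := (\sum_(k <oo) t k x)%E.
have H0 x : (0 <= H x)%E by apply: nneseries_ge0 => k _ _.
have mH : measurable_fun setT H by apply: ge0_emeasurable_sum => // k x _ _.
have Hfin : (\int[mu]_x H x < +oo)%E.
  rewrite integral_nneseries//.
  apply: (@le_lt_trans _ _ (\sum_(k <oo) (M * (4^-1) ^+ k)%:E)%E).
    apply: lee_nneseries => k _; [by move=> _; apply: integral_ge0 => x _|].
    rewrite /t; have i1 := proj2 (sD k).
    have i2 : mu.-integrable setT (EFin \o (fun x => 4 ^+ k * nC (D k x) ^+ 2)).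
      exact: (integrable_scale (4 ^+ k) i1).
    rewrite -(fineK (integrable_fin_num measurableT i2)) lee_fin.
    rewrite -/(Rintegral _ _ (fun x => 4 ^+ k * nC (D k x) ^+ 2)) RintegralZl//.
    have e4 : 4 ^+ k != 0 :> R by rewrite expf_neq0.
    have -> : M * 4^-1 ^+ k = 4 ^+ k * (M * 16 ^- k).
      have -> : 16 = 4 * 4 :> R by ring.
      by rewrite exprMn exprVn; field.
    rewrite ler_wpM2l ?exprn_ge0//; apply: le_trans (Hd k).
    by apply: eq_ler; apply: eq_Rintegral => x _; rewrite ip_sqr.
  have M0 : 0 <= M.
    by have := Hd 0%N; rewrite expr0 invr1 mulr1; apply: le_trans; exact: rip_ge0.
  have h4 : `|4^-1 : R| < 1 by rewrite ger0_norm ?invr_ge0// invf_lt1// ltr1n.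
  have /cvg_lim L := @cvg_geometric_series R M (4^-1) h4.
  have -> : (\sum_(k <oo) (M * 4^-1 ^+ k)%:E)%E = (M / (1 - 4^-1))%:E.
    apply/cvg_lim => //; apply: cvg_EFin; first by near=> n; rewrite sumEFin.
    apply: cvg_trans (@cvg_geometric_series R M (4^-1) h4).
    by apply: near_eq_cvg; near=> n; rewrite /= sumEFin.
  exact: ltry.
(* The full-measure set of convergence. Off it the sequence is replaced by 0, so that the limit
   exists everywhere and is measurable. *)
pose F := [set x | (H x < +oo)%E].
have mF : measurable F.
  rewrite (_ : F = setT `&` [set x | (H x < +oo)%E]); last by rewrite setTI.
  exact: emeasurable_fun_lt.
pose h x := fine (H x).
have h0 x : 0 <= h x by exact: fine_ge0.
have Db k x : F x -> nC (D k x) <= Num.sqrt (h x) * 2^-1 ^+ k.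
  move=> Fx; have Hx : H x = (h x)%:E by rewrite /h fineK// ge0_fin_numE.
  have : (t k x <= H x)%E.
    rewrite /H (nneseries_split 0 k.+1)//; apply: (@le_trans _ _ (\sum_(0 <= i < k.+1) t i x)%E).
      rewrite big_nat_recr//= leeDr//; exact: sume_ge0.
    by rewrite add0n leeDl//; apply: nneseries_ge0.
  rewrite Hx lee_fin => hk.
  rewrite -[X in X <= _]ger0_norm ?nC_ge0// -sqrtr_sqr.
  have -> : 2^-1 ^+ k = Num.sqrt (4 ^- k) :> R.
    have -> : 4 ^- k = (2^-1 ^+ k) ^+ 2 :> R.
      by rewrite exprAC -exprVn; congr (_ ^+ _); rewrite expr2 -invfM; congr (_^-1); ring.
    by rewrite sqrtr_sqr ger0_norm ?exprn_ge0 ?invr_ge0.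
  rewrite -sqrtrM// ler_sqrt; last by rewrite mulr_ge0 ?invr_ge0 ?exprn_ge0.
  by rewrite ler_pdivlMr ?exprn_gt0// mulrC.
have phiS k x : phi k.+1 x = phi k x + D k x by rewrite /D; ring.
have bound k x : F x -> nC (phi k x) <= nC (phi 0%N x) + Num.sqrt (h x) * (2 - 2 * 2^-1 ^+ k).
  move=> Fx; elim: k => [|k IH]; first by rewrite expr0 mulr1 subrr mulr0 addr0.
  rewrite phiS; apply: le_trans (nCD _ _) _; apply: le_trans (lerD IH (Db k x Fx)) _.
  by rewrite exprS; lra.
pose p' k x := if `[< F x >] then phi k x else 0.
have p'E k x : p' k x = ((\1_F x : R))%:C * phi k x.
  by rewrite /p' indicE; case: asboolP => Fx; rewrite ?(mem_set Fx) ?(memNset Fx) ?mul1r ?mul0r.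
have mp' k : cmeas (p' k).
  have -> : p' k = fun x => ((\1_F x : R))%:C * phi k x by apply/funext => x; exact: p'E.
  apply: cmeasM; last by case: (sphi k).
  by apply: cmeas_real; exact: measurable_indic.
(* The partial sums of 2^-i stay below 2, and (p + 2 s)^2 <= 2 p^2 + 8 s^2 with s^2 = h. *)
pose G x := 2 * nC (phi 0%N x) ^+ 2 + 8 * h x.
have iG : mu.-integrable setT (EFin \o G).
  have ih : mu.-integrable setT (EFin \o h) by exact: ge0_fine_integrable.
  have := integrableD measurableT (integrableZl measurableT 2 (proj2 (sphi 0%N))) (integrableZl
    measurableT 8 ih).
  by apply: eq_integrable => // x _ /=; rewrite /G EFinD !EFinM.
have p'G k x : nC (p' k x) ^+ 2 <= G x.
  rewrite /p'; case: asboolP => Fx; last first.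
    by rewrite nC0 expr0n; apply: addr_ge0; apply: mulr_ge0 => //; exact: sqr_ge0.
  have B := bound k x Fx; have b0 := nC_ge0 (phi k x).
  have B2 : nC (phi k x) <= nC (phi 0%N x) + 2 * Num.sqrt (h x).
    apply: le_trans B _; rewrite lerD2l mulrC ler_wpM2r ?sqrtr_ge0// lerBlDr lerDl.
    by rewrite mulr_ge0// exprn_ge0 ?invr_ge0.
  have := sqr_sqrtr (h0 x); rewrite /G; move: (Num.sqrt _) (sqrtr_ge0 (h x)) B2 => s s0 B2 <-.
  have : nC (phi k x) ^+ 2 <= (nC (phi 0%N x) + 2 * s) ^+ 2.
    by rewrite ler_sqr ?nnegrE// addr_ge0 ?nC_ge0 ?mulr_ge0.
  have := sqr_ge0 (nC (phi 0%N x) - 2 * s); rewrite !expr2; nra.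
have cvgp (proj : R[i] -> R) : (forall z w, proj (z + w) = proj z + proj w) ->
    (forall z, `|proj z| <= nC z) -> proj 0 = 0 -> forall x, cvgn (fun k => proj (p' k x)).
  move=> projD projle proj0 x; rewrite /p'; case: asboolP => Fx; last exact: is_cvg_cst.
  have E : (fun k => proj (phi k x)) = fun k => series (fun k => proj (D k x)) k + proj (phi 0%N x).
    apply/funext => k; rewrite /series /=; elim: k => [|k IH]; first by rewrite big_nil add0r.
    by rewrite phiS projD IH big_nat_recr//= addrAC.
  rewrite E; apply: is_cvgD; last exact: is_cvg_cst.
  apply: normed_cvg; apply: (@series_le_cvg _ _ (geometric (Num.sqrt (h x)) 2^-1)).
  - by move=> k; exact: normr_ge0.
  - by move=> k; rewrite /= mulr_ge0 ?sqrtr_ge0 ?exprn_ge0 ?invr_ge0.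
  - by move=> k; apply: le_trans (projle _) (Db k x Fx).
  - by apply: is_cvg_geometric_series; rewrite ger0_norm ?invr_ge0// invf_lt1// ltr1n.
have cr := cvgp _ Re_add nC_Re erefl.
have ci := cvgp _ Im_add nC_Im erefl.
pose f x : R[i] := limn (fun k => complex.Re (p' k x)) +i* limn (fun k => complex.Im (p' k x)).
have mf : cmeas f.
  split; [apply: (@measurable_fun_cvg _ _ _ _ (fun k x => complex.Re (p' k x)))|
          apply: (@measurable_fun_cvg _ _ _ _ (fun k x => complex.Im (p' k x)))] => //.
  - by move=> k; case: (mp' k).
  - by move=> k; case: (mp' k).
have fG x : nC (f x) ^+ 2 <= G x.
  rewrite nC_sqr.
  have L : (fun k => complex.Re (p' k x) ^+ 2 + complex.Im (p' k x) ^+ 2) @ \oo -->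
      complex.Re (f x) ^+ 2 + complex.Im (f x) ^+ 2.
    apply: cvgD; rewrite !expr2; under eq_fun do rewrite expr2.
      by apply: cvgM; exact: cr.
    by apply: cvgM; exact: ci.
  rewrite -(cvg_lim _ L)//; apply: limr_le; first by apply/cvg_ex; eexists; exact: L.
  by near=> k; rewrite -nC_sqr.
have sf : sqi f.
  split => //; apply: (integrable_dom _ _ iG); first by apply: measurable_funX; exact: cmeas_nC.
  by move=> x; rewrite ger0_norm ?sqr_ge0.
have sp' k : sqi (p' k).
  split => //; apply: (integrable_dom _ _ iG); first by apply: measurable_funX; exact: cmeas_nC.
  by move=> x; rewrite ger0_norm ?sqr_ge0.
exists f => // psi spsi.
(* The two sequences differ only off F, a null set because H is integrable. *)
have E k : rip (phi k) psi = rip (p' k) psi.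
  rewrite /rip /Rintegral; congr fine; apply: ae_eq_integral => //.
  - by apply/measurable_EFinP; apply: measurable_ip; [case: (sphi k)|case: spsi].
  - by apply/measurable_EFinP; apply: measurable_ip; case: spsi.
  - have iH : mu.-integrable setT H.
      apply/integrableP; split => //.
      by under eq_integral do rewrite gee0_abs//.
    apply: filterS (integrable_ae measurableT iH) => x /(_ I) Hx _; congr EFin.
    have Fx : F x by rewrite /F /= -ge0_fin_numE.
    by rewrite /ip /p'; case: asboolP.
rewrite (_ : (fun k => _) = fun k => rip (p' k) psi); last by apply/funext => k; exact: E.
have c1 k : cmeas (fun x => (ip (p' k) psi x)%:C) by apply: cmeas_real; apply: measurable_ip;
  [exact: mp'|case: spsi].
have c2 : cmeas (fun x => (ip f psi x)%:C) by apply: cmeas_real; apply: measurable_ip; [exact: mf|case: spsi].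
have ig : mu.-integrable setT (EFin \o (fun x => G x + nC (psi x) ^+ 2)).
  by have := integrableD measurableT iG (proj2 spsi); apply: eq_integrable.
apply: (proj1 (@Cint_cvg _ _ _ mu (fun k x => (ip (p' k) psi x)%:C) (fun x => (ip f psi x)%:C)
  (fun x => G x + nC (psi x) ^+ 2) c1 c2 _ _ ig _)).
- move=> x /=; apply: cvgD; apply: cvgM; [exact: cr|exact: cvg_cst|exact: ci|exact: cvg_cst].
- by move=> x /=; exact: cvg_cst.
- by move=> k x; rewrite nCr; apply: le_trans (ip_le _ _ _) _; rewrite lerD2r.
Unshelve. all: try by end_near.
Qed.

End square_integrable.

Section riesz.
Context dd (T : measurableType dd) (R : realType) (mu : {measure set T -> \bar R}).
Variables (V : (T -> R[i]) -> Prop) (l : (T -> R[i]) -> R[i]) (C : R).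
Implicit Types (f g phi psi : T -> R[i]).
Hypotheses (V0 : V (fun=> 0)) (VZD : forall c phi psi, V phi -> V psi -> V (fun x => c * phi x + psi x)).
Hypothesis Vsqi : forall phi, V phi -> sqi mu phi.
Hypothesis lZD : forall c phi psi, V phi -> V psi -> l (fun x => c * phi x + psi x) = c * l phi + l psi.
Hypothesis C0 : 0 < C.
Hypothesis lC : forall phi, V phi -> nC (l phi) <= C * norm2 mu (fun x => nC (phi x)).
Local Notation rip := (rip mu).

Let J phi := rip phi phi - 2 * complex.Re (l phi).

Let J_line (t : R) phi psi : V phi -> V psi ->
  J (fun x => t%:C * psi x + phi x) = J phi + 2 * t * (rip phi psi - complex.Re (l psi)) + t ^+ 2 * rip psi psi.
Proof.
move=> vf vg; rewrite /J rip_line; [|exact: Vsqi|exact: Vsqi].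
by rewrite lZD// Re_add Re_mulr; ring.
Qed.

Let l0 : l (fun=> 0) = 0.
Proof.
have := lZD (-1) V0 V0; rewrite (_ : (fun _ : T => _) = fun=> 0); last by apply/funext => x;
  rewrite mulr0 addr0.
by rewrite mulN1r addNr.
Qed.

Let J_ge phi : V phi -> - C ^+ 2 <= J phi.
Proof.
move=> vf; rewrite /J rip_norm2.
have h : complex.Re (l phi) <= C * norm2 mu (fun x => nC (phi x)).
  by apply: le_trans (lC vf); apply: le_trans (ler_norm _) (nC_Re _).
have := sqr_ge0 (norm2 mu (fun x => nC (phi x)) - C); move: h; move: (norm2 _ _) (complex.Re _) => n r.
by rewrite !expr2; nra.
Qed.

Let m := inf [set J phi | phi in V].

Let J_inf : has_inf [set J phi | phi in V].
Proof.
split; first by exists (J (fun=> 0)), (fun=> 0).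
by exists (- C ^+ 2) => _ [phi vf <-]; exact: J_ge.
Qed.

Let m_le phi : V phi -> m <= J phi.
Proof. by move=> vf; apply: ge_inf; [exact: (proj2 J_inf)|exists phi]. Qed.

(* Projection by minimisation: a fast minimising sequence of
   |phi|^2 - 2 Re (l phi) is Cauchy by the parallelogram law. *)
Lemma riesz_real : exists2 f, sqi mu f &
  rip f f <= 9 * C ^+ 2 /\ forall psi, V psi -> rip f psi = complex.Re (l psi).
Proof.
(* The excess s_k^2 = (C^2 / 4) 16^-k over the infimum has the decay rate that [l2_complete] asks of
   the increments. *)
pose s k : R := C / 2 * 4 ^- k.
have s0 k : 0 < s k by rewrite mulr_gt0 ?divr_gt0// invr_gt0 exprn_gt0.
have /choice[phi Hphi] : forall k, exists phi, V phi /\ J phi <= m + s k ^+ 2.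
  move=> k; have e0 : 0 < s k ^+ 2 by rewrite exprn_gt0.
  have [_ [phi vf <-] H] := inf_adherent e0 J_inf.
  by exists phi; split => //; exact: ltW.
have vphi k : V (phi k) by case: (Hphi k).
have Jphi k : J (phi k) <= m + s k ^+ 2 by case: (Hphi k).
have s2 k : s k ^+ 2 = C ^+ 2 / 4 * 16 ^- k.
  have -> : 16 = 4 * 4 :> R by ring.
  have -> : s k ^+ 2 = C ^+ 2 / 4 * (4 ^- k * 4 ^- k) by rewrite /s; field.
  by rewrite exprMn invfM.
have hd k : rip (fun x => (-1) * phi k x + phi k.+1 x) (fun x =>
  (-1) * phi k x + phi k.+1 x) <= C ^+ 2 * 16 ^- k.
  set D := fun x => (-1) * phi k x + phi k.+1 x.
  have vD : V D by exact: VZD.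
  have E1 := J_line 1 (vphi k) vD; have E2 := J_line 2^-1 (vphi k) vD.
  have F1 : (fun x => 1%:C * D x + phi k x) = phi k.+1 by apply/funext => x; rewrite /D; ring.
  rewrite F1 in E1.
  (* This is J at the midpoint of two successive terms; it gives |D|^2 <= 2 (J phi_k + J phi_{k+1} -
     2 m). *)
  have h2 : m <= J (fun x => (2^-1)%:C * D x + phi k x) by apply: m_le; exact: VZD.
  rewrite E2 in h2; have := Jphi k; have := Jphi k.+1; rewrite E1 !s2 (exprS 16 k) invfM => a1 a2.
  have e0 : 0 <= C ^+ 2 * 16 ^- k by rewrite mulr_ge0 ?sqr_ge0// invr_ge0 exprn_ge0.
  move: (rip (phi k) D - complex.Re (l D)) (J (phi k)) (rip D D) ((16 ^+ k)^-1) e0 h2 a1 a2 => X Y Z p.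
  rewrite !expr2 => *; lra.
have [f sf Lf] := l2_complete (fun k => Vsqi (vphi k)) hd.
exists f => //.
(* As m <= J 0 = 0, the norm n of phi_k satisfies n^2 - 2 C n <= C^2 / 4. *)
have n9 k : rip (phi k) (phi k) <= 9 * C ^+ 2.
  have := Jphi k; have := m_le V0; rewrite {1}/J l0 /= mulr0 subr0.
  have -> : rip (fun=> 0) (fun=> 0) = 0.
    by rewrite rip_norm2 norm2_sqr; under eq_Rintegral do rewrite nC0 expr0n/=; rewrite Rintegral_cst ?mul0r.
  move=> m0; rewrite /J rip_norm2.
  have h : complex.Re (l (phi k)) <= C * norm2 mu (fun x => nC (phi k x)).
    by apply: le_trans (lC (vphi k)); apply: le_trans (ler_norm _) (nC_Re _).
  have sC : s k ^+ 2 <= C ^+ 2 / 4.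
    by rewrite s2 ler_piMr ?divr_ge0 ?sqr_ge0// invf_le1 ?exprn_gt0// exprn_ege1// ler1n.
  have := sqr_ge0 (norm2 mu (fun x => nC (phi k x)) - 2 * C); move: h; move: (norm2 _ _) (complex.Re _) => n r.
  by move: sC; rewrite !expr2; nra.
split.
  have L : (fun k => rip (phi k) f) @ \oo --> rip f f by exact: Lf.
  (* The norm is lower semicontinuous under weak convergence: the pairing of phi_k with f is at most
     half the sum of the squared norms and tends to the squared norm of f. *)
  suff : rip f f <= (9 * C ^+ 2 + rip f f) / 2 by lra.
  rewrite -{1}(cvg_lim _ L)//; apply: limr_le; first by apply/cvg_ex; eexists; exact: L.
  apply: nearW => k; have := rip_line (-1) (Vsqi (vphi k)) sf.
  have := rip_ge0 mu (fun x => (-1)%:C * f x + phi k x).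
  by have := n9 k; rewrite sqrrN expr1n; lra.
move=> psi vg; apply/eqP; rewrite -subr_eq0; apply/eqP.
pose X k := rip (phi k) psi - complex.Re (l psi).
have LX : X @ \oo --> rip f psi - complex.Re (l psi) by apply: cvgB; [exact: Lf (Vsqi vg)|exact: cvg_cst].
pose K := C / 2 * ((1 + rip psi psi) / 2).
(* First variation: comparing phi_k with phi_k + t psi at t = s_k and t = -s_k gives |X_k| <= s_k (1
   + |psi|^2) / 2. *)
have XK k : `|X k| <= geometric K (4^-1) k.
  have h1 : m <= J (fun x => (s k)%:C * psi x + phi k x) by apply: m_le; exact: VZD.
  have h2 : m <= J (fun x => (- s k)%:C * psi x + phi k x) by apply: m_le; exact: VZD.
  rewrite !J_line// -/(X k) in h1 h2.
  have -> : geometric K 4^-1 k = s k * ((1 + rip psi psi) / 2) by rewrite /geometric/= /s /K exprVn; ring.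
  rewrite -(ler_pM2l (s0 k)) -{1}[s k]gtr0_norm// -normrM ler_norml.
  by have := Jphi k; move: h1 h2; rewrite !expr2; move: (s k) (X k) (J _) (rip _ _) => a b c e *;
    apply/andP; split; lra.
have L0 : X @ \oo --> (0 : R).
  have G0 : geometric K 4^-1 @ \oo --> (0 : R).
    by apply: cvg_geometric; rewrite ger0_norm ?invr_ge0// invf_lt1// ltr1n.
  apply/norm_cvg0P; apply: (@squeeze_cvgr _ _ _ _ (fun=> 0) (geometric K 4^-1)) => //; last exact: cvg_cst.
  by apply: nearW => k; rewrite normr_ge0 XK.
exact: (cvg_unique _ LX L0).
Qed.

(** The representing function is the conjugate of the real representative f, since the pairing is
    bilinear. Testing with i psi recovers the imaginary part. *)
Lemma riesz : exists2 g, sqi mu g & norm2 mu (fun x => nC (g x)) <= 3 * C /\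
  forall psi, V psi -> l psi = Cintegral mu (fun x => g x * psi x).
Proof.
have [f sf [f9 Hf]] := riesz_real.
have mg : cmeas (fun x => complex.Re (f x) +i* - complex.Im (f x)).
  case: sf => -[fr fi] _; split => //=; first exact: measurableT_comp fi.
have nE x : nC (complex.Re (f x) +i* - complex.Im (f x)) = nC (f x) by rewrite /nC;
  case: (f x) => a b /=; rewrite sqrrN.
exists (fun x => complex.Re (f x) +i* - complex.Im (f x)).
  by split => //; under [X in _ \o X]eq_fun do rewrite nE; case: sf.
split.
  under eq_fun do rewrite nE.
  have h3 : 0 <= 3 * C by rewrite mulr_ge0 ?ltW.
  rewrite -(@ler_pXn2r _ 2) ?nnegrE ?norm2_ge0// -rip_norm2.
  by apply: (le_trans f9); rewrite exprMn expr2; lra.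
move=> psi vg.
(* The hypotheses only give combinations c phi + psi, so i psi is written as (i - 1) psi + psi. *)
have lci : l (fun x => 'i * psi x) = 'i * l psi.
  have -> : (fun x => 'i * psi x) = fun x => ('i - 1) * psi x + psi x by apply/funext => x; ring.
  by rewrite lZD//; ring.
have vi : V (fun x => 'i * psi x).
  have -> : (fun x => 'i * psi x) = fun x => ('i - 1) * psi x + psi x by apply/funext => x; ring.
  exact: VZD.
apply: complex_eqP; rewrite ?Re_Cint ?Im_Cint.
  by rewrite -Hf//; apply: eq_Rintegral => x _; rewrite Re_mul /ip/=; ring.
have : - complex.Im (l psi) = rip f (fun x => 'i * psi x).
  by rewrite Hf// lci Re_mul /=; ring.
move/(congr1 -%R); rewrite opprK => ->; rewrite -mulN1r -RintegralZl//;
  last exact: (integrable_ip sf (Vsqi vi)).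
by apply: eq_Rintegral => x _; rewrite Im_mul /ip Re_mul Im_mul /=; ring.
Qed.

End riesz.

(** * Powers of h in the estimates *)

Section operator_families.
Context {R : realType} {d : nat}.
Local Notation mu := (lebesgue_rV R d).
Implicit Types (a b c A B : 'rV[R]_(d + d) -> R[i]) (phi psi f : 'rV[R]_d -> R[i]).
Implicit Types (F G : R -> ('rV[R]_d -> R[i]) -> 'rV[R]_d -> R[i]) (h : R) (x : 'rV[R]_d) (l : seq 'I_d).

(** The product of the 1 + x_j^2 expands into 2^d monomials of degree at most 2d; [l0] holds the
    squares already chosen. *)
Lemma wt_bound f (S : R) : 0 <= S ->
  (forall l, (size l <= d + d)%N -> forall x, `|\prod_(j <- l) x ord0 j| * nC (f x) <= S) ->
  forall x, nC (f x) <= 2 ^+ d * S * wt x.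
Proof.
move=> S0 H x; suff K l l0 : (size l0 + (size l + size l) <= d + d)%N ->
    `|\prod_(j <- l0) x ord0 j| * (\prod_(j <- l) (1 + x ord0 j ^+ 2) * nC (f x)) <= 2 ^+ size l * S.
  have := K (enum 'I_d) [::]; rewrite big_nil normr1 mul1r size_enum_ord => /(_ (leqnn _)).
  by rewrite -(ler_pM2l (wt_gt0 x)) enumT mulrA wtV mul1r [_ * wt x]mulrC.
elim: l l0 => [|j l IH] l0 /= sz.
  by rewrite big_nil mul1r expr0 mul1r; apply: H; apply: leq_trans sz; rewrite leq_addr.
have -> : 2 ^+ (size l).+1 * S = 2 ^+ size l * S + 2 ^+ size l * S by rewrite exprS; ring.
rewrite big_cons -mulrA mulrDl mul1r mulrDr lerD//.
  by apply: IH; apply: leq_trans sz; lia.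
have := IH [:: j, j & l0]; rewrite /= => IHj.
have {IHj} := IHj _; move/(_ ltac:(lia)).
rewrite !big_cons mulrA -expr2 normrM [`|_ ^+ 2|]ger0_norm ?sqr_ge0// => h.
by apply: le_trans h; rewrite [_ ^+ 2 * `|_|]mulrC !mulrA.
Qed.

Lemma n2_le_wt f (C : R) : decay f -> 0 <= C -> (forall x, nC (f x) <= C * wt x) ->
  n2 f <= C * norm2 mu (@wt R d).
Proof.
move=> df C0 H; rewrite -(@ler_pXn2r _ 2) ?nnegrE ?n2_ge0 ?mulr_ge0 ?norm2_ge0//.
rewrite exprMn /n2 !norm2_sqr -RintegralZl//; last exact: integrable_wt2.
apply: le_Rintegral => //; first exact: decay_sq.
  exact: (integrable_scale (C ^+ 2) (integrable_wt2 d)).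
by move=> x _; rewrite -exprMn ler_sqr ?nnegrE ?nC_ge0 ?mulr_ge0 ?wt_ge0.
Qed.

Lemma pow_le h (a b c e : nat) : 0 < h <= 1 -> (c + b <= a + e)%N ->
  h ^+ a * h ^- b <= h ^+ c * h ^- e.
Proof.
move=> /andP[h0 h1] le; rewrite ler_pdivrMr ?exprn_gt0// mulrAC ler_pdivlMr ?exprn_gt0//.
by rewrite -!exprD; apply: ler_wiXn2l => //; exact: ltW.
Qed.

Definition comb (c : R -> R[i]) F G h phi x := c h * F h phi x + G h phi x.

Definition smf G : Prop := forall h phi, 0 < h <= 1 -> schwartz phi -> schwartz (G h phi).

(** Measuring phi by its L^2 norm alone lets such a bound be composed on the right with any operator
    whose L^2 norm grows polynomially in 1/h. *)
Definition semb (L e : nat) G : Prop := exists2 C : R, 0 <= C &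
  forall l1 l2 : seq 'I_d, (size l1 <= L)%N -> (size l2 <= L)%N -> forall h phi x, 0 < h <= 1 -> schwartz phi ->
  `|\prod_(j <- l1) x ord0 j| * nC (cdpartials l2 (G h phi) x) <= C * h ^- e * n2 phi.

Lemma schwartz_comb (c : R[i]) phi psi : schwartz phi -> schwartz psi ->
  schwartz (fun x => c * phi x + psi x).
Proof.
by move=> sp sq; have := schwartz_lin c 1 sp sq; under eq_fun do rewrite mul1r.
Qed.

Lemma smf_comb (c : R -> R[i]) F G : smf F -> smf G -> smf (comb c F G).
Proof. by move=> sF sG h phi hh sp; exact: (schwartz_comb (c h) (sF h phi hh sp) (sG h phi hh sp)). Qed.

Lemma semb_comb L e (c : R -> R[i]) (K : R) F G : (forall h, 0 < h <= 1 -> nC (c h) <= K) ->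
  smf F -> smf G -> semb L e F -> semb L e G -> semb L e (comb c F G).
Proof.
move=> cK sF sG [C1 C10 H1] [C2 C20 H2].
have K0 : 0 <= K by apply: le_trans (nC_ge0 _) (cK 1 _); rewrite ltr01 lexx.
exists (K * C1 + C2); first by rewrite addr_ge0 ?mulr_ge0.
move=> l1 l2 s1 s2 h phi x hh sp.
have E : comb c F G h phi = fun x => c h * F h phi x + 1 * G h phi x.
  by apply/funext => y; rewrite mul1r.
rewrite E (cdpartials_lin _ _ _ (proj1 (sF h phi hh sp)) (proj1 (sG h phi hh sp))) mul1r.
apply: le_trans (ler_wpM2l (normr_ge0 _) (nCD _ _)) _.
rewrite mulrDr -mulrA mulrDl lerD//; last by rewrite mulrA; exact: H2.
rewrite nCM mulrCA -mulrA; apply: ler_pM (nC_ge0 _) _ (cK h hh) _; first by rewrite mulr_ge0 ?nC_ge0.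
by rewrite mulrA; exact: H1.
Qed.

Lemma semb_mono L e e' G : (e <= e')%N -> semb L e G -> semb L e' G.
Proof.
move=> ee [C C0 H]; exists C => // l1 l2 s1 s2 h phi x hh sp.
apply: le_trans (H _ _ s1 s2 h phi x hh sp) _; rewrite ler_wpM2r ?n2_ge0// ler_wpM2l//.
by have := @pow_le h 0 e 0 e' hh ee; rewrite !expr0 !mul1r.
Qed.

Definition wf a h phi := weyl (dilate h a) phi.

Lemma hneq0 h : 0 < h <= 1 -> h != 0.
Proof. by move=> /andP[h0 _]; rewrite gt_eqF. Qed.

Lemma smf_wf a : Cc_infty a -> smf (wf a).
Proof.
move=> ca h phi hh sp; exact: (schwartz_weyl (Cc_dilate (hneq0 hh) ca) (schwartz_decay sp)).
Qed.

Lemma semb_wf L a : Cc_infty a -> semb L (L + L + d) (wf a).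
Proof.
move=> ca; have [C C0 H] := weyl_seminorm_unif L ca; exists C => // l1 l2 s1 s2 h phi x hh sp.
exact: (H _ _ s1 s2 h phi x hh (schwartz_decay sp)).
Qed.

(** The L^2 norm is recovered from weighted sup bounds through the square integrable weight. The
    loss h^-e is tolerable where O(h^oo) follows. *)
Lemma n2_wf a : Cc_infty a -> exists e : nat, exists2 C : R, 0 <= C &
  forall h phi, 0 < h <= 1 -> schwartz phi -> n2 (wf a h phi) <= C * h ^- e * n2 phi.
Proof.
move=> ca; have [C C0 H] := semb_wf (d + d) ca.
exists (d + d + (d + d) + d)%N, (2 ^+ d * C * norm2 mu (@wt R d)).
  by rewrite mulr_ge0 ?norm2_ge0// mulr_ge0// exprn_ge0.
move=> h phi hh sp; have [h0 h1] := andP hh.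
have S0 : 0 <= C * h ^- (d + d + (d + d) + d) * n2 phi.
  by rewrite mulr_ge0 ?n2_ge0// mulr_ge0// invr_ge0 exprn_ge0 ?ltW.
apply: (le_trans (n2_le_wt (C := 2 ^+ d * (C * h ^- (d + d + (d + d) + d) * n2 phi)) _ _ _)).
- exact: (schwartz_decay (smf_wf ca hh sp)).
- by rewrite mulr_ge0// exprn_ge0.
- apply: wt_bound => // l sl x; have := H l [::] sl isT h phi x hh sp.
  by rewrite cdpartials0.
- by apply: eq_ler; move: (norm2 _ _) (n2 _) (h ^- _) => p q r; ring.
Qed.

Lemma smf_wf2 a c : Cc_infty a -> Cc_infty c -> smf (fun h phi => wf a h (wf c h phi)).
Proof. by move=> ca cc h phi hh sp; exact: (smf_wf ca hh (smf_wf cc hh sp)). Qed.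

Lemma semb_wf2 L a c : Cc_infty a -> Cc_infty c -> exists e : nat,
  semb L e (fun h phi => wf a h (wf c h phi)).
Proof.
move=> ca cc; have [e [C C0 H]] := n2_wf cc; have [D D0 K] := semb_wf L ca.
exists (L + L + d + e)%N, (D * C); first exact: mulr_ge0.
move=> l1 l2 s1 s2 h phi x hh sp; have [h0 h1] := andP hh.
apply: le_trans (K l1 l2 s1 s2 h (wf c h phi) x hh (smf_wf cc hh sp)) _.
have D1 : 0 <= D * h ^- (L + L + d) by rewrite mulr_ge0// invr_ge0 exprn_ge0 ?ltW.
apply: le_trans (ler_wpM2l D1 (H h phi hh sp)) _.
rewrite [h ^+ (L + L + d + e)]exprD [in leRHS]invfM.
by apply: eq_ler; move: (n2 _) (h ^- (L + L + d)) (h ^- e) => p q r; ring.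
Qed.

Section distribution.
Variable u : ('rV[R]_d -> R[i]) -> R[i].
Hypothesis tu : tempered u.

(** h^N h^-e stands for h^(N - e) with natural exponents: the bootstrap raises N while e stays
    fixed. *)
Definition ub (N e : nat) G : Prop := exists2 C : R, 0 <= C &
  forall h phi, 0 < h <= 1 -> schwartz phi -> nC (u (G h phi)) <= C * (h ^+ N * h ^- e) * n2 phi.

Lemma ub_mono N e N' e' G : (N' + e <= N + e')%N -> ub N e G -> ub N' e' G.
Proof.
move=> le [C C0 H]; exists C => // h phi hh sp.
apply: le_trans (H h phi hh sp) _; rewrite ler_wpM2r ?n2_ge0// ler_wpM2l//.
exact: pow_le.
Qed.

Lemma ub_comb N e g (c : R -> R[i]) (K : R) F G : (forall h, 0 < h <= 1 -> nC (c h) <= K * h ^+ g) ->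
  smf F -> smf G -> ub N e F -> ub (N + g) e G -> ub (N + g) e (comb c F G).
Proof.
move=> cK sF sG [C1 C10 H1] [C2 C20 H2].
have K0 : 0 <= K.
  by apply: le_trans (nC_ge0 _) (le_trans (cK 1 _) _); rewrite ?ltr01 ?lexx// expr1n mulr1.
exists (K * C1 + C2); first by rewrite addr_ge0 ?mulr_ge0.
move=> h phi hh sp; have [ulin _] := tu; rewrite (ulin (c h) _ _ (sF h phi hh sp) (sG h phi hh sp)).
have [h0 h1] := andP hh.
apply: le_trans (nCD _ _) _; rewrite -mulrA mulrDl lerD//; last by rewrite mulrA; exact: H2.
rewrite nCM; have := ler_pM (nC_ge0 _) (nC_ge0 _) (cK h hh) (H1 h phi hh sp).
move/le_trans; apply; rewrite exprD.
by apply: eq_ler; move: (n2 _) (h ^- e) => p q; ring.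
Qed.

Lemma ub_semb : exists L, forall e G, smf G -> semb L e G -> ub 0 e G.
Proof.
have [L [K K0 H]] := tempered_bound tu; exists L => e G sG [C C0 HC].
exists (K * C); first exact: mulr_ge0.
move=> h phi hh sp; have [h0 h1] := andP hh.
rewrite expr0 mul1r -!mulrA; apply: H; first exact: sG.
  by rewrite mulr_ge0// mulr_ge0 ?n2_ge0// invr_ge0 exprn_ge0 ?ltW.
by move=> l1 l2 s1 s2 x; rewrite mulrA; exact: HC.
Qed.

(* Smallness in the sup norm and crude bounds on the seminorms give smallness
   of the seminorms, by interpolation. *)
Lemma ub_small : exists L, forall e e' N, exists J : nat, forall G, smf G -> semb L e G ->
  (exists2 C : R, 0 <= C & forall h phi x, 0 < h <= 1 -> schwartz phi ->
     nC (G h phi x) <= C * (h ^+ J * h ^- e') * n2 phi) -> ub N 0 G.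
Proof.
have [L [K K0 H]] := tempered_bound tu; have [P [D D0 I]] := interpolation (d := d) (R := R) L.
(* With interpolation step r = h^(e + N), the term r h^-e is h^N; J is chosen so that h^J h^-e' r^-P
   is h^N as well. *)
exists (2 * L)%N => e e' N; exists (N + e' + (e + N) * P)%N => G sG [C C0 HC] [C' C'0 HC'].
exists (K * (D * (C' + C))); first by rewrite !mulr_ge0// addr_ge0.
move=> h phi hh sp; have [h0 h1] := andP hh.
have pn k : 0 <= h ^- k by rewrite invr_ge0 exprn_ge0 ?ltW.
have pp k : 0 <= h ^+ k by rewrite exprn_ge0 ?ltW.
have n0 := n2_ge0 phi.
pose r := h ^+ (e + N).
have rr : 0 < r <= 1 by rewrite exprn_gt0// exprn_ile1// ltW.
have E0 : 0 <= C' * (h ^+ (N + e' + (e + N) * P) * h ^- e') * n2 phi by rewrite !mulr_ge0.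
have M0 : 0 <= C * h ^- e * n2 phi by rewrite !mulr_ge0.
have B l1 l2 (s1 : (size l1 <= L)%N) (s2 : (size l2 <= L)%N) x :=
  I (G h phi) _ _ r (proj1 (sG h phi hh sp)) E0 M0 rr (fun x => HC' h phi x hh sp)
    (fun l1 l2 s1 s2 x => HC l1 l2 s1 s2 h phi x hh sp) l1 l2 s1 s2 x.
have S0 : 0 <= D * (C' * (h ^+ (N + e' + (e + N) * P) * h ^- e') * n2 phi * r ^- P + r * (C * h ^- e * n2 phi)).
  have [r0 _] := andP rr; apply: mulr_ge0 => //; apply: addr_ge0.
    by apply: mulr_ge0 => //; rewrite invr_ge0 exprn_ge0// ltW.
  by apply: mulr_ge0 => //; exact: ltW.
apply: le_trans (H (G h phi) _ (sG h phi hh sp) S0 B) _.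
rewrite -!mulrA ler_wpM2l// ler_wpM2l//.
have hne k : h ^+ k != 0 by rewrite expf_neq0// gt_eqF.
have -> : h ^+ (N + e' + (e + N) * P) = h ^+ N * h ^+ e' * r ^+ P by rewrite !exprD exprM.
have -> : r = h ^+ e * h ^+ N by rewrite /r exprD.
rewrite expr0 invr1 mul1r; move: (hne e) (hne e') (hne N); move: (h ^+ e) (h ^+ e') (h ^+ N) => p q s p0 q0 s0.
have t0 : (p * s) ^+ P != 0 by rewrite expf_neq0// mulf_neq0.
move: (_ ^+ P) t0 => t t0.
by apply: eq_ler; field; rewrite p0 q0 t0.
Qed.

Lemma ub_ext N e F G : (forall h phi, 0 < h <= 1 -> schwartz phi -> F h phi = G h phi) ->
  ub N e F -> ub N e G.
Proof.
by move=> E [C C0 H]; exists C => // h phi hh sp; rewrite -E//; exact: H.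
Qed.

Lemma ub_comb_cst N e (k : R[i]) F G :
  smf F -> smf G -> ub N e F -> ub N e G -> ub N e (comb (fun=> k) F G).
Proof.
move=> sF sG bF bG; have := @ub_comb N e 0 (fun=> k) (nC k) F G; rewrite addn0; apply => // h hh.
by rewrite expr0 mulr1.
Qed.

Lemma smf0 : smf (fun _ _ _ => 0).
Proof. by move=> h phi hh sp; exact: schwartz0. Qed.

Lemma semb0 L e : semb L e (fun _ _ _ => 0).
Proof.
exists 0 => // l1 l2 s1 s2 h phi x hh sp.
have s0 := proj1 (@schwartz0 R d); have := cdpartials_lin l2 0 0 s0 s0.
under eq_fun do rewrite mul0r addr0.
by move=> ->; rewrite !mul0r addr0 nC0 mulr0.
Qed.

Lemma ub0 N e : ub N e (fun _ _ _ => 0).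
Proof.
exists 0 => // h phi hh sp; have [ulin _] := tu.
have := ulin (-1) _ _ (@schwartz0 R d) (@schwartz0 R d).
rewrite (_ : (fun _ => _) = fun=> 0); last by apply/funext => x; rewrite mulr0 addr0.
by rewrite mulN1r addNr => ->; rewrite nC0 !mul0r.
Qed.

(** Apply the hypothesis with exponent N + e to the test function c_h^w phi; the e extra powers pay
    for its L^2 norm. *)
Lemma ub_wf2 N A c : Cc_infty c -> (forall N, ub N 0 (wf A)) ->
  ub N 0 (fun h phi => wf A h (wf c h phi)).
Proof.
move=> cc HA; have [e [C C0 H]] := n2_wf cc; have [D D0 K] := HA (N + e)%N.
apply: (@ub_mono (N + e) e); first by rewrite addn0.
exists (D * C); first exact: mulr_ge0.
move=> h phi hh sp; have [h0 h1] := andP hh.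
apply: le_trans (K h _ hh (smf_wf cc hh sp)) _.
have D1 : 0 <= D * (h ^+ (N + e) * h ^- 0).
  by rewrite expr0 invr1 mulr1 mulr_ge0// exprn_ge0 ?ltW.
apply: le_trans (ler_wpM2l D1 (H h phi hh sp)) _.
rewrite expr0 invr1 mulr1.
by apply: eq_ler; move: (n2 _) (h ^- e) => p q; ring.
Qed.

Section elliptic.
Variable kc : R[i].
Hypothesis kc0 : kc != 0.
Hypothesis kcE : forall a c m x y, Cc_infty a -> Cc_infty c ->
  Cintegral mu (fun w => hat a m (x - w) * hat c m (w - y)) =
  kc * hat (fun z => a z * c z) m (x - y).
Variable A : 'rV[R]_(d + d) -> R[i].
Hypothesis cA : Cc_infty A.
Hypothesis HA : forall N, ub N 0 (wf A).

Lemma kap_neq0 : @kap R d != 0.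
Proof.
by rewrite /kap fmorph_eq0 invr_eq0 expf_eq0 mulf_eq0 pnatr_eq0 /= gt_eqF ?andbF// pi_gt0.
Qed.

Let k := @kap R d * kc.

Let k_neq0 : k != 0.
Proof. by rewrite /k mulf_neq0// kap_neq0. Qed.

Section symbol.
Variable c : 'rV[R]_(d + d) -> R[i].
Hypothesis cc : Cc_infty c.

(** [Q J] is the remainder A_h^w c_h^w - k (G 0 + S J). The indices in [S] are shifted by one
    because the leading term is kept apart, and everything is built with [comb] so that the three
    kinds of bounds propagate. *)
Let G n := wf (moyal n A c).
Let G1 h phi := wf A h (wf c h phi).
Let co n h : R[i] := (h ^+ (2 * n.+1) / n.+1`!%:R)%:C.
Let S J h phi x := \sum_(i < J) co i h * G i.+1 h phi x.
Let Q J := comb (fun=> - k) (comb (fun=> 1) (G 0) (S J)) G1.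

Let SS J : S J.+1 = comb (co J) (G J.+1) (S J).
Proof.
apply/funext => h; apply/funext => phi; apply/funext => x.
by rewrite /S big_ord_recr /= addrC.
Qed.

Let S0 : S 0 = fun _ _ _ => 0.
Proof.
by apply/funext => h; apply/funext => phi; apply/funext => x; rewrite /S big_ord0.
Qed.

(** Of h^(2n+2) / (n+1)! a single factor h is kept, the gain of one induction step. *)
Let co_le n h : 0 < h <= 1 -> nC (co n h) <= 1 * h ^+ 1.
Proof.
move=> hh; have [h0 h1] := andP hh; rewrite /co nCr ger0_norm; last first.
  by rewrite mulr_ge0 ?invr_ge0// exprn_ge0 ?ltW.
have f1 : 1 <= n.+1`!%:R :> R by rewrite ler1n fact_gt0.
rewrite mul1r expr1 ler_pdivrMr ?(lt_le_trans ltr01)//.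
apply: (@le_trans _ _ (h * 1)); last by rewrite ler_wpM2l// ltW.
rewrite mulnS exprS ler_wpM2l ?(ltW h0)//.
by rewrite exprn_ile1// (ltW h0).
Qed.

Let sG n : smf (G n).
Proof. by apply: smf_wf; exact: Cc_moyal. Qed.

Let sS J : smf (S J).
Proof.
elim: J => [|J IH]; first by rewrite S0; exact: smf0.
by rewrite SS; exact: (smf_comb _ (sG _) IH).
Qed.

Let semS L J : semb L (L + L + d) (S J).
Proof.
elim: J => [|J IH]; first by rewrite S0; exact: semb0.
rewrite SS; apply: (@semb_comb _ _ _ 1 _ _ _ (sG _) (sS J) _ IH).
  move=> h hh; apply: le_trans (co_le J hh) _; rewrite mul1r expr1; by case/andP: hh.
by apply: semb_wf; exact: Cc_moyal.
Qed.

Let sG1 : smf G1.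
Proof. exact: smf_wf2. Qed.

Let sQ J : smf (Q J).
Proof. exact: (smf_comb _ (smf_comb _ (sG 0) (sS J)) sG1). Qed.

Let supQ J : exists2 C : R, 0 <= C & forall h phi x, 0 < h <= 1 -> schwartz phi ->
  nC (Q J h phi x) <= C * (h ^+ J * h ^- (d + d)) * n2 phi.
Proof.
have [C C0 H] := weyl_composition kcE J.+1 cA cc; exists C => // h phi x hh sp.
have := H h phi x hh (schwartz_decay sp).
rewrite big_ord_recl /= muln0 expr0 fact0 divr1 mul1r.
have -> : weyl (dilate h A) (weyl (dilate h c) phi) x -
   @kap R d * kc * (weyl (dilate h (fun z => A z * c z)) phi x +
     \sum_(i < J) (h ^+ (2 * i.+1) / i.+1`!%:R)%:C * weyl (dilate h (moyal i.+1 A c)) phi x) = Q J h phi x.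
  by rewrite /Q /comb /S /k /G1 /wf mul1r mulNr addrC.
move/le_trans; apply; rewrite ler_wpM2r ?n2_ge0// ler_wpM2l//.
by apply: pow_le => //; lia.
Qed.

Let semQ L J e1 : semb L e1 G1 -> semb L (maxn (L + L + d) e1) (Q J).
Proof.
move=> h1; have sW := semb_mono (leq_maxl _ e1) (semb_wf L (Cc_moyal 0 cA cc)).
have sS' := semb_mono (leq_maxl _ e1) (semS L J).
have sT := semb_comb (fun h _ => lexx (nC (1 : R[i]))) (sG 0) (sS J) sW sS'.
exact: (semb_comb (fun h _ => lexx (nC (- k))) (smf_comb _ (sG 0) (sS J)) sG1 sT (semb_mono (leq_maxr _ _) h1)).
Qed.

(** Solve the expansion for its leading term. The composition is O(h^oo) under u by hypothesis, the
    higher terms gain a factor h over the assumed bound, and the remainder is small by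
    interpolation. *)
Lemma ub_leading N e : (forall n, ub N e (wf (moyal n A c))) ->
  ub N.+1 e (fun h phi x => k * wf (moyal 0 A c) h phi x).
Proof.
move=> HG; have [L HL] := ub_small; have [e1 he1] := semb_wf2 L cA cc.
(* Neither seminorm exponent depends on the number of terms, so J can be chosen after them. *)
have [J HJ] := HL (maxn (L + L + d) e1) (d + d)%N N.+1.
have bQ : ub N.+1 0 (Q J) by exact: (HJ _ (sQ J) (semQ J he1) (supQ J)).
have bS : ub N.+1 e (S J).
  elim: (J) => [|j IH]; first by rewrite S0; exact: ub0.
  rewrite SS; have := @ub_comb N e 1 (co j) 1 (G j.+1) (S j) (@co_le j) (sG _) (sS j) (HG _).
  by rewrite addn1; apply.
have m0 F : ub N.+1 0 F -> ub N.+1 e F by apply: ub_mono; rewrite addn0 leq_addr.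
have bG1 : ub N.+1 e G1 by apply: m0; exact: ub_wf2.
have bT := ub_comb_cst (- k) (sS J) sG1 bS bG1.
have := ub_comb_cst (-1) (sQ J) (smf_comb _ (sS J) sG1) (m0 _ bQ) bT.
apply: ub_ext => h phi hh sp; apply/funext => x; rewrite /Q /comb -/(G 0).
by move: (G 0 h phi x) (S J h phi x) (G1 h phi x) => p q r; ring.
Qed.

End symbol.

(** At N = 0 the claim is the a priori bound of u on Weyl operators, which fixes e = 2L + d. In the
    step every symbol [moyal n A c] is supported in supp B, so the induction hypothesis applies to
    it. *)
Lemma ub_elliptic : exists e, forall N B, Cc_infty B -> (forall z, supp B z -> A z != 0) ->
  ub N e (wf B).
Proof.
have [L HL] := ub_semb; exists (L + L + d)%N; elim=> [|N IH] B cB BA.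
  by apply: HL; [exact: smf_wf|exact: semb_wf].
pose c z := k^-1 * (B z / A z).
have cc : Cc_infty c by apply: CcZ; exact: (Cc_div (proj1 cA) cB BA).
have cB' : supp c `<=` supp B.
  apply: supp_sub => z cz; apply: supp_neq0; apply: contraNneq cz => Bz.
  by rewrite /c Bz mul0r mulr0.
have HG n : ub N (L + L + d) (wf (moyal n A c)).
  by apply: IH; [exact: Cc_moyal|move=> z /moyal_supp/cB'; exact: BA].
have := ub_leading cc HG; apply: ub_ext => h phi hh sp; apply/funext => x.
have E : B = fun z => k * moyal 0 A c z.
  (* Where A vanishes, B does too, so the identity survives the convention for division by zero. *)
  apply/funext => z; rewrite /moyal /c; have [Az|Az] := eqVneq (A z) 0.
    have -> : B z = 0 by apply: notin_supp => /BA; rewrite Az eqxx.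
    by rewrite !mul0r !mulr0.
  by field; rewrite Az k_neq0.
have cP : Cc_infty (dilate h (moyal 0 A c)) by exact: (Cc_dilate (hneq0 hh) (Cc_moyal 0 cA cc)).
by rewrite /wf [in RHS]E -(weylZ k x cP (schwartz_decay sp)).
Qed.

End elliptic.

End distribution.

End operator_families.

(** * The L^2 norm of a distribution and its dual description *)

Section distribution_norm.
Context {R : realType} {d : nat}.
Local Notation mu := (lebesgue_rV R d).
Implicit Types (f phi psi : 'rV[R]_d -> R[i]) (u : ('rV[R]_d -> R[i]) -> R[i]) (h : R).

Lemma L2normE f : L2norm f = ((\int[mu]_x (nC (f x) ^+ 2)%:E) `^ 2^-1)%E.
Proof.
rewrite /L2norm unlock /=; congr (_ `^ _)%E; apply: eq_integral => x _.
by rewrite ger0_norm ?nC_ge0// powR_mulrn ?nC_ge0.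
Qed.

Lemma L2norm_sqi f : sqi mu f -> L2norm f = (n2 f)%:E.
Proof.
move=> [mf sf]; rewrite L2normE -(fineK (integrable_fin_num measurableT sf)) poweR_EFin.
rewrite powR12_sqrt//; apply: fine_ge0; apply: integral_ge0 => x _.
by rewrite lee_fin sqr_ge0.
Qed.

Lemma L2_sqi f : L2 f -> sqi mu f.
Proof.
move=> [mf fy]; split => //; apply: ge0_integrable.
- by apply: measurable_funX; exact: cmeas_nC.
- by move=> x; exact: sqr_ge0.
- move: fy; rewrite L2normE; case: (integral _ _ _) => [r _||_] //; first exact: ltry.
  by rewrite poweRyr ?invr_neq0// pnatr_eq0.
Qed.

Lemma sqi_L2 f : sqi mu f -> L2 f.
Proof. by move=> sf; split; [case: sf|rewrite L2norm_sqi// ltry]. Qed.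

Lemma schwartz_sqi phi : schwartz phi -> sqi mu phi.
Proof.
by move=> /schwartz_decay dp; split; [case: dp|exact: decay_sq].
Qed.

Lemma represents_bound f u phi : L2 f -> represents f u -> schwartz phi ->
  nC (u phi) <= 2 * n2 f * n2 phi.
Proof.
move=> Lf rf sp; rewrite rf//; have [mf sf] := L2_sqi Lf; have [mp sq] := schwartz_sqi sp.
have i2 := integrable_M2 (cmeas_nC mf) (cmeas_nC mp) sf sq.
have i3 : cinteg mu (fun x => f x * phi x).
  by apply: (cinteg_dom _ _ i2); [exact: cmeasM|move=> x; rewrite nCM].
apply: le_trans (nC_Cint_le i3 _ i2) _; first by move=> x; rewrite nCM.
by rewrite -mulrA ler_wpM2l//; apply: norm2_cs => //; exact: cmeas_nC.
Qed.

Definition Obound (v : R -> ('rV[R]_d -> R[i]) -> R[i]) : Prop :=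
  forall N : nat, exists2 C : R, 0 <= C & forall h phi, 0 < h <= 1 -> schwartz phi ->
    nC (v h phi) <= C * h ^+ N * n2 phi.

(** A finite bound on the infimum yields a representing L^2 function of nearly that norm, and
    Cauchy-Schwarz concludes. *)
Lemma bigO_Obound v : bigO_hinfty (fun h => distr_L2norm (v h)) -> Obound v.
Proof.
move=> H N; have := H N; set S := ereal_sup _ => Sy.
have ub h : 0 < h <= 1 -> ((h ^- N)%:E * `|distr_L2norm (v h)| <= S)%E.
  by move=> hh; apply: ereal_sup_ubound; exists h => //=; rewrite in_itv.
have S0 : (0 <= S)%E.
  apply: le_trans (ub 1 _); last by rewrite ltr01 lexx.
  by rewrite mule_ge0 ?lee_fin ?invr_ge0 ?exprn_ge0.
have [s sE] : exists s : R, S = s%:E.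
  by move: S0 Sy; case: (S) => // s _ _; exists s.
have s0 : 0 <= s by rewrite -lee_fin -sE.
exists (2 * (s + 1)); first by rewrite mulr_ge0// addr_ge0.
move=> h phi hh sp; have [h0 h1] := andP hh.
have hN : 0 < h ^+ N by exact: exprn_gt0.
(* Replacing s by s + 1 makes the inequality strict, so that a representative can be extracted
   although the infimum may not be attained. *)
have : (distr_L2norm (v h) < ((s + 1) * h ^+ N)%:E)%E.
  apply: (@le_lt_trans _ _ (s * h ^+ N)%:E); last by rewrite lte_fin ltr_pM2r// ltrDl.
  have := ub h hh; rewrite sE; case: (distr_L2norm (v h)) => [r||] //=.
  - by rewrite !lee_fin mulrC ler_pdivrMr//; apply: le_trans; exact: ler_norm.
  - by rewrite gt0_muley ?lte_fin ?invr_gt0.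
  - by rewrite leNye.
move=> lt; have [_ [f [Lf rf] <-]] := ereal_inf_lt lt; rewrite (L2norm_sqi (L2_sqi Lf)) lte_fin => fh.
apply: le_trans (represents_bound Lf rf sp) _.
by rewrite ler_wpM2r ?n2_ge0// -mulrA ler_wpM2l// ltW.
Qed.

(** For each h, [riesz] on the space of Schwartz functions supplies an L^2 representative whose norm
    is at most 3 times the bound. *)
Lemma Obound_bigO v : (forall h, 0 < h <= 1 -> forall c phi psi, schwartz phi -> schwartz psi ->
    v h (fun x => c * phi x + psi x) = c * v h phi + v h psi) ->
  Obound v -> bigO_hinfty (fun h => distr_L2norm (v h)).
Proof.
move=> vlin H N; have [C C0 HC] := H N.
apply: (@le_lt_trans _ _ (3 * (C + 1))%:E); last exact: ltry.
apply: ge_ereal_sup => y [h hI <-]; move: hI; rewrite /= in_itv/= => hh; have [h0 h1] := andP hh.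
have hN : 0 < h ^+ N by exact: exprn_gt0.
(* C may be 0, while [riesz] asks for a positive constant; hence C + 1. *)
have K0 : 0 < (C + 1) * h ^+ N by rewrite mulr_gt0// ltr_wpDl.
have [] := @riesz _ _ _ mu (@schwartz R d) (v h) ((C + 1) * h ^+ N) (@schwartz0 R d) (@schwartz_comb R d)
  schwartz_sqi (vlin h hh) K0 _.
  move=> phi sp; apply: le_trans (HC h phi hh sp) _.
  by rewrite ler_wpM2r ?n2_ge0// ler_wpM2r ?lerDl// ltW.
move=> g sg [gC Hg].
have D0 : (0 <= distr_L2norm (v h))%E.
  by apply: le_ereal_inf_tmp => _ [f _ <-]; exact: Lnorm_ge0.
have D1 : (distr_L2norm (v h) <= (3 * ((C + 1) * h ^+ N))%:E)%E.
  apply: (@le_trans _ _ (L2norm g)); last by rewrite L2norm_sqi.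
  by apply: ereal_inf_lbound; exists g => //; split; [exact: sqi_L2|exact: Hg].
rewrite gee0_abs//; apply: le_trans (lee_wpmul2l _ D1) _; first by rewrite lee_fin invr_ge0 ltW.
by rewrite -EFinM lee_fin mulrC -!mulrA mulfV ?mulr1// gt_eqF.
Qed.

Lemma supp_reflect (b : 'rV[R]_(d + d) -> R[i]) z :
  supp (reflect_xi b) z -> supp b (row_mx (lsubmx z) (- rsubmx z)).
Proof.
pose s z : 'rV[R]_(d + d) := row_mx (lsubmx z) (- rsubmx z).
pose c := fun i : 'I_(d + d) => if fintype.split i is inl _ then 1 else -1 : R.
have sE : s = scale_coord c.
  apply/funext => w; apply/rowP => i; rewrite /s /c.
  case: (split_ordP i) => j ->; rewrite !(row_mxEl, row_mxEr) !mxE.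
    by rewrite (unsplitK (inl j)) mul1r.
  by rewrite (unsplitK (inr j)) mulN1r.
have cl : closed (s @^-1` supp b).
  rewrite sE; apply: closed_comp; last exact: closed_closure.
  by move=> w _; exact: scale_coord_continuous.
have sub : [set z | reflect_xi b z != 0] `<=` s @^-1` supp b by move=> w; exact: (@supp_neq0 _ _ b (s w)).
by move/closure_id: cl => cl /(closure_subset sub); rewrite -cl.
Qed.

End distribution_norm.

Theorem theoremA8 (R : realType) (d : nat)
    (u : ('rV[R]_d -> R[i]) -> R[i]) (hu : tempered u)
    (a : 'rV[R]_(d + d) -> R[i]) (ha : Cc_infty a)
    (z0 : 'rV[R]_(d + d)) (hz0 : z0 != 0) (haz0 : a z0 = 1)
    (hau : bigO_hinfty (fun h => distr_L2norm (weyl_distr (dilate h a) u))) :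
  exists U : set 'rV[R]_(d + d),
    [/\ nbhs z0 U, compact (closure U) &
      forall b : 'rV[R]_(d + d) -> R[i], Cc_infty b -> supp b `<=` U ->
        bigO_hinfty (fun h => distr_L2norm (weyl_distr (dilate h b) u))].
Proof.
have cA := Cc_reflect ha.
(* Duality replaces a by its reflection, which takes the value 1 at the reflected point; this
   supplies the regularising symbol for Fourier inversion. *)
have [kc kc0 kcE] := @hat_convolution_const R d (reflect_xi a) (row_mx (lsubmx z0) (- rsubmx z0)) cA
  (etrans (congr1 (fun f => f z0) (reflect_xiK a)) haz0).
have HA N : ub u N 0 (wf (reflect_xi a)).
  have [C C0 H] := bigO_Obound hau N; exists C => // h phi hh sp.
  rewrite expr0 invr1 mulr1; have := H h phi hh sp.
  by rewrite /weyl_distr reflect_dilate.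
have [e He] := ub_elliptic hu kc0 kcE cA HA.
have ca : continuous (fun z => complex.Re (a z)) by exact: (@smooth_continuous _ _ _ (proj1 (proj1 ha))).
(* This set contains z0, is open by continuity, and avoids the zeros of a, so its closure lies in
   the compact support of a. *)
exists [set z | 2^-1 < complex.Re (a z)]; split.
- apply: (ca z0 [set r | 2^-1 < r]); apply: open_nbhs_nbhs; split; first exact: open_gt.
  by rewrite /= haz0 /= invf_lt1// ltr1n.
- apply: subclosed_compact (proj2 ha) _; first exact: closed_closure.
  apply: closure_subset => z /= az; apply: contraTneq az => ->.
  by rewrite /= -leNgt invr_ge0.
move=> b cb bU; apply: Obound_bigO.
  move=> h hh c phi psi sp sq; rewrite /weyl_distr reflect_dilate.
  have cB := Cc_dilate (hneq0 hh) (Cc_reflect cb).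
  have sW f : schwartz f -> schwartz (weyl (dilate h (reflect_xi b)) f).
    by move=> sf; exact: (schwartz_weyl cB (schwartz_decay sf)).
  rewrite (weyl_lin c cB (schwartz_decay sp) (schwartz_decay sq)).
  by have [ulin _] := hu; apply: ulin; exact: sW.
(* Asking for N + e powers cancels the fixed loss h^-e. *)
move=> N; have [|C C0 H] := He (N + e)%N (reflect_xi b) (Cc_reflect cb).
  move=> z /supp_reflect/bU /=; rewrite /reflect_xi => az; apply: contraTneq az => ->.
  by rewrite /= -leNgt invr_ge0.
exists C => // h phi hh sp; have := H h phi hh sp; have [h0 h1] := andP hh.
rewrite /weyl_distr reflect_dilate /wf exprD mulfK//.
by rewrite expf_neq0// gt_eqF.
Qed.
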